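(* Let $K=\bigcup_{j=1}^{k_0}\gamma_j\subset\mathbf{C}$ be a finite union of $C^2$ smooth Jordan arcs $\gamma_1,\dots,\gamma_{k_0}$ with $\gamma_j\cap\gamma_k=\emptyset$ for $j\neq k$. Then there exist a rational function $F$ and a domain $G\subset\mathbf{C}_\infty$ such that $\mathbf{C}\setminus G$ is a compact set with $k_0$ components, $\partial(\mathbf{C}_\infty\setminus G)=\partial G$ is a union of finitely many smooth Jordan curves, and $F$ is a conformal bijection from $G$ onto $\mathbf{C}_\infty\setminus K$ with $F(\infty)=\infty$. Furthermore, if $K$ is analytic (that is, every $\gamma_j$ is an analytic Jordan arc), then $\partial G$ is analytic too (that is, it is a union of finitely many analytic Jordan curves).
   Context: $\mathbf{C}_\infty=\mathbf{C}\cup\{\infty\}$ is the extended complex plane. A $C^2$ smooth (respectively analytic) Jordan arc is the image of a compact interval under an injective $C^2$ (respectively real-analytic, up to and including the endpoints) map into $\mathbf{C}$ with nowhere vanishing derivative. A smooth (respectively analytic) Jordan curve is the image of the unit circle under an injective $C^1$ (respectively real-analytic) map into $\mathbf{C}$ with nowhere vanishing derivative. *)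

(* Defs.v *)
(* MathComp-Analysis, with C = R[i] over an arbitrary R : realType. *)
From HB Require Import structures.
From mathcomp Require Import all_boot all_order all_algebra.
From mathcomp Require Import all_classical all_reals all_analysis.
From mathcomp Require Import complex.
Set Implicit Arguments.
Unset Strict Implicit.
Unset Printing Implicit Defensive.
Import Order.TTheory GRing.Theory Num.Theory numFieldNormedType.Exports.
Local Open Scope classical_set_scope.
Local Open Scope ring_scope.
Local Open Scope complex_scope.

(* [numFieldNormedType] equips abstract number fields with their norm topology,
   but not the concrete type [R[i]]; same construction here. *)
#[non_forgetful_inheritance]
HB.instance Definition _ (R : realType) := GRing.ComAlgebra.copy R[i] R[i]^o.
#[non_forgetful_inheritance]
HB.instance Definition _ (R : realType) := Vector.copy R[i] R[i]^o.
#[non_forgetful_inheritance]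
HB.instance Definition _ (R : realType) := NormedModule.copy R[i] R[i]^o.

(* The extended complex plane: [Some z] is the finite point z, [None] is oo. *)
Notation Cinf R := (one_point_compactification R[i]).

Definition boundary (T : topologicalType) (A : set T) : set T :=
  closure A `\` A°.

Section Sphere.
Variable R : realType.
Implicit Types (F : Cinf R -> Cinf R) (z : Cinf R).

(* p / q extended to the sphere, for coprime p and q != 0.  The value at oo is
   the limit of p / q: the coefficient of p of index deg q vanishes when
   deg p < deg q, and is lead_coef p when deg p = deg q. *)
Definition ratfun_val (p q : {poly R[i]}) z : Cinf R :=
  match z with
  | Some w => if q.[w] == 0 then None else Some (p.[w] / q.[w])
  | None => if (size q < size p)%N then None
            else Some (p`_(size q).-1 / lead_coef q)
  end.

Definition rational_function F : Prop :=
  exists p q : {poly R[i]},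
    [/\ q != 0, coprimep p q & forall z, F z = ratfun_val p q z].

Definition sphere_inv z : Cinf R :=
  match z with
  | Some w => if w == 0 then None else Some w^-1
  | None => Some 0
  end.

(* The coordinate map centred on z0: z itself near a finite z0, 1/z near oo.
   Both are involutions, so [chart z0] is also its own inverse. *)
Definition chart (z0 z : Cinf R) : Cinf R :=
  if z0 is Some _ then z else sphere_inv z.

Definition chart_coord z0 : R[i] := odflt 0 (chart z0 z0).

(* F read in the charts at z0 and F z0; the default 0 is only reached outside
   the domain of the target chart, hence not near [chart_coord z0] when F is
   continuous at z0. *)
Definition local_expr F (z0 : Cinf R) (w : R[i]) : R[i] :=
  odflt 0 (chart (F z0) (F (chart z0 (Some w)))).

Definition conformal_at F (z0 : Cinf R) : Prop :=
  [/\ {for z0, continuous F},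
      derivable (local_expr F z0) (chart_coord z0) 1 &
      derive1 (local_expr F z0) (chart_coord z0) != 0].

Definition conformal_bijection F (A B : set (Cinf R)) : Prop :=
  set_bij A B F /\ (forall z, A z -> conformal_at F z).

Definition domain (G : set (Cinf R)) : Prop :=
  [/\ open G, connected G & G !=set0].

End Sphere.

Section Curves.
Variable R : realType.
Implicit Types (D : set R) (g : R -> R[i]).

(* Derivative along D; one-sided at the endpoints of a compact interval. *)
Definition is_deriv_on D g (g' : R -> R[i]) : Prop :=
  forall t, D t ->
    (fun s => (g s - g t) / (s - t)%:C) @ within D t^' --> g' t.

Definition C1_regular_on D g : Prop :=
  exists g1 : R -> R[i],
    [/\ is_deriv_on D g g1, {within D, continuous g1} &
        forall t, D t -> g1 t != 0].

Definition C2_regular_on D g : Prop :=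
  exists g1 g2 : R -> R[i],
    [/\ is_deriv_on D g g1, is_deriv_on D g1 g2, {within D, continuous g2} &
        forall t, D t -> g1 t != 0].

Definition real_analytic_on D g : Prop :=
  forall t0, D t0 -> exists2 r : R, 0 < r & exists c : nat -> R[i],
    forall t, D t -> `|t - t0| < r ->
      series (fun n => c n * (t - t0)%:C ^+ n) @ \oo --> g t.

Definition analytic_regular_on D g : Prop :=
  real_analytic_on D g /\
  exists2 g1 : R -> R[i], is_deriv_on D g g1 & forall t, D t -> g1 t != 0.

Definition jordan_arc (reg : set R -> (R -> R[i]) -> Prop) (A : set R[i]) :
    Prop :=
  exists (a b : R) (g : R -> R[i]),
    [/\ a < b, set_inj `[a, b]%classic g, reg `[a, b]%classic g &
        A = g @` `[a, b]%classic].

Definition C2_jordan_arc : set R[i] -> Prop := jordan_arc C2_regular_on.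
Definition analytic_jordan_arc : set R[i] -> Prop :=
  jordan_arc analytic_regular_on.

Definition unit_circle : set R[i] := [set z | `|z| = 1].

(* Regularity of a map on the unit circle is that of t |-> f (exp (i t)). *)
Definition jordan_curve (reg : set R -> (R -> R[i]) -> Prop) (A : set R[i]) :
    Prop :=
  exists f : R[i] -> R[i],
    [/\ set_inj unit_circle f,
        reg setT (fun t => f (cos t +i* sin t)) &
        A = f @` unit_circle].

Definition smooth_jordan_curve : set R[i] -> Prop := jordan_curve C1_regular_on.
Definition analytic_jordan_curve : set R[i] -> Prop :=
  jordan_curve analytic_regular_on.

Definition finite_union_of (P : set R[i] -> Prop) (A : set (Cinf R)) : Prop :=
  exists (n : nat) (c : 'I_n -> set R[i]),
    (forall i, P (c i)) /\ A = Some @` (\bigcup_i c i).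

Definition components (A : set R[i]) : set (set R[i]) :=
  [set connected_component A x | x in A].

End Curves.

(* Main.v *)
Require Import Defs.
From HB Require Import structures.
From mathcomp Require Import all_boot all_order all_algebra.
From mathcomp Require Import all_classical all_reals all_analysis.
From mathcomp Require Import complex ring lra zify.
Import Order.TTheory GRing.Theory Num.Theory numFieldNormedType.Exports.
Local Open Scope classical_set_scope.
Local Open Scope ring_scope.
Local Open Scope complex_scope.
Set Implicit Arguments.
Unset Strict Implicit.
Unset Printing Implicit Defensive.

(* The Joukowski map J(w) = (a + b)/2 + (b - a)/4 (w + 1/w) opens one arc with
   end points a and b: off the arc, sqrt ((z - b) / (z - a)) has a continuous
   branch h with h(oo) = 1, and W = (1 + h)/(1 - h) is a right inverse of J. The
   image G of W is open, the preimage Gamma of the arc under J is invariant under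
   w -> 1/w, and the sphere is the disjoint union of G, Gamma and 1/G. The
   substitution x = cos t in a parametrization g of the arc on [-1, 1]
   desingularizes the end points and parametrizes Gamma as a smooth closed curve:
   one derivative is lost in the quotients (g x - g (+-1)) / (x -+ 1), whence the
   C^2 hypothesis. Locally Gamma has two sides; following them along Gamma from
   the fixed point 1 of w -> 1/w shows that one lies in G and the other in 1/G,
   so that Gamma is the boundary of G and both G and its complement are connected.

   Several arcs are opened successively. W is built from square roots, so it maps
   the remaining arcs to arcs of the same regularity; if F', G', W' open these,
   then F = J o F' and W' o W open all of them, with the domain of the w in G'
   such that F'(w) lies in G. *)

(** * The plane and the sphere *)

Section Modulus.
Variable R : realType.
Local Notation C := (R[i]).
Implicit Types z w : C.

(** The branch [h] must be built without knowing that the complement of an arc is connected, let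
    alone simply connected. For fixed z the root is therefore continued along the arc itself: the
    path x |-> (g x - z) / (g (-1) - z) avoids 0, starts at 1 and ends at the number whose root is
    wanted, so its lift through squaring selects [h] at z; continuity holds because the paths of
    nearby z have a quotient close to 1. The Jordan curve theorem is avoided as well: the two sides
    of Gamma are given globally as disjoint open sets, and only their connectedness is in question.
    If G were separated, one part would have no limit point on Gamma and would be clopen in the
    sphere. The same argument relative to a connected open set X, instead of the sphere, carries the
    induction over the arcs. Regularity is needed for C^1, C^2 and analytic maps at once, so it is
    proved for any class of functions stable under field operations and continuous square roots; for
    analytic functions this stability comes down to composing power series, by estimates on
    coefficients only. *)

Definition cmod (z : C) : R := Normc.normc z.

(** The norm of [R[i]] takes its values in [R[i]]; [cmod] is its real counterpart, for which the
    order is total and [lra] applies. *)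
Lemma normCE z : `|z| = (cmod z)%:C.
Proof. by rewrite normc_def /cmod; case: z. Qed.

Lemma cmod_ge0 z : 0 <= cmod z.
Proof. by case: z => a b; rewrite /cmod /= sqrtr_ge0. Qed.

Lemma cmod0 : cmod 0 = 0.
Proof. exact: Normc.normc0. Qed.

Lemma cmod1 : cmod 1 = 1.
Proof. exact: Normc.normc1. Qed.

Lemma cmod_eq0 z : (cmod z == 0) = (z == 0).
Proof.
apply/eqP/eqP => [|->]; last exact: cmod0.
exact: Normc.eq0_normc.
Qed.

Lemma cmod_gt0 z : (0 < cmod z) = (z != 0).
Proof. by rewrite lt_def cmod_ge0 andbT cmod_eq0. Qed.

Lemma cmodM z w : cmod (z * w) = cmod z * cmod w.
Proof. exact: Normc.normcM. Qed.

Lemma cmodV z : cmod z^-1 = (cmod z)^-1.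
Proof. exact: Normc.normcV. Qed.

Lemma cmodX z n : cmod (z ^+ n) = cmod z ^+ n.
Proof.
by elim: n => [|n IH]; rewrite ?expr0 ?cmod1// !exprS cmodM IH.
Qed.

Lemma cmodN z : cmod (- z) = cmod z.
Proof. by case: z => a b; rewrite /cmod /= !sqrrN. Qed.

Lemma cmodB z w : cmod (z - w) = cmod (w - z).
Proof. by rewrite -cmodN opprB. Qed.

Lemma cmodD z w : cmod (z + w) <= cmod z + cmod w.
Proof. exact: le_normcD. Qed.

Lemma cmodBD z w : cmod (z - w) <= cmod z + cmod w.
Proof. by rewrite (le_trans (cmodD _ _))// cmodN. Qed.

Lemma cmod_dist z w : cmod z - cmod w <= cmod (z - w).
Proof. by rewrite lerBlDr; have := cmodD (z - w) w; rewrite subrK. Qed.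

Lemma cmod_real (x : R) : cmod x%:C = `|x|.
Proof. by rewrite /cmod /= expr0n addr0 sqrtr_sqr. Qed.

Lemma cmod_Re z : `|complex.Re z| <= cmod z.
Proof.
case: z => a b; rewrite /cmod /= -sqrtr_sqr ler_sqrt ?lerDl ?sqr_ge0//.
by rewrite addr_ge0 ?sqr_ge0.
Qed.

Lemma cmod_Im z : `|complex.Im z| <= cmod z.
Proof.
case: z => a b; rewrite /cmod /= -sqrtr_sqr ler_sqrt ?lerDr ?sqr_ge0//.
by rewrite addr_ge0 ?sqr_ge0.
Qed.

Lemma cmod_le z : cmod z <= `|complex.Re z| + `|complex.Im z|.
Proof.
rewrite [z in cmod z]complexE (le_trans (cmodD _ _))// cmodM !cmod_real.
by rewrite /cmod /= expr0n expr1n add0r sqrtr1 mul1r.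
Qed.

Lemma nbhsCP z (A : set C) :
  nbhs z A <-> exists2 e, 0 < e & forall y, cmod (y - z) < e -> A y.
Proof.
split => [/nbhs_ballP [[e e']/=]|[e e0 eA]].
  rewrite ltcE /= => /andP[/eqP e'0 e0] eA; exists e => // y yz.
  apply: eA; rewrite -ball_normE /= -normrN opprB normCE ltcE /=.
  by rewrite e'0 eqxx.
apply/nbhs_ballP; exists e%:C; first by rewrite /= ltcR.
move=> y; rewrite -ball_normE /= -normrN opprB normCE ltcR.
exact: eA.
Qed.

Lemma cvgCP (T : Type) (F : set_system T) {FF : Filter F} (f : T -> C) (l : C) :
  f @ F --> l <-> forall e, 0 < e -> \forall x \near F, cmod (f x - l) < e.
Proof.
split => [fl e e0|fl A /nbhsCP [e e0 eA]].
  by apply: (fl [set y | cmod (y - l) < e]); apply/nbhsCP; exists e.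
by apply: filterS (fl e e0) => x; exact: eA.
Qed.

Lemma nbhsRP (x : R) (A : set R) :
  nbhs x A <-> exists2 e, 0 < e & forall y, `|y - x| < e -> A y.
Proof.
split => [/nbhs_ballP [e /= e0 eA]|[e e0 eA]].
  by exists e => // y yx; apply: eA; rewrite -ball_normE /= distrC.
by apply/nbhs_ballP; exists e => // y; rewrite -ball_normE /= distrC; exact: eA.
Qed.

Lemma dnbhsP (D : set R) (t : R) (A : set R) :
  within D t^' A <->
  exists2 e, 0 < e & forall s, `|s - t| < e -> s != t -> D s -> A s.
Proof.
split; first by move=> /nbhsRP [e e0 eA]; exists e.
by move=> [e e0 eA]; apply/nbhsRP; exists e => // y yt yt' Dy; exact: eA.
Qed.

Lemma withinRP (D : set R) (t : R) (A : set R) :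
  within D (nbhs t) A <->
  exists2 e, 0 < e & forall s, `|s - t| < e -> D s -> A s.
Proof.
split; first by move=> /nbhsRP [e e0 eA]; exists e.
by move=> [e e0 eA]; apply/nbhsRP; exists e => // y yt Dy; exact: eA.
Qed.

Lemma within_continuousCP (D : set R) (g : R -> C) :
  {within D, continuous g} <->
  forall t, D t -> g @ within D (nbhs t) --> g t.
Proof.
split => [cg t Dt|cg].
  have := cg t; rewrite /continuous_at; move=> h A /h.
  by rewrite /= /nbhs /= (nbhs_subspace_in Dt).
apply/subspace_continuousP => t Dt; exact: cg.
Qed.

Lemma continuous_Re : continuous (@complex.Re R).
Proof.
move=> z A /nbhsRP [e e0 eA]; apply/nbhsCP; exists e => // y yz.
by apply: eA; rewrite (le_lt_trans _ yz)// -raddfB cmod_Re.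
Qed.

Lemma continuous_cmod : continuous cmod.
Proof.
move=> z A /nbhsRP [e e0 eA]; apply/nbhsCP; exists e => // y yz.
apply: eA; rewrite (le_lt_trans _ yz)// ler_norml cmod_dist andbT.
by rewrite lerNl opprB (cmodB y) cmod_dist.
Qed.

Lemma cvg_complex (T : Type) (F : set_system T) (FF : Filter F) (f g : T -> R)
  (a b : R) : f @ F --> a -> g @ F --> b ->
  (fun x => f x +i* g x) @ F --> (a +i* b : C).
Proof.
move=> fa gb; apply/cvgCP => e e0.
have e2 : 0 < e / 2 by rewrite divr_gt0.
have fn : \forall x \near F, `|f x - a| < e / 2.
  by apply: (fa [set y | `|y - a| < e / 2]); apply/nbhsRP; exists (e / 2).
have gn : \forall x \near F, `|g x - b| < e / 2.
  by apply: (gb [set y | `|y - b| < e / 2]); apply/nbhsRP; exists (e / 2).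
apply: filterS2 fn gn => x fx gx; apply: le_lt_trans (cmod_le _) _.
by rewrite [ltRHS](splitr e) /= ltrD.
Qed.

Lemma cvg_RtoC (T : Type) (F : set_system T) (FF : Filter F) (f : T -> R)
  (a : R) : f @ F --> a -> (fun x => (f x)%:C) @ F --> a%:C.
Proof. by move=> fa; apply: cvg_complex => //; exact: cvg_cst. Qed.

Lemma compact_cmod (M : R) : compact [set z : C | cmod z <= M].
Proof.
pose sq : set (R * R) := `[- M, M]%classic `*` `[- M, M]%classic.
have csq : compact sq by apply: compact_setX; exact: segment_compact.
pose ph (p : R * R) : C := p.1 +i* p.2.
have cph : continuous ph.
  by move=> p; apply: cvg_complex; [exact: cvg_fst|exact: cvg_snd].
have cim : compact (ph @` sq).
  by apply: continuous_compact => //; exact: continuous_subspaceT.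
apply: (subclosed_compact _ cim).
  have -> : [set z | cmod z <= M] = cmod @^-1` [set x | x <= M] by [].
  by apply: closed_comp; [move=> z _; exact: continuous_cmod|exact: closed_le].
move=> z /= zM; exists (complex.Re z, complex.Im z); last by case: z zM.
split; rewrite /= in_itv /= -ler_norml; apply: le_trans zM.
  exact: cmod_Re.
exact: cmod_Im.
Qed.

Lemma hausdorffC : hausdorff_space C.
Proof. exact: norm_hausdorff. Qed.

Lemma compactC_bounded (A : set C) :
  compact A -> exists M, forall z, A z -> cmod z <= M.
Proof.
move=> cA; have cB : compact (cmod @` A).
  apply: continuous_compact => //; apply: continuous_subspaceT.
  exact: continuous_cmod.
have [M [Mr MB]] := compact_bounded cB.
exists (M + 1) => z Az; have := MB (M + 1).
rewrite ltrDl ltr01 => /(_ isT (cmod z)) h.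
by rewrite -[cmod z]ger0_norm ?cmod_ge0// h//; exists z.
Qed.

End Modulus.

Arguments cmod {R} z : simpl never.

Section Sphere.
Variable R : realType.
Local Notation C := (R[i]).
Local Notation S := (Cinf R).

Lemma nbhs_infP (A : set S) : nbhs (None : S) A <->
  A None /\ exists M, forall z : C, M < cmod z -> A (Some z).
Proof.
split=> [[U [cU _] UA]|[AN [M MA]]].
  split; first by apply: UA; right.
  have [M MU] := compactC_bounded cU; exists M => z Mz.
  apply: UA; left; exists z => // /MU.
  by rewrite leNgt Mz.
exists [set z : C | cmod z <= M].
  split; first exact: compact_cmod.
  by apply: (compact_closed (@hausdorffC R)); exact: compact_cmod.
move=> _ [[z /= /negP + <-]|-> //].
by rewrite -ltNge; exact: MA.
Qed.

Lemma nbhs_finP (z : C) (A : set S) :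
  nbhs (Some z : S) A <-> nbhs z (fun w : C => A (Some w)).
Proof. by []. Qed.

Lemma hausdorffS : hausdorff_space S.
Proof.
apply: one_point_compactification_hausdorff; last exact: hausdorffC.
move=> z _; rewrite withinET; exists [set w | cmod w <= cmod z + 1].
  apply/nbhsCP; exists 1 => // y yz /=.
  by have := cmodD (y - z) z; rewrite subrK; lra.
split=> //; first exact: compact_cmod.
by apply: (compact_closed (@hausdorffC R)); exact: compact_cmod.
Qed.

Lemma compactS : compact [set: S].
Proof. exact: one_point_compactification_compact. Qed.

Lemma closedS_compact (A : set S) : closed A -> compact A.
Proof. by move=> cA; exact: subclosed_compact cA compactS _. Qed.

Lemma sphere_invK : involutive (@sphere_inv R).
Proof.
case=> [w|] /=; last by rewrite eqxx.
by case: (eqVneq w 0) => [->//|w0] /=; rewrite invr_eq0 (negPf w0) invrK.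
Qed.

Lemma continuous_sphere_inv : continuous (@sphere_inv R).
Proof.
case=> [w|] /=; last first.
  move=> A /nbhsCP [e e0 eA]; apply/nbhs_infP; split => /=.
    by apply: eA; rewrite subr0 cmod0.
  exists e^-1 => z ez; rewrite /= ifN; last first.
    by rewrite -cmod_gt0 (lt_trans _ ez)// invr_gt0.
  by apply: eA; rewrite subr0 cmodV invf_plt ?posrE// (lt_trans _ ez)// invr_gt0.
case: (eqVneq w 0) => [->|w0] A; rewrite /continuous_at /= ?eqxx.
  move=> /nbhs_infP [AN [M MA]]; apply/nbhs_finP/nbhsCP.
  exists (`|M| + 1)^-1; first by rewrite invr_gt0 ltr_wpDl.
  move=> y; rewrite subr0 => yM /=; case: eqVneq => [//|y0]; apply: MA.
  rewrite cmodV (le_lt_trans (ler_norm M))//.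
  rewrite (lt_trans (_ : _ < `|M| + 1)) ?ltrDl//.
  by rewrite invf_pgt ?posrE ?cmod_gt0 ?ltr_wpDl.
rewrite (negPf w0) => /nbhs_finP => nA; apply/nbhs_finP.
have cV : (fun x : C => x^-1) @ nbhs w --> w^-1 by exact: inv_continuous.
have nz : \forall x \near nbhs w, x != 0.
  apply/nbhsCP; exists (cmod w); first by rewrite cmod_gt0.
  move=> y; apply: contraTneq => ->.
  by rewrite sub0r cmodN ltxx.
have nV : nbhs w (fun x : C => A (Some x^-1)) by exact: cV nA.
apply: filterS2 nV nz => x h x0 /=.
by rewrite (negPf x0).
Qed.

(** The plane is a union of lines through 0, and the sphere is the closure of the plane. *)
Lemma connectedS : connected [set: S].
Proof.
have cC : connected [set: C].
  rewrite [X in connected X](_ : _ =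
     \bigcup_(z in [set: C]) ((fun t : R => t%:C * z) @` [set: R])).
    apply: bigcup_connected.
      by exists 0 => z _; exists 0; rewrite ?mul0r.
    move=> z _; apply: connected_continuous_connected.
      exact/connected_intervalP.
    apply: continuous_subspaceT => t.
    by apply: cvgM; [exact: cvg_RtoC|exact: cvg_cst].
  by apply/seteqP; split => // z _; exists z => //; exists 1; rewrite ?mul1r.
have cI : connected (Some @` [set: C] : set S).
  apply: connected_continuous_connected => //; apply: continuous_subspaceT.
  exact: one_point_compactification_some_continuous.
rewrite (_ : [set: S] = closure (Some @` [set: C] : set S)).
  exact: connected_closure.
apply/seteqP; split => // -[z|] _; first by apply: subset_closure; exists z.
move=> A /nbhs_infP [_ [M MA]]; exists (Some (`|M| + 1)%:C).
split; first by exists (`|M| + 1)%:C.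
apply: MA; rewrite cmod_real ger0_norm ?addr_ge0// (le_lt_trans (ler_norm M))//.
by rewrite ltrDl.
Qed.

Lemma compact_complement (G : set S) :
  open G -> G None -> compact [set z : C | ~ G (Some z)].
Proof.
move=> oG GN; have /nbhs_infP [_ [M MG]] : nbhs (None : S) G.
  by rewrite nbhsE; exists G.
apply: (subclosed_compact _ (@compact_cmod R M)).
  have -> : [set z : C | ~ G (Some z)] = ~` (Some @^-1` G) by [].
  apply: open_closedC; apply: (@open_comp _ _ (Some : C -> S)) => // x _.
  exact: one_point_compactification_some_continuous.
by move=> z /= nG; rewrite leNgt; apply/negP => /MG.
Qed.

Lemma boundary_setC (A : set S) : boundary (~` A) = boundary A.
Proof.
rewrite /boundary; apply/seteqP; split => x [].
  rewrite closure_setC => h1; rewrite interiorC => /contrapT h2; split => //.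
rewrite closure_setC => h1 h2; split; first exact: h2.
by rewrite interiorC => h; apply: h.
Qed.

Lemma boundary_open (A : set S) : open A -> boundary A = closure A `\` A.
Proof. by rewrite openE /boundary => oA; rewrite (interior_id _).1. Qed.

End Sphere.

(** * Continuous square roots *)

Section PrincipalSqrt.
Variable R : realType.
Local Notation C := (R[i]).
Implicit Types z w : C.

(** z + |z| bisects the angle between z and the positive axis, and its squared modulus is 2 |z| (|z|
    + Re z). The formula is explicit, so continuity on the right half plane needs no argument
    function. *)
Definition psqrt z : C :=
  (z + (cmod z)%:C) / (Num.sqrt (2 * (cmod z + complex.Re z)))%:C.

Lemma cmodE z : (cmod z) ^+ 2 = complex.Re z ^+ 2 + complex.Im z ^+ 2.
Proof. by case: z => a b; rewrite /cmod /= sqr_sqrtr // addr_ge0 ?sqr_ge0. Qed.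

Lemma psqrt_sqr z : 0 < complex.Re z -> psqrt z ^+ 2 = z.
Proof.
move=> z0; have p0 : 0 < 2 * (cmod z + complex.Re z).
  by rewrite mulr_gt0 // ltr_wpDl // cmod_ge0.
rewrite /psqrt expr_div_n -[X in _ / X]rmorphXn /= sqr_sqrtr ?ltW//.
apply/(canLR (mulfK _)); first by rewrite eq_complex /= eqxx andbT gt_eqF.
have := cmodE z; move: p0 (cmod_ge0 z); move: (cmod z) => m.
case: z {z0} => a b /= p0 m0 m2.
apply/eqP; rewrite expr2 eq_complex /=; apply/andP; split; apply/eqP; nra.
Qed.

Lemma psqrt1 : psqrt 1 = 1.
Proof.
rewrite /psqrt cmod1 /= (_ : 2 * (1 + 1) = 2 ^+ 2 :> R); last by ring.
rewrite sqrtr_sqr ger0_norm // -[1%:C]/(1:C) rmorphD /= -[1%:C]/(1:C) divff //.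
Qed.

Lemma continuous_psqrt z : 0 < complex.Re z -> {for z, continuous psqrt}.
Proof.
move=> z0; have p0 : 0 < 2 * (cmod z + complex.Re z).
  by rewrite mulr_gt0 // ltr_wpDl // cmod_ge0.
have cz : psqrt @ nbhs z --> psqrt z; last exact: cz.
apply: cvgM.
  apply: cvgD; first exact: cvg_id.
  by apply: cvg_RtoC; exact: continuous_cmod.
apply: cvgV; first by rewrite eq_complex /= eqxx andbT gt_eqF // sqrtr_gt0.
apply: cvg_RtoC.
apply: (@continuous_comp _ _ _ (fun z => 2 * (cmod z + complex.Re z)) Num.sqrt).
  have c2 : (fun z => 2 * (cmod z + complex.Re z)) @ nbhs z -->
      2 * (cmod z + complex.Re z); last exact: c2.
  apply: cvgM; first exact: cvg_cst.
  by apply: cvgD; [exact: continuous_cmod|exact: continuous_Re].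
exact: sqrt_continuous.
Qed.

Lemma Re_gt0_ball z : cmod (z - 1) < 1 -> 0 < complex.Re z.
Proof.
move=> h; have := le_lt_trans (cmod_Re _) h.
by rewrite raddfB /= ltr_norml; lra.
Qed.

Lemma Re_psqrt_gt0 z : 0 < complex.Re z -> 0 < complex.Re (psqrt z).
Proof.
move=> z0; have p0 : 0 < 2 * (cmod z + complex.Re z).
  by rewrite mulr_gt0 // ltr_wpDl // cmod_ge0.
rewrite /psqrt -(fmorphV (real_complex R)) /=.
have : 0 < (Num.sqrt (2 * (cmod z + complex.Re z)))^-1 by rewrite invr_gt0 sqrtr_gt0.
have := cmod_ge0 z; set u := (Num.sqrt _)^-1; move: u => u; move: (cmod z) => m.
case: z z0 {p0} => a b /= a0 m0 u0.
by rewrite mulr0 subr0 mulr_gt0// ltr_wpDr.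
Qed.

End PrincipalSqrt.

Section Lifting.
Variable R : realType.
Local Notation C := (R[i]).
Local Notation I := (`[(- 1), 1]%classic : set R).

(** The retraction of the line onto [I], which turns continuity within [I] into continuity
    everywhere. *)
Definition clamp (x : R) : R := Num.max (- 1) (Num.min x 1).

Lemma dist_min (x y c : R) : `|Num.min x c - Num.min y c| <= `|x - y|.
Proof.
rewrite /Num.min; case: ltP => h1; case: ltP => h2 //.
- by rewrite ler_norml; case: (ler0P (x - y)); lra.
- by rewrite ler_norml; case: (ler0P (x - y)); lra.
- by rewrite subrr normr0.
Qed.

Lemma dist_max (x y c : R) : `|Num.max c x - Num.max c y| <= `|x - y|.
Proof.
rewrite /Num.max; case: ltP => h1; case: ltP => h2 //.
- by rewrite ler_norml; case: (ler0P (x - y)); lra.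
- by rewrite ler_norml; case: (ler0P (x - y)); lra.
- by rewrite subrr normr0.
Qed.

Lemma lipschitz1_continuous (f : R -> R) :
  (forall x y, `|f x - f y| <= `|x - y|) -> continuous f.
Proof.
move=> fl x A /nbhsRP [e e0 eA]; apply/nbhsRP; exists e => // y yx.
exact/eA/(le_lt_trans (fl _ _)).
Qed.

Lemma continuous_clamp : continuous clamp.
Proof.
apply: lipschitz1_continuous => x y.
by rewrite (le_trans (dist_max _ _ _))// dist_min.
Qed.

Lemma clamp_in x : I (clamp x).
Proof.
rewrite /= in_itv /= /clamp /Num.max /Num.min.
by case: (ltP x 1) => h; case: ltP; lra.
Qed.

Lemma clamp_id x : I x -> clamp x = x.
Proof.
rewrite /= in_itv /= /clamp /Num.max /Num.min.
by case: (ltP x 1) => h; case: ltP; lra.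
Qed.

Lemma continuous_comp_clamp (T : topologicalType) (f : R -> T) :
  {within I, continuous f} -> continuous (f \o clamp).
Proof.
move=> /subspace_continuousP cf x A /(cf _ (clamp_in x)) nA.
have {}nA : nbhs (clamp x) (fun y => I y -> A (f y)) by exact: nA.
have nB : nbhs x (fun y => I (clamp y) -> A (f (clamp y))).
  exact: continuous_clamp nA.
apply: (filterS _ nB) => y /= h.
exact/h/clamp_in.
Qed.

Lemma continuous_prod (n : nat) (F : nat -> R -> C) :
  (forall k, continuous (F k)) -> continuous (fun x => \prod_(0 <= k < n) F k x).
Proof.
move=> cF; elim: n => [|n IH] x.
  rewrite /continuous_at big_nil [X in X @ _](_ : _ = fun=> 1); first exact: cvg_cst.
  by apply/funext => y; rewrite big_nil.
rewrite /continuous_at big_nat_recr //= [X in X @ _](_ : _ =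
   fun x => (\prod_(0 <= k < n) F k x) * F n x); last first.
  by apply/funext => y; rewrite big_nat_recr.
by apply: cvgM; [exact: IH|exact: cF].
Qed.

(** The disc of radius 1 about 1 lies in the half plane where [psqrt] is a continuous root;
    compactness of [I] makes the step size uniform. *)
Lemma uniform_ratio (f : R -> C) : continuous f -> (forall x, f x != 0) ->
  exists2 e, 0 < e & forall x y, I x -> `|y - x| < e -> cmod (f y / f x - 1) < 1.
Proof.
move=> cf f0.
have := (compact_near_coveringP I).1 (@segment_compact R (- 1) 1) R (nbhs 0)
   (fun d x => forall y, `|y - x| <= `|d| -> cmod (f y / f x - 1) < 1) _.
case.
  move=> x0 Ix; set x : R := x0.
  have cq : (fun p : R * R => f p.2 / f p.1) @ nbhs (x, x) --> f x / f x.
    apply: cvgM; first by apply: continuous_comp (cf x); exact: cvg_snd.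
    apply: cvgV => //.
    by apply: continuous_comp (cf x); exact: cvg_fst.
  rewrite divff // in cq.
  have cq' : forall e, 0 < e -> \forall p \near nbhs (x, x), cmod (f p.2 / f p.1 - 1) < e.
    by apply/cvgCP; exact: cq.
  have [[U V] [/= nU nV UV]] := cq' 1 ltr01.
  move/nbhsRP : nU => [d1 d10 dU]; move/nbhsRP : nV => [d2 d20 dV].
  exists (ball x (Num.min d1 (d2 / 2)), ball 0 (d2 / 2)).
    split; apply: nbhsx_ballx; rewrite ?lt_min ?d10 ?divr_gt0//.
  move=> [x' d] /=; rewrite -!ball_normE /= lt_min => -[/andP[h1 h2]].
  rewrite sub0r normrN => h3 y yx.
  apply: (UV (x', y)); split => /=.
    by apply: dU; rewrite distrC.
  apply: dV; rewrite (_ : y - x = (y - x') + (x' - x)); last by ring.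
  rewrite (le_lt_trans (ler_normD _ _))// (distrC x').
  by rewrite [ltRHS](splitr d2) ltrD// (le_lt_trans yx).
move=> e /= e0 he; exists (e / 2); first by rewrite divr_gt0.
move=> x y Ix yx; apply: (he (e / 2)) => //.
  by rewrite /= sub0r normrN gtr0_norm ?divr_gt0// ltr_pdivrMr// ltr_pMr// ltr1n.
by rewrite (le_trans (ltW yx))// ler_norm.
Qed.

Lemma continuous_sqrt_lift (f : R -> C) (s0 : C) :
  {within I, continuous f} -> (forall x, I x -> f x != 0) ->
  s0 ^+ 2 = f (- 1) ->
  exists s : R -> C, [/\ continuous s, s (- 1) = s0 &
    forall x, I x -> s x ^+ 2 = f x].
Proof.
move=> cf f0 s0E; set F := f \o clamp.
have cF : continuous F by exact: continuous_comp_clamp.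
have F0 x : F x != 0 by apply/f0/clamp_in.
have [e e0 he] := uniform_ratio cF F0.
pose n := (Num.trunc (2 / e)).+1.
have ne : 2 / n%:R < e.
  have : 2 / e < n%:R by rewrite /n; exact: truncnS_gt.
  by rewrite ltr_pdivrMr// mulrC ltr_pdivrMr.
have n0 : (0 : R) < n%:R by rewrite ltr0n.
pose X k : R := -1 + 2 * k%:R / n%:R.
pose m k x := Num.min x (X k).
have X0 : X 0%N = -1 by rewrite /X mulr0 mul0r addr0.
have Xn : X n = 1 by rewrite /X mulfK ?gt_eqF//; lra.
have Xmono k : X k < X k.+1 /\ X k.+1 - X k < e.
  rewrite (_ : X k.+1 = X k + 2 / n%:R); last first.
    by rewrite /X -natr1; field; rewrite gt_eqF.
  split; last by rewrite addrAC subrr add0r.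
  by rewrite ltrDl divr_gt0.
have Xle k : -1 <= X k by rewrite /X lerDl divr_ge0 // mulr_ge0.
have key k x : (k < n)%N -> cmod (F (m k.+1 x) / F (m k x) - 1) < 1.
  move=> kn; have [h1 h2] := Xmono k.
  have [hx|hx] := ltP x (-1).
    rewrite /m !min_l ?divff ?subrr ?cmod0 ?(le_trans (ltW hx))//.
  apply: he.
    rewrite /= in_itv /= /m /Num.min; have := Xle k.
    have : X k <= 1.
      rewrite -Xn /X lerD2l -!mulrA ler_wpM2l // ler_pM2r ?invr_gt0 //.
      by rewrite ler_nat ltnW.
    by case: ltP => /=; lra.
  rewrite /m /Num.min; case: (ltP x (X k)) => h3; case: (ltP x (X k.+1)) => h4 //=;
    rewrite ltr_norml; lra.
exists (fun x => s0 * \prod_(0 <= k < n) psqrt (F (m k.+1 x) / F (m k x))).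
have cm k : continuous (m k).
  by apply: lipschitz1_continuous => x y; exact: dist_min.
split.
- move=> x; apply: cvgM; first exact: cvg_cst.
  (* [continuous_prod] asks for continuity of all factors, but [key] only covers k < n; beyond n the
     factor is replaced by 1. *)
  rewrite (_ : (fun x : R => _) = (fun x => \prod_(0 <= k < n)
       (if (k < n)%N then psqrt (F (m k.+1 x) / F (m k x)) else 1))); last first.
    by apply/funext => y; apply: eq_big_nat => k /= ->.
  suff cp : continuous (fun x => \prod_(0 <= k < n)
       (if (k < n)%N then psqrt (F (m k.+1 x) / F (m k x)) else 1)).
    rewrite (eq_big_nat _ _ (F2 := fun k => if (k < n)%N then
       psqrt (F (m k.+1 x) / F (m k x)) else 1)); first exact: cp.
    by move=> k /= ->.
  apply: (@continuous_prod n (fun k x => if (k < n)%N then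
     psqrt (F (m k.+1 x) / F (m k x)) else 1)) => k y.
  have [kn|_] := ltnP k n; last exact: cvg_cst.
  apply: (@continuous_comp _ _ _ (fun y => F (m k.+1 y) / F (m k y)) (@psqrt R)).
    apply: cvgM; first by apply: continuous_comp (cF _); exact: cm.
    by apply: cvgV => //; apply: continuous_comp (cF _); exact: cm.
  by apply: continuous_psqrt; apply: Re_gt0_ball; exact: key.
- rewrite big1_seq ?mulr1 // => k /andP[_ _].
  by rewrite /m !min_l ?divff ?psqrt1.
- move=> x Ix; rewrite exprMn s0E -prodrXl.
  rewrite (eq_big_nat _ _ (F2 := fun k => F (m k.+1 x) / F (m k x))); last first.
    by move=> k /= kn; rewrite psqrt_sqr//; apply: Re_gt0_ball; exact: key.
  rewrite (@telescope_prodf _ 0 n (fun k => F (m k x))) //.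
  move: (Ix); rewrite /= in_itv /= => /andP[x1 x2].
  rewrite /m X0 Xn min_l // (min_r x1).
  have In1 : I (-1) by rewrite /= in_itv /= lexx; lra.
  by rewrite /F /= !clamp_id // mulrC divfK// f0.
Qed.

(** The quotient of the two roots takes only the values 1 and -1, and by the intermediate value
    theorem its real part cannot jump from one to the other. *)
Lemma sqrt_lift_unique (s s' : R -> C) :
  {within I, continuous s} -> {within I, continuous s'} ->
  (forall x, I x -> s x != 0) ->
  (forall x, I x -> s x ^+ 2 = s' x ^+ 2) -> s (- 1) = s' (- 1) ->
  forall x, I x -> s x = s' x.
Proof.
move=> cs cs' s0 ss sN x Ix.
pose q t := complex.Re (s' (clamp t) / s (clamp t)).
have q1 t : I t -> s' t = s t \/ s' t = - s t.
  move=> It; have /eqP := ss _ It; rewrite eq_sym eqf_sqr => /orP[]/eqP ->; auto.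
case: (q1 _ Ix) => // sx.
move: (Ix); rewrite /= in_itv /= => /andP[x1 x2].
have cq : continuous q.
  move=> t; apply: (@continuous_comp _ _ _ (fun t => s' (clamp t) / s (clamp t))
    (@complex.Re R)); last exact: continuous_Re.
  have cz : (fun t => s' (clamp t) / s (clamp t)) @ nbhs t -->
     s' (clamp t) / s (clamp t); last exact: cz.
  apply: cvgM; first exact: (continuous_comp_clamp cs').
  by apply: cvgV; [apply/s0/clamp_in|exact: (continuous_comp_clamp cs)].
have In1 : I (-1) by rewrite /= in_itv /= lexx; lra.
have qN : q (-1) = 1 by rewrite /q clamp_id// -sN divff ?s0.
have qx : q x = -1 by rewrite /q clamp_id// sx mulNr divff ?s0.
have [] := @IVT R q (-1) x 0 x1 (continuous_subspaceT cq).
  by rewrite qN qx /Num.min /Num.max; case: ltP; lra.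
move=> c; rewrite in_itv /= => /andP[c1 c2] qc.
have Ic : I c by rewrite /= in_itv /= c1; lra.
by exfalso; move: qc; rewrite /q clamp_id//; case: (q1 _ Ic) => ->;
  rewrite ?mulNr divff ?s0 //=; lra.
Qed.

Lemma cvg_psqrt (T : Type) (F : set_system T) (FF : Filter F) (f : T -> C) l :
  0 < complex.Re l -> f @ F --> l -> (fun x => psqrt (f x)) @ F --> psqrt l.
Proof. by move=> l0 fl; apply: cvg_comp fl _; exact: continuous_psqrt. Qed.

End Lifting.

(** * The inverse Joukowski map off an arc *)

Section ArcSquareRoot.
Variable R : realType.
Local Notation C := (R[i]).
Local Notation S := (Cinf R).
Local Notation I := (`[(- 1), 1]%classic : set R).
Variable g : R -> C.
Hypothesis cg : {within I, continuous g}.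
Hypothesis ig : set_inj I g.

Definition arc_set : set C := g @` I.
Local Notation a := (g (- 1)).
Local Notation b := (g 1).

Let In1 : I (-1). Proof. by rewrite /= in_itv /= lexx; lra. Qed.
Let I1 : I 1. Proof. by rewrite /= in_itv /= lexx; lra. Qed.

Lemma arc_ends : a != b.
Proof.
apply/eqP => ab; have := ig _ _ ab; rewrite !inE => /(_ In1 I1) /eqP.
by rewrite eq_sym -subr_eq0 opprK gt_eqF.
Qed.

Let memN z : ~ arc_set z -> forall x, I x -> g x - z != 0.
Proof. by move=> nz x Ix; apply/eqP => /subr0_eq gx; apply: nz; exists x. Qed.

Lemma compact_arc : compact arc_set.
Proof. by apply: continuous_compact => //; exact: segment_compact. Qed.

Lemma closed_arc : closed arc_set.
Proof. exact: compact_closed (@hausdorffC R) compact_arc. Qed.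

Lemma arc_dist z : ~ arc_set z ->
  exists2 d, 0 < d & forall x, I x -> d <= cmod (g x - z).
Proof.
move=> nz; have : nbhs z (~` arc_set).
  by apply: open_nbhs_nbhs; split => //; exact/closed_openC/closed_arc.
move=> /nbhsCP [d d0 dA]; exists d => // x Ix; rewrite leNgt; apply/negP => h.
by apply: (dA _ h); exists x.
Qed.

(* The path t |-> (g t - z) / (a - z) is lifted through the square map. *)
Definition lifts z (s : R -> C) := [/\ {within I, continuous s}, s (- 1) = 1 &
  forall x, I x -> s x ^+ 2 = (g x - z) / (a - z)].

(* The branch of sqrt ((z - b) / (z - a)) off the arc with value 1 at oo; the
   junk value 0 is taken only on the arc. *)
Definition hroot z : C := xget 0 [set y | exists2 s, lifts z s & y = s 1].

Lemma hroot_lift z : ~ arc_set z -> exists2 s, lifts z s & hroot z = s 1.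
Proof.
move=> nz; rewrite /hroot.
have [s [cs s1 sE]] : exists s : R -> C, [/\ continuous s, s (- 1) = 1 &
    forall x, I x -> s x ^+ 2 = (g x - z) / (a - z)].
  apply: continuous_sqrt_lift.
  - apply/within_continuousCP => t It.
    apply: cvgM; last exact: cvg_cst.
    apply: cvgB; last exact: cvg_cst.
    by move/within_continuousCP : cg; exact.
  - by move=> x Ix; rewrite mulf_neq0 ?invr_eq0 ?memN.
  - by rewrite expr1n divff // memN.
case: xgetP => [y -> [s' Hs ->]|/(_ (s 1)) []]; first by exists s'.
exists s; last by [].
split; [exact: continuous_subspaceT|exact: s1|exact: sE].
Qed.

Lemma hrootE z s : ~ arc_set z -> lifts z s -> hroot z = s 1.
Proof.
move=> nz [cs s1 sE]; have [s' [cs' s1' sE'] ->] := hroot_lift nz.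
apply: (sqrt_lift_unique cs' cs); last exact: I1; last by rewrite s1 s1'.
- move=> x Ix; rewrite -sqrf_eq0 (sE' _ Ix); apply: mulf_neq0.
    exact: memN.
  by rewrite invr_eq0; exact: memN.
- by move=> x Ix; rewrite (sE _ Ix) (sE' _ Ix).
Qed.

Lemma hroot_sqr z : ~ arc_set z -> hroot z ^+ 2 = (b - z) / (a - z).
Proof. by move=> nz; have [s [_ _ sE] ->] := hroot_lift nz; rewrite sE. Qed.

(** A path [s0] corrected by the principal root of a factor [q] close to 1 is a lift for z, and
    lifts are unique. Near a finite point [s0] is the lift of that point; near oo it is the constant
    1. *)
Lemma hroot_perturb z (s0 q : R -> C) : ~ arc_set z ->
  {within I, continuous s0} -> s0 (- 1) = 1 -> {within I, continuous q} ->
  (forall x, I x -> cmod (q x - 1) < 1) -> q (- 1) = 1 ->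
  (forall x, I x -> s0 x ^+ 2 * q x = (g x - z) / (a - z)) ->
  hroot z = s0 1 * psqrt (q 1).
Proof.
move=> nz cs0 s01 cq q1 qN1 sq.
apply: (@hrootE _ (fun x => s0 x * psqrt (q x))); first exact: nz.
split.
- apply/within_continuousCP => t It; apply: cvgM.
    by move/within_continuousCP : cs0; exact.
  apply: cvg_psqrt; first exact/Re_gt0_ball/q1.
  by move/within_continuousCP : cq; exact.
- by rewrite s01 qN1 psqrt1 mul1r.
- move=> x Ix; rewrite exprMn psqrt_sqr ?sq//; exact/Re_gt0_ball/q1.
Qed.

Let cratio z w : ~ arc_set w -> {within I, continuous (fun x => (g x - z) / (g x - w))}.
Proof.
move=> nw; apply/within_continuousCP => t It; apply: cvgM.
  apply: cvgB; last exact: cvg_cst.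
  by move/within_continuousCP : cg; exact.
apply: cvgV; first exact: memN.
apply: cvgB; last exact: cvg_cst.
by move/within_continuousCP : cg; exact.
Qed.

Lemma continuous_hroot z0 : ~ arc_set z0 -> {for z0, continuous hroot}.
Proof.
move=> nz0; have [d d0 dA] := arc_dist nz0.
have [s0 [cs0 s01 s0E] hE] := hroot_lift nz0.
(* The quotient of the path of z by the path of z0. For z within d / 4 of z0 its two factors are
   within 1 / 4 and 1 / 3 of 1, hence [Q z x] is within 2 / 3 of 1. *)
pose Q z x := (g x - z) / (g x - z0) * ((a - z0) / (a - z)).
have near_z0 : \forall z \near nbhs z0, hroot z = s0 1 * psqrt (Q z 1).
  apply/nbhsCP; exists (d / 4); first by rewrite divr_gt0.
  move=> z zz0.
  have nz : ~ arc_set z.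
    move=> [x Ix gx]; have := dA _ Ix; rewrite gx; move: zz0; lra.
  have az : 3 * d / 4 <= cmod (a - z).
    have := cmodD (a - z) (z - z0); rewrite addrA subrK.
    have := dA _ In1; move: zz0; lra.
  apply: hroot_perturb; [exact: nz|exact: cs0|exact: s01| | | |].
  - apply/within_continuousCP => t It; apply: cvgM; last exact: cvg_cst.
    by move/within_continuousCP : (@cratio z z0 nz0); exact.
  - move=> x Ix.
    have -> : Q z x - 1 = (z0 - z) / (g x - z0) + (z - z0) / (a - z) +
        (z0 - z) / (g x - z0) * ((z - z0) / (a - z)).
      by rewrite /Q; field; rewrite !memN.
    have h1 : cmod ((z0 - z) / (g x - z0)) <= 1 / 4.
      rewrite cmodM cmodV cmodB ler_pdivrMr ?cmod_gt0 ?memN//.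
      by have := dA _ Ix; move: zz0; lra.
    have h2 : cmod ((z - z0) / (a - z)) <= 1 / 3.
      rewrite cmodM cmodV ler_pdivrMr ?cmod_gt0 ?memN//.
      by move: zz0 az; lra.
    move: (_ / (g x - z0)) (_ / (a - z)) h1 h2 => U V h1 h2.
    have := cmodD (U + V) (U * V); have := cmodD U V.
    rewrite cmodM; move: h1 h2 (cmod_ge0 U) (cmod_ge0 V).
    by move: (cmod U) (cmod V) => u v; nra.
  - by rewrite /Q; field; rewrite !memN.
  - by move=> x Ix; rewrite (s0E _ Ix) /Q; field; rewrite !memN.
have Q1 : Q z0 1 = 1 by rewrite /Q; field; rewrite !memN.
have lim : (fun z => s0 1 * psqrt (Q z 1)) @ nbhs z0 --> s0 1 * psqrt (Q z0 1).
  apply: cvgM; first exact: cvg_cst.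
  apply: cvg_psqrt; first by rewrite Q1 /=.
  apply: cvgM.
    apply: cvgM; last exact: cvg_cst.
    by apply: cvgB; [exact: cvg_cst|exact: cvg_id].
  apply: cvgM; first exact: cvg_cst.
  apply: cvgV; first exact: memN.
  by apply: cvgB; [exact: cvg_cst|exact: cvg_id].
rewrite Q1 psqrt1 mulr1 -hE in lim.
have cz : hroot @ nbhs z0 --> hroot z0; last exact: cz.
move=> A /lim nA.
have {}nA : nbhs z0 (fun z => A (s0 1 * psqrt (Q z 1))).
  by rewrite -hE; exact: nA.
by have nB : nbhs z0 (fun z => A (hroot z)); [apply: filterS2 near_z0 nA => z ->|].
Qed.

Lemma hroot_inf e : 0 < e ->
  exists M, forall z, M < cmod z -> ~ arc_set z /\ cmod (hroot z - 1) < e.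
Proof.
move=> e0; have [M0 hM0] := compactC_bounded compact_arc.
have : (@psqrt R) @ nbhs (1 : C) --> (1 : C).
  by rewrite -[X in _ --> X]psqrt1; apply: continuous_psqrt => /=.
move=> /(cvgCP _ _).1 /(_ _ e0) /nbhsCP [d d0 dA].
have M00 : 0 <= M0.
  by apply: le_trans (cmod_ge0 a) (hM0 _ _); exists (-1).
(* Then |a - z| > 2 M0 + 1 + 2 M0 / d while |g x - a| <= 2 M0: the path stays within distance 1 of
   1, and its end point within d. *)
exists (3 * M0 + 1 + 2 * M0 / d) => z Mz.
have Md : 0 <= 2 * M0 / d by rewrite divr_ge0 ?mulr_ge0// ltW.
have nz : ~ arc_set z by move=> /hM0; lra.
have az : 2 * M0 + 1 + 2 * M0 / d < cmod (a - z).
  have := cmodD (a - z) z; rewrite subrK.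
  have := cmod_dist z a; rewrite cmodB.
  have : cmod a <= M0 by apply: hM0; exists (-1).
  lra.
have az0 : 0 < cmod (a - z) by lra.
have bd x : I x -> cmod ((g x - a) / (a - z)) * cmod (a - z) <= 2 * M0.
  move=> Ix; rewrite -cmodM divfK; last by rewrite -cmod_gt0.
  have := cmodBD (g x) a.
  have : cmod (g x) <= M0 by apply: hM0; exists x.
  have : cmod a <= M0 by apply: hM0; exists (-1).
  lra.
split => //.
rewrite (@hroot_perturb _ (fun=> 1) (fun x => (g x - z) / (a - z)) nz).
- rewrite mul1r; apply: dA.
  have -> : (b - z) / (a - z) - 1 = (b - a) / (a - z) by field; rewrite memN.
  rewrite cmodM cmodV ltr_pdivrMr//.
  have := bd _ I1; rewrite -cmodM divfK; last by rewrite -cmod_gt0.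
  have : d * (2 * M0 / d) < d * cmod (a - z) by rewrite ltr_pM2l //; lra.
  rewrite (_ : d * (2 * M0 / d) = 2 * M0); last by field; rewrite gt_eqF.
  lra.
- by apply: continuous_subspaceT; move=> x; exact: cvg_cst.
- by [].
- apply/within_continuousCP => t It.
  apply: cvgM; last exact: cvg_cst.
  apply: cvgB; last exact: cvg_cst.
  by move/within_continuousCP : cg; exact.
- move=> x Ix.
  have -> : (g x - z) / (a - z) - 1 = (g x - a) / (a - z) by field; rewrite memN.
  have := bd _ Ix; rewrite -(ler_pdivlMr _ _ az0) => /le_lt_trans; apply.
  by rewrite ltr_pdivrMr //; lra.
- by rewrite divff // memN.
- by move=> x Ix; rewrite expr1n mul1r.
Qed.

End ArcSquareRoot.

Section Joukowski.
Variable R : realType.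
Local Notation C := (R[i]).
Local Notation S := (Cinf R).
Local Notation I := (`[(- 1), 1]%classic : set R).
Variable g : R -> C.
Hypothesis cg : {within I, continuous g}.
Hypothesis ig : set_inj I g.
Local Notation a := (g (- 1)).
Local Notation b := (g 1).
Local Notation gam := (arc_set g).

Let In1 : I (-1). Proof. by rewrite /= in_itv /= lexx; lra. Qed.
Let I1 : I 1. Proof. by rewrite /= in_itv /= lexx; lra. Qed.
Let ab0 : b - a != 0. Proof. by rewrite subr_eq0 eq_sym; exact: arc_ends. Qed.
Let na z : ~ gam z -> a - z != 0.
Proof. by move=> nz; apply/eqP => /subr0_eq h; apply: nz; exists (-1). Qed.
Let nb z : ~ gam z -> b - z != 0.
Proof. by move=> nz; apply/eqP => /subr0_eq h; apply: nz; exists 1. Qed.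
Let two : (2 : C) != 0. Proof. by rewrite pnatr_eq0. Qed.
Let four : (4 : C) != 0. Proof. by rewrite pnatr_eq0. Qed.

Definition jou (w : C) : C := (a + b) / 2 + (b - a) / 4 * (w + w^-1).

Definition jouS (x : S) : S :=
  if x is Some w then (if w == 0 then None else Some (jou w)) else None.

(* [jou] has critical points 1 and -1 with values b and a. Its two inverse
   images of z are (1 + h) / (1 - h) with h ^+ 2 = (z - b) / (z - a). *)
Definition open_up (z : C) : C := (1 + hroot g z) / (1 - hroot g z).

Definition open_upS (x : S) : S := omap open_up x.

Lemma jou1 : jou 1 = b.
Proof. by rewrite /jou invr1; field. Qed.

Lemma jouN1 : jou (- 1) = a.
Proof. by rewrite /jou invrN1; field. Qed.

Lemma jouV w : jou w^-1 = jou w.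
Proof. by rewrite /jou invrK addrC [w^-1 + w]addrC addrC. Qed.

Lemma jou_inj w w' : w != 0 -> w' != 0 -> jou w = jou w' -> w' = w \/ w' = w^-1.
Proof.
move=> w0 w0' /addrI.
have k0 : (b - a) / 4 != 0 by rewrite mulf_neq0 ?invr_eq0.
move=> /(mulfI k0) h.
have : (w' - w) * (w' - w^-1) = 0.
  rewrite (_ : _ * _ = w' * (w' + w'^-1 - (w + w^-1))); last by field; rewrite w0 w0'.
  by rewrite -h subrr mulr0.
move/eqP; rewrite mulf_eq0 !subr_eq0 => /orP[]/eqP; auto.
Qed.

Lemma hroot_neq z : ~ gam z -> [/\ 1 - hroot g z != 0, 1 + hroot g z != 0 &
  hroot g z != 0].
Proof.
move=> nz; have hE := hroot_sqr cg nz; have n1 := na nz; have n2 := nb nz.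
have hN1 : hroot g z ^+ 2 != 1.
  rewrite hE; apply/eqP => /(canRL (mulfVK n1)); rewrite mul1r => /addIr ba.
  by move: ab0; rewrite ba subrr eqxx.
split.
- by apply: contra hN1; rewrite subr_eq0 => /eqP <-; rewrite expr1n.
- apply: contra hN1; rewrite addrC addr_eq0 => /eqP ->.
  by rewrite sqrrN expr1n.
- by rewrite -sqrf_eq0 hE mulf_neq0 ?invr_eq0.
Qed.

Lemma open_up_neq z : ~ gam z -> [/\ open_up z != 0, open_up z != 1 & open_up z != -1].
Proof.
move=> nz; have [h1 h2 h3] := hroot_neq nz.
rewrite /open_up; split.
- by rewrite mulf_neq0 ?invr_eq0.
- apply/eqP => /(canRL (mulfVK h1)); rewrite mul1r => /addrI /eqP.
  rewrite -subr_eq0 opprK -mulr2n mulrn_eq0 /=; exact/negP.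
- apply/eqP => /(canRL (mulfVK h1)); rewrite mulN1r opprB [RHS]addrC => /addIr/eqP.
  by rewrite -subr_eq0 opprK -[1 + 1]/(2%:R : C) (negPf two).
Qed.

Lemma open_upK z : ~ gam z -> jou (open_up z) = z.
Proof.
move=> nz; have hE := hroot_sqr cg nz; have [h1 h2 h3] := hroot_neq nz.
have n1 := na nz.
rewrite /jou /open_up invf_div.
move: (hroot g z) hE h1 h2 h3 => h hE h1 h2 h3.
have e1 : 1 - h ^+ 2 = (a - b) / (a - z) by rewrite hE; field.
have e2 : 1 + h ^+ 2 = (a + b - 2 * z) / (a - z) by rewrite hE; field.
have ab' : a - b != 0 by rewrite -oppr_eq0 opprB.
have -> : (1 + h) / (1 - h) + (1 - h) / (1 + h) = 2 * (1 + h ^+ 2) / (1 - h ^+ 2).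
  have -> : 1 - h ^+ 2 = (1 - h) * (1 + h) by ring.
  by field; rewrite h1 h2.
by rewrite e1 e2; field; rewrite ab' n1.
Qed.

Lemma jouSV x : jouS (sphere_inv x) = jouS x.
Proof.
case: x => [w|] /=; last by rewrite eqxx.
by case: (eqVneq w 0) => [//|w0] /=; rewrite invr_eq0 (negPf w0) jouV.
Qed.

Lemma continuous_jou w : w != 0 -> {for w, continuous jou}.
Proof.
move=> w0; have cz : jou @ nbhs w --> jou w; last exact: cz.
apply: cvgD; first exact: cvg_cst.
apply: cvgM; first exact: cvg_cst.
by apply: cvgD; [exact: cvg_id|exact: inv_continuous].
Qed.

Lemma continuous_jouS : continuous jouS.
Proof.
have c0 : {for (None : S), continuous jouS}.
  move=> A; rewrite /= => /nbhs_infP [AN [M MA]]; apply/nbhs_infP; split => //.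
  pose k := cmod ((b - a) / 4); pose m := cmod ((a + b) / 2).
  have k0 : 0 < k by rewrite cmod_gt0 mulf_neq0 ?invr_eq0.
  have m0 : 0 <= m := cmod_ge0 _.
  exists (1 + (m + k + `|M|) / k) => w wM.
  have w1 : 1 < cmod w.
    by rewrite (le_lt_trans _ wM)// lerDl divr_ge0 ?addr_ge0// ltW.
  have w0 : w != 0 by rewrite -cmod_gt0 (lt_trans _ w1).
  rewrite /= (negPf w0); apply: MA.
  have : cmod ((b - a) / 4 * w) <= cmod (jou w) + m + k.
    rewrite (_ : (b - a) / 4 * w = jou w - (a + b) / 2 - (b - a) / 4 * w^-1); last first.
      by rewrite /jou; ring.
    rewrite (le_trans (cmodBD _ _))// lerD//; first exact: cmodBD.
    by rewrite cmodM cmodV ler_piMr ?cmod_ge0// invf_le1 ?ltW// (lt_trans _ w1).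
  rewrite cmodM -/k.
  have : (1 + (m + k + `|M|) / k) * k < cmod w * k by rewrite ltr_pM2r.
  rewrite mulrDl mul1r divfK ?gt_eqF//; have := ler_norm M; lra.
case=> [w|] //; case: (eqVneq w 0) => [->|w0].
  rewrite (_ : jouS = jouS \o @sphere_inv R); last first.
    by apply/funext => x /=; rewrite jouSV.
  apply: continuous_comp; first exact: continuous_sphere_inv.
  by rewrite /= eqxx.
move=> A /=; rewrite (negPf w0) => nA; apply/nbhs_finP.
have nB : nbhs w (fun x : C => A (Some (jou x))).
  have cj : jou @ nbhs w --> jou w by exact: continuous_jou w0.
  exact: (cj (fun y => A (Some y))).
have nz : \forall x \near nbhs w, x != 0.
  apply/nbhsCP; exists (cmod w); first by rewrite cmod_gt0.
  move=> y; apply: contraTneq => ->.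
  by rewrite sub0r cmodN ltxx.
by apply: filterS2 nB nz => x h /negPf /= ->.
Qed.

Lemma jouSK x : ~ (Some @` gam) x -> jouS (open_upS x) = x.
Proof.
case: x => [z|//] nz /=; have {}nz : ~ gam z by move=> gz; apply: nz; exists z.
by have [/negPf -> _ _] := open_up_neq nz; rewrite open_upK.
Qed.

Lemma continuous_open_upS x : ~ (Some @` gam) x -> {for x, continuous open_upS}.
Proof.
case: x => [z|] nz.
  have {}nz : ~ gam z by move=> gz; apply: nz; exists z.
  move=> A nA; apply/nbhs_finP; rewrite /= in nA *.
  have [h1 h2 h3] := hroot_neq nz.
  have co : open_up @ nbhs z --> open_up z.
    have ch : hroot g @ nbhs z --> hroot g z by exact: continuous_hroot.
    apply: cvgM; first by apply: cvgD; [exact: cvg_cst|exact: ch].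
    by apply: cvgV; [exact: h1|apply: cvgB; [exact: cvg_cst|exact: ch]].
  exact: (co (fun y => A (Some y))).
move=> A /nbhs_infP [AN [M MA]]; apply/nbhs_infP; split => //.
have e0 : 0 < (`|M| + 2)^-1 by rewrite invr_gt0 ltr_wpDl.
have [M' hM'] := hroot_inf cg e0; exists M' => z /hM' [nz' hz].
apply: MA; have [h1 h2 h3] := hroot_neq nz'.
rewrite /open_up cmodM cmodV ltr_pdivlMr ?cmod_gt0//.
have : (`|M| + 2) * cmod (hroot g z - 1) < 1.
  by rewrite mulrC -ltr_pdivlMr ?ltr_wpDl// mul1r.
rewrite cmodB; have := cmod_ge0 (1 - hroot g z).
have := ler_norm M; have := normr_ge0 M.
have := cmodD (1 + hroot g z) (1 - hroot g z).
rewrite (_ : 1 + hroot g z + (1 - hroot g z) = (2 : R)%:C); last first.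
  by rewrite rmorph_nat; ring.
rewrite cmod_real ger0_norm //.
move: (cmod _) (cmod (1 + _)) `|M| => u v m; nra.
Qed.

(** The image of the inverse branch, written as the fixed points of [open_upS \o jouS]. In this form
    the trichotomy below says that x and 1/x are the only points with the same image under
    [jouS]. *)
Definition arc_domain : set S :=
  [set x | ~ (Some @` gam) (jouS x) /\ open_upS (jouS x) = x].

Definition arc_codomain : set S := (@sphere_inv R) @^-1` arc_domain.

Definition arc_curve : set S := jouS @^-1` (Some @` gam).

Lemma jouS_fixed x : sphere_inv x = x -> arc_curve x.
Proof.
case: x => [w|//] /=; case: (eqVneq w 0) => [//|w0] [ww].
have : (w - 1) * (w + 1) = 0.
  rewrite (_ : _ * _ = w * (w - w^-1)); last by field.
  by rewrite ww subrr mulr0.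
move/eqP; rewrite mulf_eq0 subr_eq0 addr_eq0.
rewrite /arc_curve /= (negPf w0) => /orP[]/eqP ->.
  by rewrite jou1; exists b => //; exists 1.
by rewrite jouN1; exists a => //; exists (-1).
Qed.

Lemma open_up_jouS x : ~ arc_curve x ->
  open_upS (jouS x) = x \/ open_upS (jouS x) = sphere_inv x.
Proof.
case: x => [w|]; last by left.
rewrite /arc_curve /=; case: (eqVneq w 0) => [->|w0 nw /=]; first by right.
have {}nw : ~ gam (jou w) by move=> h; apply: nw; exists (jou w).
have [n0 _ _] := open_up_neq nw.
by have [|->|->] := @jou_inj w (open_up (jou w)) w0 n0; rewrite ?open_upK//; auto.
Qed.

Lemma arc_trichotomy x :
  [\/ arc_domain x, arc_curve x | arc_codomain x].
Proof.
have [cx|ncx] := pselect (arc_curve x); first exact: Or32.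
have [h|h] := open_up_jouS ncx; first by apply: Or31.
by apply: Or33; split; rewrite jouSV.
Qed.

Lemma arc_domain_curve x : arc_domain x -> ~ arc_curve x.
Proof. by case. Qed.

Lemma arc_codomain_curve x : arc_codomain x -> ~ arc_curve x.
Proof. by case; rewrite jouSV. Qed.

Lemma arc_domain_codomain x : arc_domain x -> ~ arc_codomain x.
Proof.
move=> [nx h] [_]; rewrite jouSV h => xx.
by apply: nx; apply: jouS_fixed; rewrite -xx.
Qed.

Lemma closed_arcS : closed (Some @` gam : set S).
Proof.
apply: compact_closed; first exact: hausdorffS.
apply: continuous_compact; last exact: compact_arc.
apply: continuous_subspaceT; exact: one_point_compactification_some_continuous.
Qed.

(** Off the curve, [open_upS (jouS y)] is y or 1/y. At a point of the domain these two are distinct,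
    so separating them by open sets rules out the second value nearby. *)
Lemma open_arc_domain : open arc_domain.
Proof.
rewrite openE => x [nx h]; rewrite /interior.
have xi : open_upS (jouS x) != sphere_inv x.
  by rewrite h; apply/eqP => /esym xx; apply: nx; exact: jouS_fixed.
have cx : (open_upS \o jouS) @ nbhs x --> open_upS (jouS x).
  by apply: continuous_comp; [exact: continuous_jouS|exact: continuous_open_upS].
have := @hausdorffS R; rewrite open_hausdorff.
move=> /(_ _ _ xi) [[U V] /= [Ux Vx] [oU oV /eqP UV]].
rewrite !inE in Ux Vx.
have n1 : nbhs x (fun y => U (open_upS (jouS y))).
  by apply: cx; exact: open_nbhs_nbhs.
have n2 : nbhs x (fun y => V (sphere_inv y)).
  by apply: continuous_sphere_inv; exact: open_nbhs_nbhs.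
have n3 : nbhs x (fun y => ~ (Some @` gam) (jouS y)).
  apply: (@continuous_jouS x (~` (Some @` gam))).
  by apply: open_nbhs_nbhs; split => //; exact: closed_openC closed_arcS.
apply: filterS3 n1 n2 n3 => y Uy Vy ny; split => //.
case: (open_up_jouS ny) => // e; exfalso.
have : (U `&` V) (sphere_inv y) by split => //; rewrite -e.
by rewrite UV.
Qed.

Lemma arc_domain_inf : arc_domain None.
Proof. by split => // -[]. Qed.

Lemma open_upS_domain y : ~ (Some @` gam) y -> arc_domain (open_upS y).
Proof. by move=> ny; split; rewrite jouSK. Qed.

End Joukowski.

(** * Both sides of a smooth curve *)

Section MeanValue.
Variable R : realType.
Local Notation C := (R[i]).

Lemma is_deriv_onP (D : set R) (f f1 : R -> C) : is_deriv_on D f f1 <->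
  forall t, D t -> forall e, 0 < e -> exists2 n, 0 < n & forall s, `|s - t| < n ->
    s != t -> D s -> cmod ((f s - f t) / (s - t)%:C - f1 t) < e.
Proof.
split => [fd t Dt e e0|fd t Dt].
  by have /cvgCP /(_ e e0) /dnbhsP := fd t Dt.
by apply/cvgCP => e e0; apply/dnbhsP; exact: fd.
Qed.

Lemma is_deriv_on_continuous (D : set R) (f f1 : R -> C) :
  is_deriv_on D f f1 -> {within D, continuous f}.
Proof.
move=> /is_deriv_onP fd; apply/within_continuousCP => t Dt; apply/cvgCP => e e0.
have [n n0 nf] := fd t Dt 1 ltr01.
have c0 : 0 < cmod (f1 t) + 1 by rewrite ltr_wpDl ?cmod_ge0.
apply/withinRP; exists (Num.min n (e / (cmod (f1 t) + 1))).
  by rewrite lt_min n0 divr_gt0.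
move=> s; rewrite lt_min => /andP[sn se] Ds.
have [->|st] := eqVneq s t; first by rewrite subrr cmod0.
have st0 : (s - t)%:C != 0 by rewrite eq_complex /= eqxx andbT subr_eq0.
have := nf s sn st Ds; set q := (_ / _) => qf.
have -> : f s - f t = q * (s - t)%:C by rewrite /q divfK.
rewrite cmodM cmod_real.
have q1 : cmod q <= cmod (f1 t) + 1.
  by have := cmodD (q - f1 t) (f1 t); rewrite subrK; lra.
apply: (le_lt_trans (_ : _ <= (cmod (f1 t) + 1) * `|s - t|)).
  by rewrite ler_wpM2r.
by rewrite mulrC -ltr_pdivlMr.
Qed.

Lemma is_derive_of_quotient (f : R -> R) (x l : R) :
  (forall e, 0 < e -> exists2 n, 0 < n & forall s, `|s - x| < n -> s != x ->
    `|(f s - f x) / (s - x) - l| < e) -> is_derive x 1 f l.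
Proof.
move=> h.
have cv : (fun h : R => h^-1 *: (f (h *: 1 + x) - f x)) @ 0^' --> l.
  apply/cvgrPdist_lt => e e0; have [n n0 nf] := h e e0.
  apply/nbhs_ballP; exists n => //= y; rewrite -ball_normE /= sub0r normrN => yn y0.
  have := nf (y + x); rewrite addrK => /(_ yn).
  rewrite -subr_eq0 addrK => /(_ y0).
  by rewrite distrC [y *: 1]mulr1 /GRing.scale /= mulrC.
split; first by apply/cvg_ex; exists l.
exact: cvg_lim cv.
Qed.

(** [p] stands for the real or the imaginary part, to which the real mean value theorem applies. *)
Let mvi_real (D : set R) (f f1 : R -> C) (p : C -> R) (s t e : R) :
  (forall z w, p (z - w) = p z - p w) -> (forall z (x : R), p (z * x%:C) = p z * x) ->
  (forall z, `|p z| <= cmod z) ->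
  is_deriv_on D f f1 -> s < t -> (forall x, s <= x <= t -> D x) ->
  (forall x, s <= x <= t -> cmod (f1 x) <= e) -> `|p (f t - f s)| <= e * (t - s).
Proof.
move=> pB pM ple fd st sD fe.
have cp : continuous p.
  move=> z A /nbhsRP [d d0 dA]; apply/nbhsCP; exists d => // y yz.
  by apply: dA; rewrite -pB (le_lt_trans (ple _)).
have cf : {within `[s, t], continuous (p \o f)}.
  move=> x; apply: (@continuous_comp (subspace `[s, t]) _ _ f p); last exact: cp.
  apply: (@continuous_subspaceW _ _ _ D); last exact: is_deriv_on_continuous fd.
  by move=> y /=; rewrite in_itv /=; exact: sD.
have dp (x : R) : x \in `]s, t[ -> is_derive x 1 (p \o f) (p (f1 x)).
  rewrite in_itv /= => /andP[sx xt]; apply: is_derive_of_quotient => d d0.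
  have Dx : D x by apply: sD; rewrite !ltW.
  have [n n0 nf] := (is_deriv_onP _ _ _).1 fd x Dx d d0.
  exists (Num.min n (Num.min (x - s) (t - x))).
    by rewrite !lt_min n0 !subr_gt0 sx.
  move=> y; rewrite !lt_min => /and3P[yn y1 y2] yx.
  have Dy : D y.
    by apply: sD; move: y1 y2; rewrite !ltr_norml; lra.
  apply: le_lt_trans (nf y yn yx Dy); apply: le_trans (ple _).
  rewrite pB -(fmorphV (real_complex R)) pM pB /=.
  by [].
have [c] := @MVT_segment R (p \o f) (p \o f1) s t (ltW st) dp cf.
rewrite in_itv /= pB => cI ->; rewrite normrM (gtr0_norm (x := t - s)) ?subr_gt0//.
by rewrite ler_pM2r ?subr_gt0// (le_trans (ple _))// fe.
Qed.

Lemma mean_value_le (D : set R) (f f1 : R -> C) (s t e : R) :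
  is_deriv_on D f f1 -> s < t -> (forall x, s <= x <= t -> D x) ->
  (forall x, s <= x <= t -> cmod (f1 x) <= e) ->
  cmod (f t - f s) <= 2 * e * (t - s).
Proof.
move=> fd st sD fe; rewrite (le_trans (cmod_le _))//.
rewrite -mulrA mulr_natl mulr2n lerD//.
  apply: (mvi_real (p := @complex.Re R)) fd st sD fe.
  - by move=> z w; rewrite raddfB.
  - by move=> [x y] z /=; rewrite mulr0 subr0.
  - exact: cmod_Re.
apply: (mvi_real (p := @complex.Im R)) fd st sD fe.
- by move=> z w; rewrite raddfB.
- by move=> [x y] z /=; rewrite mulr0 add0r.
- exact: cmod_Im.
Qed.

(** Mean value inequality for f minus its linear part at t0. Uniformity in both parameters is what
    makes the curve locally a graph over its tangent. *)
Lemma strict_deriv (f f1 : R -> C) (t0 : R) :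
  is_deriv_on setT f f1 -> {for t0, continuous f1} ->
  forall e, 0 < e -> exists2 n, 0 < n & forall s t, `|s - t0| < n -> `|t - t0| < n ->
    cmod (f s - f t - f1 t0 * (s - t)%:C) <= e * `|s - t|.
Proof.
move=> fd c1 e e0.
have [] := (nbhsRP _ _).1 (c1 [set y | cmod (y - f1 t0) < e / 2] _).
  by apply/nbhsCP; exists (e / 2); rewrite ?divr_gt0.
move=> n n0 nf; exists n => //.
have ld : is_deriv_on setT (fun t => f t - f1 t0 * t%:C) (fun t => f1 t - f1 t0).
  move: fd => /is_deriv_onP fd; apply/is_deriv_onP => t Dt d d0.
  have [m m0 mf] := fd t Dt d d0; exists m => // s sn st Ds.
  have st0 : (s - t)%:C != 0 by rewrite eq_complex /= eqxx andbT subr_eq0.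
  have := mf s sn st Ds; congr (cmod _ < _).
  have -> : f s - f1 t0 * s%:C - (f t - f1 t0 * t%:C) =
     f s - f t - f1 t0 * (s - t)%:C by rewrite rmorphB /=; ring.
  by move: (_ - _)%:C (f s - f t) st0 => q p q0; field.
have main s t : `|s - t0| < n -> `|t - t0| < n -> s < t ->
    cmod (f t - f s - f1 t0 * (t - s)%:C) <= e * (t - s).
  move=> hs ht st; have := @mean_value_le setT _ _ s t (e / 2) ld st.
  rewrite mulrCA divff ?pnatr_eq0// mulr1.
  rewrite (_ : f t - _ - _ = f t - f s - f1 t0 * (t - s)%:C); last first.
    by rewrite rmorphB /=; ring.
  apply => // x /andP[sx xt]; apply/ltW/nf.
  by move: hs ht; rewrite !ltr_norml; lra.
move=> s t hs ht; have [st|ts|->] := ltgtP s t.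
- have := main _ _ hs ht st; rewrite -cmodN => /le_trans.
  rewrite (_ : - _ = f s - f t - f1 t0 * (s - t)%:C); last first.
    by rewrite !rmorphB /=; ring.
  by apply; rewrite distrC ger0_norm // subr_ge0 ltW.
- by rewrite gtr0_norm ?subr_gt0//; exact: main.
- by rewrite !subrr normr0 mulr0 sub0r mulr0 cmodN cmod0.
Qed.

End MeanValue.

Section Collar.
Variable R : realType.
Local Notation C := (R[i]).

Lemma cmodi : cmod ('i : C) = 1.
Proof. by rewrite /cmod /= expr0n expr1n add0r sqrtr1. Qed.

Lemma Re_addi (z : C) (s : R) : complex.Re (z + 'i * s%:C) = complex.Re z.
Proof. by case: z => x y /=; ring. Qed.

Lemma Im_addi (z : C) (s : R) : complex.Im (z + 'i * s%:C) = complex.Im z + s.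
Proof. by case: z => x y /=; ring. Qed.

(* Small neighbourhoods V of x cut by A into at most two connected pieces, each
   one accumulating at every point of A in V. *)
Definition two_sided_at (T : topologicalType) (A : set T) (x : T) : Prop :=
  forall U, nbhs x U -> exists V S1 S2 : set T,
    [/\ nbhs x V, connected S1 /\ connected S2,
        S1 `<=` U `\` A /\ S2 `<=` U `\` A,
        V `\` A `<=` S1 `|` S2 &
        V `&` A `<=` closure S1 `&` closure S2].

(** In the coordinate (z - f t0) / d the curve is near t0 a graph: the abscissa [u] grows at rate at
    least 1 / 2 and the ordinate [v] varies at rate at most 1 / 2. Its vertical translates [P t s]
    fill a neighbourhood, and the signs of s are the two sides. The last hypothesis prevents remote
    parts of the curve from returning near f t0. *)
Lemma curve_two_sided (f : R -> C) (t0 : R) (d : C) : d != 0 ->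
  (forall e, 0 < e -> exists2 n, 0 < n & forall s t, `|s - t0| < n -> `|t - t0| < n ->
    cmod (f s - f t - d * (s - t)%:C) <= e * `|s - t|) ->
  (forall n, 0 < n -> exists2 e, 0 < e & forall t, cmod (f t - f t0) < e ->
     exists2 t', `|t' - t0| < n & f t' = f t) ->
  two_sided_at (range f) (f t0).
Proof.
move=> d0 fd ffar U /nbhsCP [e1 e10 eU].
have dgt : 0 < cmod d by rewrite cmod_gt0.
have [n n0 nf] := fd (cmod d / 2) (divr_gt0 dgt (ltr0n _ 2)).
have [e2 e20 ef] := ffar n n0.
pose F s := (f s - f t0) / d.
pose u s : R := complex.Re (F s).
pose v s : R := complex.Im (F s).
have fE s : f s = f t0 + F s * d by rewrite /F divfK// addrC subrK.
have Fd s t : `|s - t0| < n -> `|t - t0| < n ->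
    cmod (F s - F t - (s - t)%:C) <= `|s - t| / 2.
  move=> hs ht.
  have -> : F s - F t - (s - t)%:C = (f s - f t - d * (s - t)%:C) / d.
    by rewrite /F; field.
  rewrite cmodM cmodV ler_pdivrMr// (le_trans (nf _ _ hs ht))//.
  by rewrite mulrC mulrA mulrAC.
have ud s t : `|s - t0| < n -> `|t - t0| < n -> `|u s - u t - (s - t)| <= `|s - t| / 2.
  move=> hs ht; apply: le_trans (Fd _ _ hs ht).
  by have := cmod_Re (F s - F t - (s - t)%:C); rewrite !raddfB.
have vd s t : `|s - t0| < n -> `|t - t0| < n -> `|v s - v t| <= `|s - t| / 2.
  move=> hs ht; apply: le_trans (Fd _ _ hs ht).
  rewrite (_ : v s - v t = complex.Im (F s - F t - (s - t)%:C)).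
    exact: cmod_Im.
  by rewrite /v; case: (F s) => ? ?; case: (F t) => ? ? /=; rewrite oppr0 addr0.
have t0n : `|t0 - t0| < n by rewrite subrr normr0.
have u0 : u t0 = 0 by rewrite /u /F subrr mul0r.
have v0 : v t0 = 0 by rewrite /v /F subrr mul0r.
have u_inj s t : `|s - t0| < n -> `|t - t0| < n -> u s = u t -> s = t.
  move=> hs ht us; have := ud _ _ hs ht; rewrite us subrr sub0r normrN => h.
  have : `|s - t| <= 0 by move: h (normr_ge0 (s - t)); clear; lra.
  by rewrite normr_le0 subr_eq0 => /eqP.
pose e := Num.min e1 e2.
have ep : 0 < e by rewrite lt_min e10.
pose r := Num.min (n / 2) (e / (4 * cmod d)).
have r0 : 0 < r by rewrite lt_min !divr_gt0// mulr_gt0.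
have rn : r < n.
  by rewrite (le_lt_trans (y := n / 2)) ?ge_min ?lexx// ltr_pdivrMr// ltr_pMr// ltr1n.
have re : 4 * r * cmod d <= e.
  have : r <= e / (4 * cmod d) by rewrite ge_min lexx orbT.
  by rewrite ler_pdivlMr ?mulr_gt0//; clear; lra.
pose P t s : C := f t + ('i * s%:C) * d.
have Pball t s : `|t - t0| < r -> `|s| < r -> cmod (P t s - f t0) < e.
  move=> ht hs.
  have -> : P t s - f t0 = (F t - F t0 - (t - t0)%:C + (t - t0)%:C + 'i * s%:C) * d.
    by rewrite /P /F; field.
  rewrite cmodM; apply: lt_le_trans re; rewrite ltr_pM2r//.
  have h1 := cmodD (F t - F t0 - (t - t0)%:C + (t - t0)%:C) ('i * s%:C).
  have h2 := cmodD (F t - F t0 - (t - t0)%:C) ((t - t0)%:C).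
  have h3 := Fd _ _ (lt_trans ht rn) t0n.
  move: h1 h2; rewrite cmodM !cmod_real cmodi mul1r.
  move: h3 ht hs r0; move: (cmod _) (cmod _) (cmod _) `|_| `|_|; clear => *; lra.
have PU t s : `|t - t0| < r -> `|s| < r -> U (P t s).
  by move=> ht hs; apply/eU/(lt_le_trans (Pball _ _ ht hs)); rewrite ge_min lexx.
(* A curve point equal to [P t s] has a parameter t' near t0 and the same abscissa as f t; so t' =
   t, and comparing ordinates gives s = 0. *)
have Prange t s : `|t - t0| < r -> `|s| < r -> range f (P t s) -> s = 0.
  move=> ht hs [t1 _ ft1].
  have [|t' t'n ft'] := ef t1.
    by rewrite ft1 (lt_le_trans (Pball _ _ ht hs))// ge_min lexx orbT.
  have FE : F t' = F t + 'i * s%:C.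
    by rewrite /F ft' ft1 /P; field.
  have ut : u t' = u t.
    by rewrite /u FE Re_addi.
  have tt := u_inj _ _ t'n (lt_trans ht rn) ut.
  move: FE; rewrite tt => /(congr1 (@complex.Im R)); rewrite Im_addi; lra.
have cP1 s : {within [set t | `|t - t0| < r], continuous (P^~ s)}.
  apply/within_continuousCP => t /= ht.
  apply: cvgD; last exact: cvg_cst.
  apply/cvgCP => q q0; apply/withinRP.
  exists (Num.min (n - `|t - t0|) (q / (2 * cmod d))).
    by rewrite lt_min subr_gt0 (lt_trans ht rn) divr_gt0// mulr_gt0.
  move=> y; rewrite lt_min => /andP[y1 y2] _.
  have hy : `|y - t0| < n.
    by have := ler_normD (y - t) (t - t0); rewrite addrA subrK; move: y1; clear; lra.
  have := Fd _ _ hy (lt_trans ht rn).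
  have -> : f y - f t = (F y - F t - (y - t)%:C + (y - t)%:C) * d.
    by rewrite /F; field.
  rewrite cmodM => h; have := cmodD (F y - F t - (y - t)%:C) (y - t)%:C.
  rewrite cmod_real => h'.
  move: y2; rewrite ltr_pdivlMr ?mulr_gt0// => y2.
  apply: le_lt_trans (y2); rewrite mulrA ler_pM2r//.
  by move: h h' (normr_ge0 (y - t)); move: (cmod _) (cmod _) `|_|; clear => *; lra.
have cP2 t : continuous (P t).
  move=> s; apply: cvgD; first exact: cvg_cst.
  apply: cvgM; last exact: cvg_cst.
  by apply: cvgM; [exact: cvg_cst|exact: cvg_RtoC].
(* Connected as a comb: vertical pieces over each t, all attached to the translate of the curve at
   height s0. *)
have conn (J : set R) (s0 : R) : connected J -> J s0 -> J `<=` [set s | `|s| < r] ->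
    connected [set z | exists t s, [/\ `|t - t0| < r, J s & z = P t s]].
  move=> cJ Js0 Jr.
  rewrite [X in connected X](_ : _ = \bigcup_(t in [set t | `|t - t0| < r])
     ((P t @` J) `|` (P^~ s0 @` [set t | `|t - t0| < r]))); last first.
    apply/seteqP; split=> [z [t [s [ht Js ->]]]|z [t ht [[s Js <-]|[t' ht' <-]]]].
    - by exists t => //; left; exists s.
    - by exists t, s.
    - by exists t', s0.
  apply: bigcup_connected.
    exists (P t0 s0) => t ht; right; exists t0 => //=.
    by rewrite subrr normr0.
  move=> t ht; apply: connectedU.
  - by exists (P t s0); split; [exists s0|exists t].
  - apply: connected_continuous_connected => //; exact: continuous_subspaceT.
  - apply: connected_continuous_connected => //.
    apply/connected_intervalP => x y /= hx hy z /andP[xz zy].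
    by move: hx hy xz zy; rewrite !ltr_norml; clear; lra.
exists [set z | exists t s, [/\ `|t - t0| < r, `|s| < r & z = P t s]].
exists [set z | exists t s, [/\ `|t - t0| < r, [set s | 0 < s < r] s & z = P t s]].
exists [set z | exists t s, [/\ `|t - t0| < r, [set s | - r < s < 0] s & z = P t s]].
split.
(* A point near f t0 is [P t s] with t given by the intermediate value theorem for the abscissa and
   s the difference of ordinates; r / 6 keeps |t - t0| and |s| below r. *)
- pose q := Num.min (r / 6) 1.
  have q0 : 0 < q by rewrite lt_min ltr01 andbT divr_gt0.
  have qr : q <= r / 6 by rewrite ge_min lexx.
  apply/nbhsCP; exists (q * cmod d); first by rewrite mulr_gt0.
  move=> w ww; pose o := (w - f t0) / d.
  have oq : cmod o < q by rewrite /o cmodM cmodV ltr_pdivrMr.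
  have h1 := le_lt_trans (cmod_Re o) oq; have h2 := le_lt_trans (cmod_Im o) oq.
  pose t1 := t0 - r / 2; pose t2 := t0 + r / 2.
  have b1 : `|t1 - t0| < n.
    by rewrite /t1 ltr_norml; move: rn r0; clear; lra.
  have b2 : `|t2 - t0| < n.
    by rewrite /t2 ltr_norml; move: rn r0; clear; lra.
  have u1 : u t1 <= - (r / 4).
    have := ud _ _ b1 t0n; rewrite u0 subr0 /t1 addrAC subrr add0r normrN.
    rewrite [X in _ <= X / _]gtr0_norm ?divr_gt0// ler_norml; move: r0; clear; lra.
  have u2 : r / 4 <= u t2.
    have := ud _ _ b2 t0n; rewrite u0 subr0 /t2 addrAC subrr add0r.
    rewrite [X in _ <= X / _]gtr0_norm ?divr_gt0// ler_norml; move: r0; clear; lra.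
  have t12 : t1 <= t2 by rewrite /t1 /t2; move: r0; clear; lra.
  have cu : {within `[t1, t2], continuous u}.
    apply/subspace_continuousP => t; rewrite /= in_itv /= => /andP[tt1 tt2].
    have tn : `|t - t0| < n.
      by move: b1 b2 tt1 tt2; rewrite !ltr_norml; clear; lra.
    move=> A /nbhsRP [q1 q10 qA]; apply/withinRP.
    exists (Num.min (n - `|t - t0|) (q1 / 2)).
      by rewrite lt_min subr_gt0 tn divr_gt0.
    move=> y; rewrite lt_min => /andP[y1 y2] _; apply: qA.
    have yn : `|y - t0| < n.
      by have := ler_normD (y - t) (t - t0); rewrite addrA subrK; move: y1; clear; lra.
    have := ud _ _ yn tn; have := ler_normD (u y - u t - (y - t)) (y - t).
    by rewrite subrK; move: y2 (normr_ge0 (y - t)); clear; lra.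
  have [] := @IVT R u t1 t2 (complex.Re o) t12 cu.
    rewrite ge_min le_max; move: h1; rewrite ltr_norml => /andP[h1 h1'].
    apply/andP; split; apply/orP; [left|right]; move: u1 u2 h1 h1' qr r0; clear; lra.
  move=> t; rewrite in_itv /= => /andP[tt1 tt2] ut.
  have tn : `|t - t0| < n.
    by move: b1 b2 tt1 tt2; rewrite !ltr_norml; clear; lra.
  have tq : `|t - t0| <= 2 * q.
    have := ud _ _ tn t0n; rewrite u0 subr0 ut => h.
    have := ler_normD (- (complex.Re o - (t - t0))) (complex.Re o).
    rewrite normrN opprB subrK; move: h h1; clear; lra.
  exists t, (complex.Im o - v t); split.
  - by move: tq qr q0; clear; lra.
  - have := vd _ _ tn t0n; rewrite v0 subr0.
    by have := ler_normB (complex.Im o) (v t); move: tq qr q0 h2; clear; lra.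
  - have FE : F t + 'i * (complex.Im o - v t)%:C = o.
      by apply/eqP; rewrite eq_complex Re_addi Im_addi -/(u t) -/(v t) ut addrC subrK !eqxx.
    rewrite /P [f t]fE -addrA -mulrDl FE /o divfK// addrC subrK //.
- split.
  + apply: (conn _ (r / 2)).
    * apply/connected_intervalP => x y /= /andP[x1 x2] /andP[y1 y2] z /andP[z1 z2].
      by move: x1 x2 y1 y2 z1 z2; clear => *; apply/andP; split; lra.
    * by rewrite /= divr_gt0//=; move: r0; clear; lra.
    * by move=> s /= /andP[s1 s2]; rewrite gtr0_norm.
  + apply: (conn _ (- (r / 2))).
    * apply/connected_intervalP => x y /= /andP[x1 x2] /andP[y1 y2] z /andP[z1 z2].
      by move: x1 x2 y1 y2 z1 z2; clear => *; apply/andP; split; lra.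
    * by rewrite /=; move: r0; clear; lra.
    * by move=> s /= /andP[s1 s2]; rewrite ltr0_norm// ltrNl.
- split=> z [t [s [ht /= /andP[s1 s2] ->]]]; split.
  + by apply: PU => //; rewrite gtr0_norm.
  + move=> rz; have := Prange _ _ ht _ rz; rewrite gtr0_norm// => /(_ s2) sz.
    by rewrite sz ltxx in s1.
  + by apply: PU => //; rewrite ltr0_norm// ltrNl.
  + move=> rz; have := Prange _ _ ht _ rz; rewrite ltr0_norm// ltrNl => /(_ s1) sz.
    by rewrite sz ltxx in s2.
- move=> z [[t [s [ht hs ->]]] nr].
  have [s0|s0|s0] := ltgtP s 0.
  + right; exists t, s; split => //=; rewrite s0 andbT.
    by move: hs; rewrite ltr_norml => /andP[].
  + left; exists t, s; split => //=; rewrite s0 /=.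
    by move: hs; rewrite ltr_norml => /andP[].
  + by exfalso; apply: nr; rewrite s0; exists t => //; rewrite /P mulr0 mul0r addr0.
- move=> z [[t [s [ht hs ->]]] rz].
  rewrite (Prange _ _ ht hs rz).
  split => A /(cP2 t 0) /nbhsRP [q q0 qA].
    pose m := Num.min (q / 2) (r / 2).
    have m0 : 0 < m by rewrite lt_min !divr_gt0.
    have mq : m <= q / 2 by rewrite ge_min lexx.
    have mr : m <= r / 2 by rewrite ge_min lexx orbT.
    exists (P t m); split.
      by exists t, m; split => //=; rewrite m0 /=; move: r0 mr; clear; lra.
    by apply: qA; rewrite subr0 gtr0_norm//; move: q0 mq; clear; lra.
  pose m := Num.min (q / 2) (r / 2).
  have m0 : 0 < m by rewrite lt_min !divr_gt0.
  have mq : m <= q / 2 by rewrite ge_min lexx.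
  have mr : m <= r / 2 by rewrite ge_min lexx orbT.
  exists (P t (- m)); split.
    by exists t, (- m); split => //=; move: r0 mr m0; clear; lra.
  by apply: qA; rewrite subr0 normrN gtr0_norm//; move: q0 mq; clear; lra.
Qed.

End Collar.

(** * Connected sets cut by a curve *)

Section Separation.
Variable T : topologicalType.
Implicit Types A B G X S U V : set T.

Lemma open_disjoint_separated A B : open A -> open B -> A `&` B = set0 ->
  separated A B.
Proof.
move=> oA oB AB; split; rewrite -subset0 => x [].
  move=> cA Bx; have [y [Ay By]] := cA B (open_nbhs_nbhs (conj oB Bx)).
  by rewrite -[set0 x]/(set0 y) -AB; split.
move=> Ax cB; have [y [By Ay]] := cB A (open_nbhs_nbhs (conj oA Ax)).
by rewrite -[set0 x]/(set0 y) -AB; split.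
Qed.

Lemma connected_closed_cover A (F1 F2 : set T) : connected A ->
  closed F1 -> closed F2 -> A `<=` F1 `|` F2 -> A `&` F1 `&` F2 = set0 ->
  A `&` F1 = set0 \/ A `&` F2 = set0.
Proof.
move=> cA c1 c2 cov dis.
have [->|/set0P ne] := eqVneq (A `&` F1) set0; [by left|right].
have e : A `&` F1 = A.
  apply: cA => //; last by exists F1.
  exists (~` F2); first exact: closed_openC.
  apply/seteqP; split=> x [Ax h]; split => //.
    by move=> F2x; have : (A `&` F1 `&` F2) x by []; rewrite dis.
  by case: (cov _ Ax).
by rewrite -[in LHS]e dis.
Qed.

(** A form of local connectedness of G at the boundary point x: the two parts of a separation of G
    cannot both accumulate at x. *)
Definition one_sided_at G (x : T) : Prop :=
  forall U, nbhs x U -> exists V S, [/\ nbhs x V, connected S,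
    S `<=` U `&` G & V `&` G `<=` S].

(** If G is separated, every point of A is a limit of only one part, and A, being connected, misses
    the closure of one of them. That part is clopen in X, hence all of X, although A lies in X and
    avoids G. X is the sphere for a single arc, and the sphere minus the other arcs in the
    induction. *)
Lemma connected_one_side X G A : connected X -> open X -> open G -> G `<=` X ->
  A `<=` X -> connected A -> A !=set0 -> A `&` G = set0 -> A `<=` closure G ->
  closure G `&` X `<=` G `|` A ->
  (forall x, A x -> one_sided_at G x) -> connected G.
Proof.
move=> cX oX oG GX AX cA [a0 Aa0] AG Acl clG sided; apply: contrapT.
move/connectedPn => [E [E0 GE [s1 s2]]].
have Edis b : closure (E b) `&` E (~~ b) = set0.
  by case: b => //=; rewrite setIC.
have Esub b : E b `<=` G by rewrite GE; case: b => x; [right|left].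
have oE b : open (E b).
  rewrite (_ : E b = G `&` ~` closure (E (~~ b))).
    by apply: openI => //; exact/closed_openC/closed_closure.
  apply/seteqP; split => x.
    move=> Ex; split; first exact: Esub Ex.
    by move=> cx; rewrite -[False]/(set0 x) -(Edis (~~ b)) negbK; split.
  move=> [Gx nx]; move: Gx; rewrite GE; case: b nx => nx [] h //; exfalso;
    exact/nx/subset_closure.
have key b : A `&` closure (E b) = set0 -> False.
  move=> Ab; have [y Ey] := E0 b.
  suff e : E b = X.
    have : (A `&` G) a0 by split => //; apply: (Esub b); rewrite e; exact: AX.
    by rewrite AG.
  apply: cX; [by exists y| |].
  - exists (E b) => //; apply/seteqP; split => x; last by case.
    by move=> Ex; split => //; apply/GX/(Esub b).
  - exists (closure (E b)); first exact: closed_closure.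
    apply/seteqP; split => x.
      by move=> Ex; split; [apply/GX/(Esub b)|exact: subset_closure].
    move=> [Xx cx]; have : (G `|` A) x.
      by apply: clG; split => //; exact: closure_subset (Esub b) _ cx.
    case=> [|Ax]; last by exfalso; rewrite -[False]/(set0 x) -Ab.
    have : ~ E (~~ b) x by move=> h; rewrite -[False]/(set0 x) -(Edis b).
    by rewrite GE; case: (b) => nx [].
have [] := @connected_closed_cover A (closure (E false)) (closure (E true)) cA.
- exact: closed_closure.
- exact: closed_closure.
- by rewrite -closureU -GE.
- rewrite -subset0 => x [[Ax c1] c2].
  have [V [S [nV cS SU VG]]] := sided x Ax setT filterT.
  have SG : S `<=` G by move=> y /SU [].
  have [|h|h] := connected_subset (conj s1 s2) _ cS; first by rewrite -GE.
    have [y [Ey Vy]] := c2 V nV.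
    rewrite -[set0 x]/(set0 y) -(Edis false); split => //.
    by apply/subset_closure/h/VG; split => //; exact: Esub Ey.
  have [y [Ey Vy]] := c1 V nV.
  rewrite -[set0 x]/(set0 y) -(Edis true); split => //.
  by apply/subset_closure/h/VG; split => //; exact: Esub Ey.
- exact: key.
- exact: key.
Qed.

End Separation.

(* A sphere-like space cut by a curve A, with an involution swapping the two
   sides G and i @^-1` G: the curve has no point where both local sides belong
   to the same region, because the set of good points is clopen in A. *)
Section Involution.
Variables (T : topologicalType) (i : T -> T) (G A : set T).
Hypothesis ci : continuous i.
Hypothesis iK : involutive i.
Hypothesis oG : open G.
Local Notation G' := (i @^-1` G).
Hypothesis tri : forall x, [\/ G x, A x | G' x].
Hypothesis GA : forall x, G x -> ~ A x.
Hypothesis GA' : forall x, G' x -> ~ A x.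
Hypothesis GG' : forall x, G x -> ~ G' x.
Hypothesis cA : connected A.
Hypothesis sided : forall x, A x -> two_sided_at A x.
Variable x0 : T.
Hypothesis Ax0 : A x0.
Hypothesis ix0 : i x0 = x0.

Let oG' : open G'.
Proof. by apply: open_comp => // x _; exact: ci. Qed.

Let side S : connected S -> (forall x, S x -> ~ A x) -> S `<=` G \/ S `<=` G'.
Proof.
move=> cS SA; apply: connected_subset cS.
  apply: open_disjoint_separated => //; rewrite -subset0 => x [Gx].
  exact: GG'.
by move=> x /SA nA; case: (tri x) => // h; [left|right].
Qed.

Lemma curve_sides : A `<=` closure G `&` closure G'.
Proof.
pose cc := closure G `&` closure G'.
have ccl : closed cc by apply: closedI; exact: closed_closure.
have x0cc : cc x0.
  (* Near x0 there is y off A such that y and i y both lie in U; one of them is in G and the other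
     in G'. *)
  have main U : nbhs x0 U -> exists2 y, (U `&` i @^-1` U) y & ~ A y.
    move=> nU; have nU' : nbhs x0 (i @^-1` U) by apply: ci; rewrite ix0.
    have [V [S1 [S2 [nV _ [s1 _] _ h]]]] := sided Ax0 (filterI nU nU').
    have [c1 _] : (closure S1 `&` closure S2) x0.
      by apply: h; split => //; exact: nbhs_singleton.
    have [y [Sy _]] := c1 V nV; have [hU nA] := s1 _ Sy.
    by exists y.
  split=> U /main [y [Uy Uiy] nA].
    case: (tri y) => // h; first by exists y.
    by exists (i y).
  case: (tri y) => // h; last by exists y.
  by exists (i y); split => //=; rewrite iK.
suff e : A `&` cc = A by move=> x; rewrite -{1}e => -[].
apply: cA; [by exists x0| |by exists cc].
exists (interior (~` A `|` cc)); first exact: open_interior.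
apply/seteqP; split => x [Ax]; last first.
  by move=> /interior_subset [//|h]; split.
move=> [cG cG']; split => //.
have [V [S1 [S2 [nV [c1 c2] [s1 s2] VS VA]]]] := sided Ax filterT.
have n1 y : S1 y -> ~ A y by move=> /s1 [].
have n2 y : S2 y -> ~ A y by move=> /s2 [].
(* Each local piece is connected and off A, hence on one side. Since both sides accumulate at x, the
   two pieces lie on different sides, and this transfers to all points of A in V. *)
have oneG : S1 `<=` G /\ S2 `<=` G' \/ S1 `<=` G' /\ S2 `<=` G.
  case: (side c1 n1) => h1; case: (side c2 n2) => h2; try by [left|right].
    exfalso; have [y [G'y Vy]] := cG' V nV.
    by case: (VS y); [by split => //; exact: GA'|move/h1|move/h2] => /GG'.
  exfalso; have [y [Gy Vy]] := cG V nV.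
  by case: (VS y); [by split => //; exact: GA|move/h1|move/h2] => h; apply: (GG' Gy).
apply: filterS nV => y Vy.
have [Ay|] := pselect (A y); [right|by left].
have [d1 d2] : (closure S1 `&` closure S2) y by apply: VA.
case: oneG => -[h1 h2]; split.
- exact: closure_subset h1 _ d1.
- exact: closure_subset h2 _ d2.
- exact: closure_subset h2 _ d2.
- exact: closure_subset h1 _ d1.
Qed.

Lemma curve_one_sided x : A x -> one_sided_at G x.
Proof.
move=> Ax U nU; have [V [S1 [S2 [nV [c1 c2] [s1 s2] VS VA]]]] := sided Ax nU.
have n1 y : S1 y -> ~ A y by move=> /s1 [].
have n2 y : S2 y -> ~ A y by move=> /s2 [].
have [cG cG'] := curve_sides Ax.
case: (side c1 n1) => h1; case: (side c2 n2) => h2.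
- exfalso; have [y [G'y Vy]] := cG' V nV.
  by case: (VS y); [by split => //; exact: GA'|move/h1|move/h2] => /GG'.
- exists V, S1; split => //; first by move=> y Sy; split; [case: (s1 _ Sy)|exact: h1].
  move=> y [Vy Gy]; case: (VS y) => //; first by split => //; exact: GA.
  by move/h2 => h; exfalso; exact: GG' Gy h.
- exists V, S2; split => //; first by move=> y Sy; split; [case: (s2 _ Sy)|exact: h2].
  move=> y [Vy Gy]; case: (VS y) => //; first by split => //; exact: GA.
  by move/h1 => h; exfalso; exact: GG' Gy h.
- exfalso; have [y [Gy Vy]] := cG V nV.
  by case: (VS y); [by split => //; exact: GA|move/h1|move/h2] => h; apply: (GG' Gy).
Qed.

Lemma closure_side : closure G `<=` G `|` A.
Proof.
move=> x cx; case: (tri x); [by left|by right|move=> h; exfalso].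
have [y [Gy G'y]] := cx _ (open_nbhs_nbhs (conj oG' h)).
exact: GG' Gy G'y.
Qed.

Lemma boundary_side : closure G `\` G = A.
Proof.
apply/seteqP; split => x.
  by move=> [/closure_side[]].
by move=> Ax; split; [case: (curve_sides Ax)|move/GA].
Qed.

Lemma connected_side : connected [set: T] -> connected G.
Proof.
move=> cT; apply: (@connected_one_side _ setT G A) => //.
- exact: openT.
- by exists x0.
- by rewrite -subset0 => x [Ax /GA].
- by move=> x /curve_sides [].
- by move=> x [/closure_side].
- exact: curve_one_sided.
Qed.

Lemma connected_other_side : connected [set: T] -> connected (~` G).
Proof.
move=> cT; rewrite (_ : ~` G = closure G').
  apply: connected_closure; rewrite (_ : G' = i @` G).
    apply: connected_continuous_connected; first exact: connected_side.
    exact: continuous_subspaceT.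
  apply/seteqP; split => [x Gx|_ [x Gx <-]]; last by rewrite /= iK.
  by exists (i x) => //; rewrite iK.
apply/seteqP; split => x.
  move=> nG; case: (tri x) => // h; last exact: subset_closure.
  by case: (curve_sides h).
move=> cx Gx; have [y [G'y Gy]] := cx _ (open_nbhs_nbhs (conj oG Gx)).
exact: GG' Gy G'y.
Qed.

End Involution.

(** * Transfer between plane and sphere, and counting of components *)

Section SphereSubsets.
Variable R : realType.
Local Notation C := (R[i]).
Local Notation S := (Cinf R).

Lemma two_sided_sphere (A : set C) (x : C) :
  two_sided_at A x -> two_sided_at (Some @` A : set S) (Some x).
Proof.
move=> h U nU; have {}nU : nbhs x (fun y => U (Some y)) by exact: nU.
have cS : continuous (Some : C -> S).
  exact: one_point_compactification_some_continuous.
have clim (B : set C) y : closure B y -> closure (Some @` B : set S) (Some y).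
  by move=> cB W /(cS y) /cB [z [Bz Wz]]; exists (Some z); split => //; exists z.
have [V [S1 [S2 [nV [c1 c2] [s1 s2] VS VA]]]] := h _ nU.
exists (Some @` V), (Some @` S1), (Some @` S2); split.
- exact: one_point_compactification_some_nbhs.
- by split; apply: connected_continuous_connected => //; exact: continuous_subspaceT.
- split=> _ [y Sy <-]; [have [Uy nA] := s1 _ Sy|have [Uy nA] := s2 _ Sy];
    by split => // -[z Az [zy]]; apply: nA; rewrite -zy.
- move=> _ [[y Vy <-] nA]; have [] := VS y.
  + by split => // Ay; apply: nA; exists y.
  + by left; exists y.
  + by right; exists y.
- move=> _ [[y Vy <-] [z Az [zy]]]; rewrite zy in Az.
  by have [] := VA y (conj Vy Az); split; exact: clim.
Qed.

Definition fin_part (x : S) : C := odflt 0 x.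

Lemma continuous_fin_part (x : S) : x <> None -> {for x, continuous fin_part}.
Proof.
case: x => [x _|//] A nA; exact: nA.
Qed.

Lemma connected_finite_part (A : set S) : ~ A None -> connected A ->
  connected [set z : C | A (Some z)].
Proof.
move=> nA cA; rewrite (_ : [set z | _] = fin_part @` A).
  apply: connected_continuous_connected => //.
  apply/subspace_continuousP => x Ax.
  have nx : x <> None by move=> xN; apply: nA; rewrite -xN.
  move=> B /(continuous_fin_part nx) nB.
  have {}nB : nbhs x (fun y => B (fin_part y)) by exact: nB.
  have nW : nbhs x (fun y => A y -> B (fin_part y)) by apply: filterS nB.
  exact: nW.
apply/seteqP; split => [z Az|_ [[z|] Az <-]] //=; by exists (Some z).
Qed.

Lemma connected_components_setU (A B : set C) : closed A -> closed B ->
  A `&` B = set0 -> connected B -> B !=set0 ->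
  components (A `|` B) = components A `|` [set B] /\ ~ components A B.
Proof.
move=> clA clB AB cB [b Bb].
have sep : separated A B.
  by split; rewrite -?(closure_id _).1 // -?AB.
have ccA x : A x -> connected_component (A `|` B) x = connected_component A x.
  move=> Ax; apply/seteqP; split => y; last first.
    move=> [D [Dx DA cD] Dy]; exists D => //; split => //.
    by move=> z /DA; left.
  move=> [D [Dx DA cD] Dy]; exists D => //; split => //.
  have [//|DB] := connected_subset sep DA cD.
  have : (A `&` B) x by split => //; exact: DB.
  by rewrite AB.
have ccB x : B x -> connected_component (A `|` B) x = B.
  move=> Bx; apply/seteqP; split => y; last first.
    by move=> By; exists B => //; split => //; right.
  move=> [D [Dx DA cD] Dy].
  have [DA'|DB] := connected_subset sep DA cD; last exact: DB.
  have : (A `&` B) x by split => //; exact: DA'.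
  by rewrite AB.
split.
  apply/seteqP; split => D.
    move=> [x [Ax|Bx] <-]; last by right; rewrite ccB.
    by left; exists x; rewrite ?ccA.
  move=> [[x Ax <-]|->]; first by exists x; [left|rewrite ccA].
  by exists b; [right|rewrite ccB].
move=> [x Ax xB]; have : connected_component A x b by rewrite xB.
by move=> /connected_component_sub Ab; rewrite -[False]/(set0 b) -AB.
Qed.

Lemma card_components_setU (A B : set C) n : closed A -> closed B ->
  A `&` B = set0 -> connected B -> B !=set0 ->
  (components A #= `I_n)%card -> (components (A `|` B) #= `I_n.+1)%card.
Proof.
move=> clA clB AB cB B0 cn.
have [-> nB] := connected_components_setU clA clB AB cB B0.
apply/eq_cardSP; exists B; first by right.
rewrite (_ : _ `\ B = components A) //.
apply/seteqP; split => D; first by move=> [[h|DB] nD].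
by move=> h; split; [left|move=> DB; apply: nB; rewrite -DB].
Qed.

End SphereSubsets.

(** * Regularity classes *)

Section DerivativeRules.
Variable R : realType.
Local Notation C := (R[i]).
Variable D : set R.
Implicit Types f g F : R -> C.

Lemma cvg_dnbhs_continuous f t : {within D, continuous f} -> D t ->
  f @ within D t^' --> f t.
Proof.
move=> /within_continuousCP cf Dt A /(cf _ Dt) /withinRP [e e0 eA].
by apply/dnbhsP; exists e => // s st _; exact: eA.
Qed.

Lemma cvg_dnbhs_near_eq f g (t : R) (l : C) : (\forall s \near within D t^', f s = g s) ->
  f @ within D t^' --> l -> g @ within D t^' --> l.
Proof.
move=> fg fl A /fl nA.
have {}nA : (within D t^') (fun s => A (f s)) by exact: nA.
have nB : (within D t^') (fun s => A (g s)).
  by apply: filterS2 fg nA => s ->.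
exact: nB.
Qed.

Lemma near_dnbhs_in t (P : R -> Prop) : (forall s, D s -> P s) ->
  \forall s \near within D t^', P s.
Proof. by move=> h; apply/dnbhsP; exists 1 => // s _ _; exact: h. Qed.

Lemma cvg_neq0 (T : Type) (F : set_system T) {FF : Filter F} (h : T -> C) l :
  l != 0 -> h @ F --> l -> \forall s \near F, h s != 0.
Proof.
move=> l0 /cvgCP /(_ (cmod l)); rewrite cmod_gt0 => /(_ l0); apply: filterS => s.
by apply: contraTneq => ->; rewrite sub0r cmodN ltxx.
Qed.

Lemma is_deriv_on_ext f g (g' : R -> C) : (forall t, D t -> f t = g t) ->
  is_deriv_on D f g' -> is_deriv_on D g g'.
Proof.
move=> fg fd t Dt; apply: cvg_dnbhs_near_eq (fd t Dt).
by apply: near_dnbhs_in => s Ds; rewrite !fg.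
Qed.

Lemma is_deriv_on_cst (c : C) : is_deriv_on D (fun=> c) (fun=> 0).
Proof.
move=> t Dt; rewrite subrr; under eq_fun do rewrite mul0r.
exact: cvg_cst.
Qed.

Lemma is_deriv_on_id : is_deriv_on D (fun t => t%:C) (fun=> 1).
Proof.
move=> t Dt; apply: (@cvg_dnbhs_near_eq (fun=> 1)); last exact: cvg_cst.
apply/dnbhsP; exists 1 => // s _ st _.
by rewrite -rmorphB divff// eq_complex /= eqxx andbT subr_eq0.
Qed.

Lemma is_deriv_onD f (f' : R -> C) g (g' : R -> C) : is_deriv_on D f f' -> is_deriv_on D g g' ->
  is_deriv_on D (fun t => f t + g t) (fun t => f' t + g' t).
Proof.
move=> fd gd t Dt.
have h : (fun s => (f s - f t) / (s - t)%:C + (g s - g t) / (s - t)%:C)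
    @ within D t^' --> f' t + g' t by apply: cvgD; [exact: fd|exact: gd].
move: h; by apply: cvg_dnbhs_near_eq; apply: near_dnbhs_in => s _; rewrite /=; ring.
Qed.

Lemma is_deriv_onM f (f' : R -> C) g (g' : R -> C) : is_deriv_on D f f' -> is_deriv_on D g g' ->
  is_deriv_on D (fun t => f t * g t) (fun t => f' t * g t + f t * g' t).
Proof.
move=> fd gd t Dt; have cg := is_deriv_on_continuous gd.
have h : (fun s => (f s - f t) / (s - t)%:C * g s + f t * ((g s - g t) / (s - t)%:C))
    @ within D t^' --> f' t * g t + f t * g' t.
  apply: cvgD; apply: cvgM; [exact: fd|exact: cvg_dnbhs_continuous| |exact: gd].
  exact: cvg_cst.
move: h; by apply: cvg_dnbhs_near_eq; apply: near_dnbhs_in => s _; rewrite /=; ring.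
Qed.

Lemma is_deriv_onV f f' : (forall t, D t -> f t != 0) -> is_deriv_on D f f' ->
  is_deriv_on D (fun t => (f t)^-1) (fun t => - f' t * (f t)^-1 * (f t)^-1).
Proof.
move=> f0 fd t Dt; have cf := is_deriv_on_continuous fd.
have h : (fun s => - ((f s - f t) / (s - t)%:C) * (f s)^-1 * (f t)^-1)
    @ within D t^' --> - f' t * (f t)^-1 * (f t)^-1.
  apply: cvgM; last exact: cvg_cst.
  apply: cvgM; first by apply: cvgN; exact: fd.
  by apply: cvgV; [exact: f0|exact: cvg_dnbhs_continuous].
move: h; apply: cvg_dnbhs_near_eq; apply: near_dnbhs_in => s Ds /=.
have h : (f s)^-1 - (f t)^-1 = - (f s - f t) / f s / f t.
  by field; rewrite !f0.
by rewrite h; ring.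
Qed.

(** Continuity of f suffices: f s ^+ 2 - f t ^+ 2 has the factor f s - f t, and the cofactor f s + f
    t tends to 2 f t, which is not 0. *)
Lemma is_deriv_on_sqrt f q' : (forall t, D t -> f t != 0) ->
  {within D, continuous f} -> is_deriv_on D (fun t => f t ^+ 2) q' ->
  is_deriv_on D f (fun t => q' t * (2 * f t)^-1).
Proof.
move=> f0 cf qd t Dt.
have n0 : 2 * f t != 0 by rewrite mulf_neq0 ?f0 ?pnatr_eq0.
have c2 : (fun s => f s + f t) @ within D t^' --> 2 * f t.
  rewrite mulr_natl mulr2n; apply: cvgD; first exact: cvg_dnbhs_continuous.
  exact: cvg_cst.
have h : (fun s => (f s ^+ 2 - f t ^+ 2) / (s - t)%:C * (f s + f t)^-1)
    @ within D t^' --> q' t * (2 * f t)^-1.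
  by apply: cvgM; [exact: qd|exact: cvgV].
move: h; apply: cvg_dnbhs_near_eq.
apply: filterS (cvg_neq0 n0 c2) => s s0 /=.
by rewrite subr_sqr mulrAC mulfK.
Qed.

(** The same device for w + 1/w: the difference factors exactly through F s - F t, and the cofactor
    has a nonzero limit because F avoids 1 and -1. No inverse function theorem is involved. *)
Lemma is_deriv_on_joukowski (m k : C) f (f' : R -> C) F : k != 0 ->
  {within D, continuous F} ->
  (forall t, D t -> [/\ F t != 0, F t != 1 & F t != -1]) ->
  (forall t, D t -> f t = m + k * (F t + (F t)^-1)) ->
  is_deriv_on D f f' ->
  is_deriv_on D F (fun t => f' t * (k * (1 - (F t)^-1 * (F t)^-1))^-1).
Proof.
move=> k0 cF F0 fF fd t Dt; have [Ft0 Ft1 FtN1] := F0 _ Dt.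
have n0 : k * (1 - (F t)^-1 * (F t)^-1) != 0.
  rewrite mulf_neq0//.
  have -> : 1 - (F t)^-1 * (F t)^-1 = (F t - 1) * (F t - (-1)) * (F t)^-1 ^+ 2.
    by field.
  by rewrite !mulf_neq0 ?subr_eq0 ?expf_neq0 ?invr_eq0.
have c2 : (fun s => k * (1 - (F s)^-1 * (F t)^-1)) @ within D t^' -->
    k * (1 - (F t)^-1 * (F t)^-1).
  apply: cvgM; first exact: cvg_cst.
  apply: cvgB; first exact: cvg_cst.
  apply: cvgM; last exact: cvg_cst.
  by apply: cvgV => //; exact: cvg_dnbhs_continuous.
have h : (fun s => (f s - f t) / (s - t)%:C * (k * (1 - (F s)^-1 * (F t)^-1))^-1)
    @ within D t^' --> f' t * (k * (1 - (F t)^-1 * (F t)^-1))^-1.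
  by apply: cvgM; [exact: fd|exact: cvgV].
move: h; apply: cvg_dnbhs_near_eq.
have DF : \forall s \near within D t^', D s by apply: near_dnbhs_in.
apply: filterS2 DF (cvg_neq0 n0 c2) => s Ds s0 /=.
have [Fs0 _ _] := F0 _ Ds.
have -> : f s - f t = (F s - F t) * (k * (1 - (F s)^-1 * (F t)^-1)).
  by rewrite (fF _ Ds) (fF _ Dt); field; rewrite ?Fs0 ?Ft0.
by rewrite mulrAC mulfK.
Qed.

End DerivativeRules.

(** * Classes stable under field operations and square roots *)

Section RegularityClasses.
Variable R : realType.
Local Notation C := (R[i]).

(** The properties through which C^n and real-analytic functions are treated alike. A root enters
    through its continuity and its square alone, so the choice of a branch is left to topology. *)
Record regularity_class (D : set R) (P : (R -> C) -> Prop) : Prop :=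
  RegularityClass {
  rc_continuous : forall f : R -> C, P f -> {within D, continuous f};
  rc_ext : forall f g : R -> C, (forall t, D t -> f t = g t) -> P f -> P g;
  rc_cst : forall c : C, P (fun=> c);
  rc_add : forall f g : R -> C, P f -> P g -> P (fun t => f t + g t);
  rc_mul : forall f g : R -> C, P f -> P g -> P (fun t => f t * g t);
  rc_inv : forall f : R -> C, (forall t, D t -> f t != 0) -> P f -> P (fun t => (f t)^-1);
  rc_sqrt : forall f : R -> C, (forall t, D t -> f t != 0) -> {within D, continuous f} ->
    P (fun t => f t ^+ 2) -> P f }.

Fixpoint Cn (D : set R) (n : nat) (f : R -> C) : Prop :=
  if n is m.+1 then exists2 f', is_deriv_on D f f' & Cn D m f'
  else {within D, continuous f}.

Lemma CnW D n (f : R -> C) : Cn D n.+1 f -> Cn D n f.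
Proof.
elim: n f => [|n IH] f [f' fd cf']; first exact: is_deriv_on_continuous fd.
by exists f' => //; exact: IH.
Qed.

Lemma within_cvg (D : set R) (f : R -> C) t : {within D, continuous f} -> D t ->
  f @ within D (nbhs t) --> f t.
Proof. by move=> /within_continuousCP; exact. Qed.

(** Induction on n. The derivative of a root is q' / (2 f), in which f itself recurs, but only one
    class lower, where the induction hypothesis applies. *)
Lemma regularity_Cn D n : regularity_class D (Cn D n).
Proof.
elim: n => [|n [h1 h2 h3 h4 h5 h6 h7]]; split.
- by move=> f.
- move=> f g fg cf; apply/within_continuousCP => t Dt A.
  rewrite -(fg _ Dt) => /(within_cvg cf Dt) nA.
  have {}nA : (within D (nbhs t)) (fun s => A (f s)) by exact: nA.
  have nB : (within D (nbhs t)) (fun s => A (g s)).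
    move: nA => /withinRP [e e0 eA]; apply/withinRP; exists e; first exact: e0.
    by move=> s se Ds; rewrite -(fg _ Ds); exact: eA.
  exact: nB.
- by move=> c; apply: continuous_subspaceT => x; exact: cvg_cst.
- move=> f g cf cg; apply/within_continuousCP => t Dt.
  by apply: cvgD; [exact: within_cvg cf Dt|exact: within_cvg cg Dt].
- move=> f g cf cg; apply/within_continuousCP => t Dt.
  by apply: cvgM; [exact: within_cvg cf Dt|exact: within_cvg cg Dt].
- move=> f f0 cf; apply/within_continuousCP => t Dt.
  by apply: cvgV; [exact: f0|exact: within_cvg cf Dt].
- by move=> f _ cf _; exact: cf.
- by move=> f [f' fd _]; exact: is_deriv_on_continuous fd.
- by move=> f g fg [f' fd cf']; exists f'; [exact: is_deriv_on_ext fd|exact: cf'].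
- by move=> c; exists (fun=> 0); [exact: is_deriv_on_cst|exact: h3].
- move=> f g [f' fd cf] [g' gd cg].
  by exists (fun t => f' t + g' t); [exact: is_deriv_onD|exact: h4].
- move=> f g /[dup] /CnW f0 [f' fd cf] /[dup] /CnW g0 [g' gd cg].
  exists (fun t => f' t * g t + f t * g' t); first exact: is_deriv_onM.
  by apply: h4; apply: h5; [exact: cf|exact: g0|exact: f0|exact: cg].
- move=> f f0 /[dup] /CnW c0 [f' fd cf].
  exists (fun t => - f' t * (f t)^-1 * (f t)^-1); first exact: is_deriv_onV.
  have -> : (fun t => - f' t * (f t)^-1 * (f t)^-1) =
      (fun t => -1 * f' t * (f t)^-1 * (f t)^-1).
    by apply/funext => t; rewrite mulN1r.
  have cV : Cn D n (fun t => (f t)^-1) by apply: h6; [exact: f0|exact: c0].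
  apply: (h5 (fun t => -1 * f' t * (f t)^-1)); last exact: cV.
  apply: (h5 (fun t => -1 * f' t)); last exact: cV.
  by apply: h5; [exact: h3|exact: cf].
- move=> f f0 cf /[dup] /CnW c0 [q' qd cq].
  exists (fun t => q' t * (2 * f t)^-1); first exact: is_deriv_on_sqrt.
  apply: (h5 q'); first exact: cq.
  apply: (h6 (fun t => 2 * f t)).
    by move=> t Dt; rewrite mulf_neq0 ?f0 ?pnatr_eq0.
  by apply: (h5 (fun=> 2)); [exact: h3|exact: h7].
Qed.

Lemma rc_sub D P : regularity_class D P -> forall f g : R -> C, P f -> P g ->
  P (fun t => f t - g t).
Proof.
move=> rc f g Pf Pg.
rewrite (_ : (fun t => _) = (fun t => f t + -1 * g t)); last first.
  by apply/funext => t; rewrite mulN1r.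
apply: (rc_add rc); first exact: Pf.
by apply: (rc_mul rc); [exact: (rc_cst rc)|exact: Pg].
Qed.

Lemma rc_div D P : regularity_class D P -> forall f g : R -> C,
  (forall t, D t -> g t != 0) -> P f -> P g -> P (fun t => f t / g t).
Proof.
by move=> rc f g g0 Pf Pg; apply: (rc_mul rc); [exact: Pf|exact: (rc_inv rc)].
Qed.

Section OpenUp.
Variable g : R -> C.
Hypothesis cg : {within `[(- 1), 1]%classic, continuous g}.
Hypothesis ig : set_inj `[(- 1), 1]%classic g.

Lemma open_up_regular (D : set R) P (f : R -> C) : regularity_class D P ->
  (forall t, D t -> ~ arc_set g (f t)) -> P f -> P (open_up g \o f).
Proof.
move=> rc nf Pf; have In1 : `[(- 1), 1]%classic (-1 : R) by rewrite /= in_itv /= lexx; lra.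
have Ph : P (hroot g \o f).
  apply: (rc_sqrt rc).
  - by move=> t Dt; have [] := hroot_neq cg ig (nf _ Dt).
  - apply/within_continuousCP => t Dt.
    have cf := within_cvg (rc_continuous rc Pf) Dt.
    have ch : hroot g @ nbhs (f t) --> hroot g (f t).
      by apply: continuous_hroot; [exact: cg|exact: nf].
    exact: cvg_comp cf ch.
  - apply: (rc_ext rc (f := fun t => (g 1 - f t) / (g (-1) - f t))).
      by move=> t Dt /=; rewrite (hroot_sqr cg (nf _ Dt)).
    apply: (rc_div rc).
    + move=> t Dt; apply/eqP => /subr0_eq h; apply: (nf _ Dt).
      by exists (-1).
    + by apply: (rc_sub rc); [exact: (rc_cst rc)|assumption].
    + by apply: (rc_sub rc); [exact: (rc_cst rc)|assumption].
apply: (rc_div rc).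
- by move=> t Dt; have [] := hroot_neq cg ig (nf _ Dt).
- by apply: (rc_add rc); [exact: (rc_cst rc)|assumption].
- by apply: (rc_sub rc); [exact: (rc_cst rc)|assumption].
Qed.

(** The derivative of f divided by J'(w) = (b - a) / 4 * (1 - w^-2) at w = [open_up g (f t)]. *)
Definition open_up_deriv (f f' : R -> C) (t : R) : C :=
  f' t * ((g 1 - g (-1)) / 4 *
    (1 - (open_up g (f t))^-1 * (open_up g (f t))^-1))^-1.

Lemma open_up_is_deriv (D : set R) (f f' : R -> C) : (forall t, D t -> ~ arc_set g (f t)) ->
  is_deriv_on D f f' ->
  is_deriv_on D (open_up g \o f) (open_up_deriv f f') /\
  forall t, D t -> f' t != 0 -> open_up_deriv f f' t != 0.
Proof.
move=> nf fd; have cf := is_deriv_on_continuous fd.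
have k0 : (g 1 - g (-1)) / 4 != 0.
  by rewrite mulf_neq0 ?invr_eq0 ?pnatr_eq0// subr_eq0 eq_sym arc_ends.
split.
  apply: (is_deriv_on_joukowski (m := (g (-1) + g 1) / 2)) fd.
  - exact: k0.
  - exact: (open_up_regular (regularity_Cn D 0) nf cf).
  - by move=> t /nf nt; exact: (open_up_neq cg ig nt).
  - by move=> t /nf nt /=; rewrite -{1}(open_upK cg ig nt).
move=> t /nf nt f0; have [u0 u1 uN1] := open_up_neq cg ig nt.
rewrite /open_up_deriv mulf_neq0// invr_eq0 mulf_neq0//.
move: (open_up _ _) u0 u1 uN1 => u u0 u1 uN1.
have -> : 1 - u^-1 * u^-1 = (u - 1) * (u - (-1)) * u^-1 ^+ 2 by field.
by rewrite !mulf_neq0 ?subr_eq0 ?expf_neq0 ?invr_eq0.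
Qed.

Lemma open_up_deriv_regular (D : set R) P (f f' : R -> C) : regularity_class D P ->
  (forall t, D t -> ~ arc_set g (f t)) -> P f -> P f' -> P (open_up_deriv f f').
Proof.
move=> rc nf Pf Pf'; apply: (rc_div rc); [|exact: Pf'|].
  have k0 : (g 1 - g (-1)) / 4 != 0.
    by rewrite mulf_neq0 ?invr_eq0 ?pnatr_eq0// subr_eq0 eq_sym arc_ends.
  move=> t /nf nt; have [u0 u1 uN1] := open_up_neq cg ig nt.
  rewrite mulf_neq0//; move: (open_up _ _) u0 u1 uN1 => u u0 u1 uN1.
  have -> : 1 - u^-1 * u^-1 = (u - 1) * (u - (-1)) * u^-1 ^+ 2 by field.
  by rewrite !mulf_neq0 ?subr_eq0 ?expf_neq0 ?invr_eq0.
have PV : P (fun t => (open_up g (f t))^-1).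
  apply: (rc_inv rc); last exact: (open_up_regular rc nf Pf).
  by move=> t /nf nt; have [] := open_up_neq cg ig nt.
apply: (rc_mul rc); first exact: (rc_cst rc).
apply: (rc_sub rc); first exact: (rc_cst rc).
by apply: (rc_mul rc); exact: PV.
Qed.

End OpenUp.
End RegularityClasses.

(** * Power series *)

Section PolynomialNorm.
Variable R : realType.
Local Notation C := (R[i]).
Implicit Types (p q : {poly C}) (r : R) (z : C).

(** Submultiplicative like a supremum norm on a disc, but read off the coefficients, so that it
    passes to truncations of power series. *)
Definition pnorm r p : R := \sum_(k < size p) cmod p`_k * r ^+ k.

Lemma pnorm_wide r p n : (size p <= n)%N ->
  pnorm r p = \sum_(0 <= k < n) cmod p`_k * r ^+ k.
Proof.
move=> pn; rewrite (big_cat_nat (n := size p)) //= big_mkord -/(pnorm r p).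
rewrite [X in _ = _ + X]big_nat_cond big1 ?addr0// => i /andP[/andP[pi _] _].
by rewrite nth_default// cmod0 mul0r.
Qed.

Lemma pnorm_ge0 r p : 0 <= r -> 0 <= pnorm r p.
Proof. by move=> r0; apply: sumr_ge0 => k _; rewrite mulr_ge0 ?cmod_ge0 ?exprn_ge0. Qed.

Lemma pnormD r p q : 0 <= r -> pnorm r (p + q) <= pnorm r p + pnorm r q.
Proof.
move=> r0; pose n := maxn (size p) (size q).
rewrite !(@pnorm_wide _ _ n) ?leq_maxl ?leq_maxr ?size_polyD// -big_split /=.
apply: ler_sum => k _; rewrite coefD -mulrDl ler_wpM2r ?exprn_ge0//.
exact: cmodD.
Qed.

Lemma pnormZ r p z : pnorm r (z *: p) = cmod z * pnorm r p.
Proof.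
rewrite !(@pnorm_wide _ _ (size p)) ?size_scale_leq// mulr_sumr.
by apply: eq_bigr => k _; rewrite coefZ cmodM mulrA.
Qed.

Lemma pnorm_cons r p z : pnorm r (p * 'X + z%:P) = r * pnorm r p + cmod z.
Proof.
rewrite !(@pnorm_wide _ _ (size p).+1) ?leqnSn//; last first.
  by rewrite size_MXaddC; case: ifP.
rewrite big_nat_recl // coefD coefMX coefC /= add0r expr0 mulr1 addrC; congr (_ + _).
rewrite big_nat_recr //= nth_default // cmod0 mul0r addr0 mulr_sumr.
apply: eq_bigr => k _; rewrite coefD coefMX coefC /= addr0 exprS; ring.
Qed.

Lemma pnormM r p q : 0 <= r -> pnorm r (p * q) <= pnorm r p * pnorm r q.
Proof.
move=> r0; elim/poly_ind: p => [|p z IH].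
  by rewrite mul0r /pnorm size_poly0 !big_ord0 mul0r.
rewrite mulrDl (le_trans (pnormD _ _ r0))// pnorm_cons mulrDl lerD//.
  rewrite mulrAC -[_ * 'X]addr0 -[X in _ + X]/(0%:P) pnorm_cons cmod0 addr0.
  by rewrite -mulrA ler_wpM2l.
by rewrite mul_polyC pnormZ.
Qed.

Lemma pnormX r p n : 0 <= r -> pnorm r (p ^+ n) <= pnorm r p ^+ n.
Proof.
move=> r0; elim: n => [|n IH].
  rewrite !expr0 (@pnorm_wide _ _ 1) ?size_poly1// big_nat1 expr0 mulr1.
  by rewrite coef1 [cmod _]cmod1.
rewrite !exprS (le_trans (pnormM _ _ r0))// ler_wpM2l// pnorm_ge0//.
Qed.

Lemma pnorm_sum r (F : nat -> {poly C}) n : 0 <= r ->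
  pnorm r (\sum_(0 <= k < n) F k) <= \sum_(0 <= k < n) pnorm r (F k).
Proof.
move=> r0; elim: n => [|n IH].
  by rewrite !big_nil /pnorm size_poly0 big_ord0.
by rewrite !big_nat_recr //= (le_trans (pnormD _ _ r0))// lerD2r.
Qed.

Lemma cmod_sum (F : nat -> C) m n :
  cmod (\sum_(m <= k < n) F k) <= \sum_(m <= k < n) cmod (F k).
Proof.
elim/big_ind2: _ => [||//]; first by rewrite cmod0.
by move=> x1 x2 y1 y2 h1 h2; rewrite (le_trans (cmodD _ _))// lerD.
Qed.

Lemma horner_nat p n z : (size p <= n)%N ->
  p.[z] = \sum_(0 <= k < n) p`_k * z ^+ k.
Proof. by move=> pn; rewrite (horner_coef_wide _ pn) big_mkord. Qed.

(** At half the radius, every term of index at least N loses a factor 2^-N. *)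
Lemma pnorm_tail r p z N : 0 <= r -> cmod z <= r / 2 ->
  cmod (p.[z] - \sum_(0 <= k < N) p`_k * z ^+ k) <= (2 ^- N) * pnorm r p.
Proof.
move=> r0 zr; pose n := maxn (size p) N.
rewrite (@horner_nat p n) ?leq_maxl// (@pnorm_wide _ p n) ?leq_maxl//.
rewrite [\sum_(0 <= k < n) p`_k * _](big_cat_nat (n := N)) ?leq_maxr//=.
rewrite [\sum_(0 <= k < n) cmod _ * _](big_cat_nat (n := N)) ?leq_maxr//=.
rewrite addrAC subrr add0r.
rewrite (le_trans (cmod_sum _ _ _))// mulrDr.
rewrite ler_wpDl ?mulr_ge0 ?invr_ge0 ?exprn_ge0 ?sumr_ge0//.
  by move=> k _; rewrite mulr_ge0 ?cmod_ge0 ?exprn_ge0.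
rewrite mulr_sumr; apply: ler_sum_nat => k /andP[Nk _].
rewrite cmodM cmodX [leRHS]mulrCA ler_wpM2l ?cmod_ge0//.
rewrite (@le_trans _ _ ((r / 2) ^+ k))//.
  by rewrite lerXn2r ?nnegrE ?cmod_ge0 // (le_trans (cmod_ge0 z)).
rewrite expr_div_n mulrC ler_wpM2r ?exprn_ge0// lef_pV2 ?posrE ?exprn_gt0//.
by rewrite ler_eXn2l// ltr1n.
Qed.

End PolynomialNorm.

Section PowerSeries.
Variable R : realType.
Local Notation C := (R[i]).
Implicit Types (a c d : nat -> C) (r s A M e : R) (h y l z : C).

Definition psum c z n : C := \sum_(0 <= k < n) c k * z ^+ k.

Definition pser c z l : Prop :=
  forall e, 0 < e -> exists N0, forall N, (N0 <= N)%N -> cmod (psum c z N - l) < e.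

Lemma pserP c z l : pser c z l <-> series (fun n => c n * z ^+ n) @ \oo --> l.
Proof.
split=> [h|/cvgCP h e e0].
  by apply/cvgCP => e e0; have [N0 hN] := h e e0; exists N0.
by have [N0 _ hN] := h e e0; exists N0 => N NN; exact: hN.
Qed.

(* Weighted l^1 bounds on the coefficients form a Banach algebra norm, so that
   composition of power series needs no complex analysis. *)
Definition weight_le c r M : Prop :=
  forall n, \sum_(0 <= k < n) cmod (c k) * r ^+ k <= M.

Lemma weight_le_ge0 c r M : weight_le c r M -> 0 <= M.
Proof. by move=> /(_ 0%N); rewrite big_nil. Qed.

Lemma weight_leW c r s M : 0 <= s -> s <= r -> weight_le c r M -> weight_le c s M.
Proof.
move=> s0 sr h n; apply: le_trans (h n); apply: ler_sum => k _.
by rewrite ler_wpM2l ?cmod_ge0// lerXn2r ?nnegrE// (le_trans s0).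
Qed.

Lemma psum_le c r M z n : weight_le c r M -> cmod z <= r -> cmod (psum c z n) <= M.
Proof.
move=> h zr; apply: le_trans (h n); rewrite (le_trans (cmod_sum _ _ _))//.
apply: ler_sum => k _; rewrite cmodM cmodX ler_wpM2l ?cmod_ge0//.
by rewrite lerXn2r ?nnegrE ?cmod_ge0// (le_trans (cmod_ge0 z)).
Qed.

Lemma pser_le c r M z l : weight_le c r M -> cmod z <= r -> pser c z l -> cmod l <= M.
Proof.
move=> h zr cl; apply/ler_addgt0Pr => e e0; have [N0 /(_ N0 (leqnn _)) hN] := cl e e0.
have := psum_le N0 h zr; have := cmodD (psum c z N0) (l - psum c z N0).
by rewrite [_ + (l - _)]addrC subrK (cmodB l); lra.
Qed.

Lemma pser0 c : pser c 0 (c 0%N).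
Proof.
move=> e e0; exists 1%N => -[//|N] _; rewrite /psum big_nat_recl // expr0 mulr1 addrAC subrr add0r.
by rewrite big1 ?cmod0// => k _; rewrite exprS mul0r mulr0.
Qed.

Lemma pser_unique c z l l' : pser c z l -> pser c z l' -> l = l'.
Proof.
move=> h h'; apply/eqP; rewrite -subr_eq0 -cmod_eq0 eq_le cmod_ge0 andbT.
apply/ler_addgt0Pr => e e0; rewrite add0r.
have [N hN] := h (e / 2) (divr_gt0 e0 (ltr0n _ 2)).
have [N' hN'] := h' (e / 2) (divr_gt0 e0 (ltr0n _ 2)).
have := hN (maxn N N') (leq_maxl _ _); have := hN' (maxn N N') (leq_maxr _ _).
have := cmodD (l - psum c z (maxn N N')) (psum c z (maxn N N') - l').
by rewrite addrA subrK (cmodB l); lra.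
Qed.

Lemma half_power_lt A e : 0 < e -> exists N0, forall N, (N0 <= N)%N -> 2 ^- N * A < e.
Proof.
move=> e0; exists (Num.trunc (`|A| / e)).+1 => N hN.
have h1 : `|A| / e < (Num.trunc (`|A| / e)).+1%:R by exact: truncnS_gt.
have h2 : (Num.trunc (`|A| / e)).+1%:R <= 2 ^+ N :> R.
  by rewrite -natrX ler_nat (leq_trans hN)// ltnW// ltn_expl.
rewrite mulrC ltr_pdivrMr ?exprn_gt0// (le_lt_trans (ler_norm A))//.
by rewrite -ltr_pdivrMl// mulrC (lt_le_trans h1).
Qed.

Section Composition.
Variables a d : nat -> C.
Hypothesis d0 : d 0%N = 0.

Definition trunc_poly n : {poly C} := \poly_(k < n) d k.
Definition comp_trunc n : {poly C} := \sum_(0 <= k < n) a k *: trunc_poly n ^+ k.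
(** As [d 0 = 0], the coefficient of index k of the composite involves only terms of [a] and [d] of
    index at most k: the truncation at k.+1 already contains it, and no infinite sum is formed. *)
Definition comp_coef k : C := (comp_trunc k.+1)`_k.

Lemma trunc_polyX n m k : (k < m)%N -> (trunc_poly n ^+ m)`_k = 0.
Proof.
move=> km; have -> : trunc_poly n = (\poly_(k < n.-1) d k.+1) * 'X.
  apply/polyP => -[|i]; rewrite coefMX /= !coef_poly; first by rewrite d0; case: ifP.
  by case: n.
by rewrite exprMn coefMXn km.
Qed.

Lemma comp_truncS n k : (k < n)%N -> (comp_trunc n.+1)`_k = (comp_trunc n)`_k.
Proof.
move=> kn; rewrite /comp_trunc big_nat_recr //= coefD coefZ trunc_polyX// mulr0 addr0.
rewrite !coef_sum; apply: eq_bigr => m _; rewrite !coefZ; congr (_ * _).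
have -> : trunc_poly n.+1 = trunc_poly n + d n *: 'X^n.
  apply/polyP => i; rewrite coefD coefZ coefXn !coef_poly ltnS leq_eqVlt.
  case: (ltngtP i n) => [_|_|->]; rewrite ?mulr0 ?mulr1 ?addr0 ?add0r//.
apply/eqP; rewrite -subr_eq0 -coefB subrXX addrAC subrr add0r -scalerAl coefZ.
by rewrite coefXnM kn mulr0.
Qed.

Lemma comp_coefE n k : (k < n)%N -> (comp_trunc n)`_k = comp_coef k.
Proof.
elim: n => // n IH; rewrite ltnS leq_eqVlt => /orP[/eqP -> //|kn].
by rewrite comp_truncS// IH.
Qed.

Variables (r s A : R).
Hypothesis r0 : 0 < r.
Hypothesis s0 : 0 < s.
Hypothesis wa : weight_le a s A.
Hypothesis wd : weight_le d r (s / 2).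

Lemma pnorm_trunc_poly n : pnorm r (trunc_poly n) <= s / 2.
Proof.
rewrite (@pnorm_wide _ _ _ n) ?size_poly//; apply: le_trans (wd n).
apply: ler_sum_nat => k /andP[_ kn].
by rewrite coef_poly kn.
Qed.

Lemma pnorm_comp_trunc n : pnorm r (comp_trunc n) <= A.
Proof.
apply: le_trans (wa n); rewrite (le_trans (pnorm_sum _ _ (ltW r0)))//.
apply: ler_sum => k _; rewrite pnormZ ler_wpM2l ?cmod_ge0//.
rewrite (le_trans (pnormX _ _ (ltW r0)))// lerXn2r // ?nnegrE ?pnorm_ge0 ?(ltW s0) ?(ltW r0)//.
apply: le_trans (pnorm_trunc_poly n) _.
by rewrite ler_pdivrMr// ler_pMr// ler1n.
Qed.

Lemma weight_comp_coef : weight_le comp_coef r A.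
Proof.
move=> n; apply: le_trans (pnorm_comp_trunc n).
have sz : (size (comp_trunc n) <= maxn (size (comp_trunc n)) n)%N by rewrite leq_maxl.
rewrite (pnorm_wide _ sz) [leRHS](big_cat_nat (n := n)) ?leq_maxr//=.
rewrite ler_wpDr//; first by apply: sumr_ge0 => k _; rewrite mulr_ge0 ?cmod_ge0 ?exprn_ge0 ?ltW.
apply: ler_sum_nat => k /andP[_ kn].
by rewrite comp_coefE.
Qed.

(** The factor m from differentiating a power is absorbed by the passage from s to s / 2, since m.+1
    <= 2 ^ m. This is the reason for the bound s / 2 in [wd]. *)
Let powers_lip (u v : C) m : cmod u <= s / 2 -> cmod v <= s / 2 ->
  cmod (u ^+ m - v ^+ m) * s <= s ^+ m * cmod (u - v).
Proof.
move=> us vs; rewrite subrXX cmodM -mulrA mulrC ler_wpM2r ?cmod_ge0//.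
case: m => [|m]; first by rewrite big_ord0 cmod0 mul0r expr0.
rewrite exprSr ler_wpM2r ?(ltW s0)//.
apply: (@le_trans _ _ (\sum_(0 <= i < m.+1) (s / 2) ^+ m)).
  rewrite -(big_mkord xpredT (fun i => u ^+ (m.+1.-1 - i) * v ^+ i)).
  rewrite (le_trans (cmod_sum _ _ _))//.
  apply: ler_sum_nat => i /andP[_ im].
  rewrite cmodM !cmodX -{2}(subnK (im : (i <= m)%N)) exprD.
  by rewrite ler_pM ?exprn_ge0 ?cmod_ge0// lerXn2r ?nnegrE ?cmod_ge0// divr_ge0 ?ltW.
rewrite sumr_const_nat subn0 expr_div_n -mulrnAr ler_piMr ?exprn_ge0 ?(ltW s0)//.
rewrite -mulr_natl ler_pdivrMr ?exprn_gt0// mul1r -natrX ler_nat.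
exact: ltn_expl.
Qed.

(** Three errors of e / 3: the degrees from N on of the truncated composite, a tail at half the
    radius; the replacement of y by a partial sum of [d]; the convergence of [a] at y. *)
Lemma pser_comp h y l : cmod h <= r / 2 -> pser d h y -> pser a y l ->
  pser comp_coef h l.
Proof.
move=> hr dy al e e0.
have r1 : cmod h <= r by rewrite (le_trans hr)// ler_pdivrMr// ler_pMr// ler1n.
have ys : cmod y <= s / 2 := pser_le wd r1 dy.
have A0 : 0 <= A := weight_le_ge0 wa.
have e3 : 0 < e / 3 by rewrite divr_gt0.
have [N1 h1] := half_power_lt A e3.
have [N2 h2] := al _ e3.
have e4 : 0 < e / 3 * s / (A + 1) by rewrite !(divr_gt0, mulr_gt0)// ltr_wpDl.
have [N3 h3] := dy _ e4.
exists (maxn N1 (maxn N2 N3)) => N; rewrite !geq_max => /and3P[n1 n2 n3].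
have p1 : psum comp_coef h N = \sum_(0 <= k < N) (comp_trunc N)`_k * h ^+ k.
  by apply: eq_big_nat => k /andP[_ kN]; rewrite comp_coefE.
have := pnorm_tail (comp_trunc N) N (ltW r0) hr; rewrite -p1 => t1.
have t2 : 2 ^- N * pnorm r (comp_trunc N) <= 2 ^- N * A.
  by rewrite ler_wpM2l ?invr_ge0 ?exprn_ge0// pnorm_comp_trunc.
have yN : (trunc_poly N).[h] = psum d h N.
  rewrite (@horner_nat _ _ N) ?size_poly//.
  by apply: eq_big_nat => k /andP[_ kN]; rewrite coef_poly kN.
have p2 : (comp_trunc N).[h] = psum a (psum d h N) N.
  rewrite /comp_trunc horner_sum; apply: eq_bigr => k _.
  by rewrite hornerZ horner_exp yN.
have t3 : cmod (psum a (psum d h N) N - psum a y N) * s <= A * cmod (psum d h N - y).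
  rewrite /psum -sumrB (le_trans (ler_wpM2r (ltW s0) (cmod_sum _ _ _)))//.
  apply: (@le_trans _ _ (\sum_(0 <= k < N) cmod (a k) * s ^+ k * cmod (psum d h N - y))).
    rewrite mulr_suml; apply: ler_sum => k _.
    rewrite -mulrBr cmodM -!mulrA ler_wpM2l ?cmod_ge0//.
    exact: powers_lip (psum_le N wd r1) ys.
  by rewrite -mulr_suml ler_wpM2r ?cmod_ge0.
have t4 : cmod (psum a (psum d h N) N - psum a y N) < e / 3.
  rewrite -(ltr_pM2r s0) (le_lt_trans t3)//.
  have := h3 N n3; rewrite ltr_pdivlMr ?ltr_wpDl// => t5.
  apply: le_lt_trans t5; rewrite mulrC ler_wpM2l ?cmod_ge0//.
  by rewrite lerDl.
have := h1 N n1; have := h2 N n2.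
have := cmodD (psum comp_coef h N - (comp_trunc N).[h])
  ((psum a (psum d h N) N - psum a y N) + (psum a y N - l)).
have := cmodD (psum a (psum d h N) N - psum a y N) (psum a y N - l).
rewrite {1}p2 !addrA !subrK (cmodB _ (comp_trunc N).[h]).
move: t1 t2 t4; lra.
Qed.

End Composition.

End PowerSeries.

(** * The power series of the square root at 1 *)

Section SquareRootSeries.
Variable R : realType.
Local Notation C := (R[i]).

(* The square root 1 + u of 1 + X is the fixed point u = (X - u^2) / 2; the
   iterates converge coefficientwise and have norm at most 1. *)
Fixpoint sqrt_iter (n : nat) : {poly C} :=
  if n is m.+1 then 2^-1 *: ('X - sqrt_iter m ^+ 2) else 0.

Definition sqrt_coef (k : nat) : C := (sqrt_iter k)`_k.

Lemma pnorm_sqrt_iter n : pnorm (1 : R) (sqrt_iter n) <= 1.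
Proof.
elim: n => [|n IH] /=; first by rewrite /pnorm size_poly0 big_ord0.
have h1 := pnormD 'X (- (sqrt_iter n ^+ 2)) (@ler01 R).
have h2 := pnormX (sqrt_iter n) 2 (@ler01 R).
have h3 : pnorm 1 (- (sqrt_iter n ^+ 2)) = pnorm (1 : R) (sqrt_iter n ^+ 2).
  by rewrite -scaleN1r pnormZ cmodN cmod1 mul1r.
have h4 : pnorm (1 : R) ('X : {poly C}) <= 1.
  rewrite -['X]mul1r -[_ * 'X]addr0 -[X in _ + X]/(0%:P) pnorm_cons cmod0 addr0 mul1r.
  by have := pnormX 0 0 (@ler01 R); rewrite !expr0.
have h5 : pnorm (1 : R) (sqrt_iter n) ^+ 2 <= 1.
  by rewrite expr_le1 // pnorm_ge0.
rewrite pnormZ cmodV (_ : cmod 2 = 2); last first.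
  by rewrite -(rmorph_nat (real_complex R)) cmod_real ger0_norm.
by rewrite ler_pdivrMl// mulr1; lra.
Qed.

Lemma coef0_sqrt_iter n : (sqrt_iter n)`_0 = 0.
Proof.
elim: n => [|n IH] /=; first by rewrite coef0.
by rewrite coefZ coefB coefX expr2 coef0M IH mulr0 subr0 mulr0.
Qed.

(** The difference of two squared iterates is the difference of the iterates times a sum without
    constant term. Each iteration thus adds a factor X to the difference. *)
Lemma sqrt_iter_stable n k : (k <= n)%N -> (sqrt_iter n.+1)`_k = (sqrt_iter n)`_k.
Proof.
have main m : exists q : {poly C}, sqrt_iter m.+1 - sqrt_iter m = q * 'X^(m.+1).
  elim: m => [|m [q qE]].
    by exists (2^-1)%:P; rewrite /= expr0n subr0 subr0 expr1 -mul_polyC.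
  have [s sE] : exists s : {poly C}, sqrt_iter m.+1 + sqrt_iter m = s * 'X.
    have : root (sqrt_iter m.+1 + sqrt_iter m) 0.
      by rewrite /root horner_coef0 coefD !coef0_sqrt_iter addr0.
    by move/factor_theorem => [s ->]; exists s; rewrite subr0.
  exists (- 2^-1 *: (q * s)).
  have -> : sqrt_iter m.+2 - sqrt_iter m.+1 =
      - 2^-1 *: ((sqrt_iter m.+1 - sqrt_iter m) * (sqrt_iter m.+1 + sqrt_iter m)).
    have -> : sqrt_iter m.+2 = 2^-1 *: ('X - sqrt_iter m.+1 ^+ 2) by [].
    rewrite [X in _ - X](_ : _ = 2^-1 *: ('X - sqrt_iter m ^+ 2))//.
    rewrite -scalerBr scaleNr -scalerN; congr (_ *: _); ring.
  by rewrite qE sE -scalerAl (exprSr 'X m.+1); congr (_ *: _); ring.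
move=> kn; have [q qE] := main n; apply/eqP; rewrite -subr_eq0 -coefB qE.
by rewrite coefMXn ltnS kn.
Qed.

Lemma sqrt_coefE n k : (k <= n)%N -> (sqrt_iter n)`_k = sqrt_coef k.
Proof.
elim: n => [|n IH]; first by case: k.
rewrite leq_eqVlt => /orP[/eqP -> //|kn].
by rewrite sqrt_iter_stable// IH.
Qed.

Lemma weight_sqrt_coef : weight_le sqrt_coef 1 1.
Proof.
move=> n; apply: le_trans (pnorm_sqrt_iter n).
have sz : (size (sqrt_iter n) <= maxn (size (sqrt_iter n)) n)%N by rewrite leq_maxl.
rewrite (pnorm_wide _ sz) [leRHS](big_cat_nat (n := n)) ?leq_maxr//=.
rewrite ler_wpDr//.
  by apply: sumr_ge0 => k _; rewrite mulr_ge0 ?cmod_ge0 ?exprn_ge0.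
by apply: ler_sum_nat => k /andP[_ kn]; rewrite sqrt_coefE// ltnW.
Qed.

(** The iterates at x and [v] stay in the disc of radius 1 / 2, where u |-> (x - u^2) / 2 halves
    distances, so the iterates converge to [v]. They differ from the partial sums of the series by a
    polynomial tail. *)
Lemma pser_sqrt (x : C) : cmod x <= 2^-1 -> pser sqrt_coef x (psqrt (1 + x) - 1).
Proof.
move=> x2; set v := psqrt (1 + x) - 1.
have x1 : cmod (1 + x - 1) < 1 by rewrite addrAC subrr add0r; lra.
have Re0 := Re_gt0_ball x1.
have e : v * (v + 2) = x.
  have := psqrt_sqr Re0; rewrite -[psqrt _](subrK 1) -/v => h.
  by rewrite -[RHS](addKr 1) -h; ring.
have vE : v = 2^-1 * (x - v ^+ 2).
  by rewrite -e; move: (v) => w; field.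
(* The principal root has positive real part, so |v + 2| >= 1, and v (v + 2) = x gives |v| <=
   |x|. *)
have v1 : cmod v <= 2^-1.
  have h2 : 1 <= cmod (v + 2).
    have := cmod_Re (v + 2).
    have -> : v + 2 = psqrt (1 + x) + 1 by rewrite /v; ring.
    rewrite raddfD /=; have := Re_psqrt_gt0 Re0; have := ler_norm (complex.Re (psqrt (1 + x)) + 1).
    lra.
  apply: le_trans x2; rewrite -e cmodM ler_peMr ?cmod_ge0//.
have itb n : cmod (sqrt_iter n).[x] <= 2^-1 /\
    cmod ((sqrt_iter n).[x] - v) <= 2 ^- n.
  elim: n => [|n [IH1 IH2]]; first by rewrite /= horner0 cmod0 sub0r cmodN expr0 invr1; split; lra.
  have uE : (sqrt_iter n.+1).[x] = 2^-1 * (x - (sqrt_iter n).[x] ^+ 2).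
    by rewrite /= !hornerE.
  have c2 : cmod (2^-1 : C) = 2^-1.
    by rewrite cmodV -(rmorph_nat (real_complex R)) cmod_real ger0_norm.
  move: (sqrt_iter n).[x] uE IH1 IH2 => u -> IH1 IH2; split.
    rewrite cmodM c2; have := cmodBD x (u ^+ 2); rewrite cmodX expr2.
    have := ler_pM (cmod_ge0 u) (cmod_ge0 u) IH1 IH1; move: x2; lra.
  rewrite [X in cmod (_ - X)]vE -mulrBr.
  have -> : x - u ^+ 2 - (x - v ^+ 2) = - ((u - v) * (u + v)) by ring.
  rewrite cmodM c2 cmodN cmodM exprS invfM ler_pM2l //.
  apply: le_trans IH2; rewrite ler_piMr ?cmod_ge0//; have := cmodD u v; lra.
move=> d d0; have [N0 hN] := half_power_lt 2 d0; exists N0 => N NN.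
have x12 : cmod x <= 1 / 2 by rewrite mul1r.
have := pnorm_tail (sqrt_iter N) N (@ler01 R) x12.
rewrite (_ : \sum_(0 <= k < N) _ = psum sqrt_coef x N); last first.
  by apply: eq_big_nat => k /andP[_ kN]; rewrite sqrt_coefE// ltnW.
have [_ h2] := itb N.
have h3 : 2 ^- N * pnorm 1 (sqrt_iter N) <= 2 ^- N :> R.
  by rewrite ler_piMr ?invr_ge0 ?exprn_ge0// pnorm_sqrt_iter.
have := cmodD (psum sqrt_coef x N - (sqrt_iter N).[x]) ((sqrt_iter N).[x] - v).
rewrite addrA subrK cmodB (cmodB _ (sqrt_iter N).[x]).
have := hN N NN; rewrite (cmodB v); lra.
Qed.

End SquareRootSeries.

(** * Real-analytic functions on a subset of the line *)

Section AnalyticAt.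
Variable R : realType.
Local Notation C := (R[i]).
Variable D : set R.
Implicit Types (f g : R -> C).

(** Analyticity together with a weighted bound on the coefficients, the form in which series
    compose. *)
Definition ana_at f (t0 : R) : Prop := exists r M c, [/\ 0 < r, weight_le c r M &
  forall t, D t -> `|t - t0| <= r -> pser c (t - t0)%:C (f t)].

Lemma ana_at_shrink f t0 s : 0 < s -> ana_at f t0 ->
  exists r M c, [/\ 0 < r, r <= s, weight_le c r M &
  forall t, D t -> `|t - t0| <= r -> pser c (t - t0)%:C (f t)].
Proof.
move=> s0 [r [M [c [r0 w h]]]]; exists (Num.min r s), M, c; split.
- by rewrite lt_min r0.
- by rewrite ge_min lexx orbT.
- by apply: weight_leW w; rewrite ?ge_min ?lexx// le_min !ltW.
- by move=> t Dt; rewrite le_min => /andP[tr _]; exact: h.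
Qed.

Lemma pser_center c f t0 (r : R) : D t0 -> 0 < r ->
  (forall t, D t -> `|t - t0| <= r -> pser c (t - t0)%:C (f t)) -> c 0%N = f t0.
Proof.
move=> Dt r0 h; apply: (pser_unique (pser0 c)).
by have := h t0 Dt; rewrite subrr normr0; apply; exact: ltW.
Qed.

Lemma ana_at_near f g t0 (e : R) : 0 < e ->
  (forall t, D t -> `|t - t0| < e -> f t = g t) -> ana_at f t0 -> ana_at g t0.
Proof.
move=> e0 fg /(ana_at_shrink (s := e / 2)) [|r [M [c [r0 re w h]]]].
  by rewrite divr_gt0.
exists r, M, c; split=> // t Dt tr; rewrite -fg//; first exact: h.
by rewrite (le_lt_trans tr)// (le_lt_trans re)// ltr_pdivrMr// ltr_pMr// ltr1n.
Qed.

(** The expansion of f - f t0, since an inner series must have no constant term. *)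
Definition drop0 (c : nat -> C) (k : nat) : C := if k is 0%N then 0 else c k.

Lemma psum_drop0 c z n : psum (drop0 c) z n.+1 = psum c z n.+1 - c 0%N.
Proof. by rewrite /psum !big_nat_recl // expr0 !mulr1 /= add0r addrC addKr. Qed.

Lemma pser_drop0 c z l : pser c z l -> pser (drop0 c) z (l - c 0%N).
Proof.
move=> h e e0; have [N0 hN] := h e e0; exists N0.+1 => -[//|N] NN.
rewrite psum_drop0 [X in cmod X](_ : _ = psum c z N.+1 - l); last by ring.
exact: hN _ (ltnW NN).
Qed.

Lemma weight_drop0 c r M : 0 <= r -> weight_le c r M -> weight_le (drop0 c) r M.
Proof.
move=> r0 w n; apply: le_trans (w n); apply: ler_sum => -[|k] _ //=.
by rewrite cmod0 mul0r mulr_ge0 ?cmod_ge0 ?exprn_ge0.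
Qed.

(** Without a constant term, shrinking the radius by k shrinks the norm by k as well, in the manner
    of the Schwarz lemma. *)
Lemma weight_drop0_scale c r M k : 0 <= r -> 0 <= k <= 1 -> weight_le c r M ->
  weight_le (drop0 c) (k * r) (k * M).
Proof.
move=> r0 /andP[k0 k1] w n; apply: le_trans (ler_wpM2l k0 (weight_drop0 r0 w n)).
rewrite mulr_sumr; apply: ler_sum => -[|i] _ /=.
  by rewrite cmod0 !mul0r mulr0.
rewrite mulrCA ler_wpM2l ?cmod_ge0// exprMn ler_wpM2r ?exprn_ge0//.
by rewrite exprS ler_piMr// exprn_ile1.
Qed.

Lemma ana_at_comp f g t0 (s A : R) a : D t0 -> ana_at f t0 -> 0 < s ->
  weight_le a s A ->
  (forall t, D t -> cmod (f t - f t0) <= s / 2 -> pser a (f t - f t0) (g t)) ->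
  ana_at g t0.
Proof.
move=> Dt0 [r [M [c [r0 w h]]]] s0 wa hg.
have M0 := weight_le_ge0 w.
(* At radius k r the series of f - f t0 has norm at most k M <= s / 2, as composition requires. *)
pose k := Num.min 1 (s / (2 * (M + 1))).
have k0 : 0 < k by rewrite lt_min ltr01 divr_gt0// mulr_gt0// ltr_wpDl.
have k1 : k <= 1 by rewrite ge_min lexx.
have kr0 : 0 < k * r by rewrite mulr_gt0.
have kM : k * M <= s / 2.
  apply: (@le_trans _ _ (s / (2 * (M + 1)) * M)).
    by rewrite ler_wpM2r// ge_min lexx orbT.
  rewrite invfM mulrA -mulrA ler_piMr ?divr_ge0 ?(ltW s0)//.
  by rewrite ler_pdivrMl ?ltr_wpDl// mulr1 lerDl.
have wd : weight_le (drop0 c) (k * r) (s / 2).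
  move=> n; apply: le_trans kM.
  by apply: weight_drop0_scale w n; rewrite ?(ltW r0) ?(ltW k0).
exists (k * r / 2), A, (comp_coef a (drop0 c)); split.
- by rewrite divr_gt0.
- apply: weight_leW (weight_comp_coef (erefl _) kr0 s0 wa wd); first by rewrite divr_ge0 ?(ltW kr0).
  by rewrite ler_pdivrMr// ler_pMr// ler1n.
- move=> t Dt tr.
  have trr : `|t - t0| <= r.
    rewrite (le_trans tr)// ler_pdivrMr// (@le_trans _ _ r)//.
      by rewrite ler_piMl// ltW.
    by rewrite ler_pMr// ler1n.
  have cE := pser_center Dt0 r0 h.
  have := pser_drop0 (h t Dt trr); rewrite cE => py.
  have ys : cmod (f t - f t0) <= s / 2.
    apply: pser_le wd _ py; rewrite cmod_real (le_trans tr)//.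
    by rewrite ler_pdivrMr// ler_pMr// ler1n.
  apply: (pser_comp (erefl _) kr0 s0 wa wd) py (hg _ Dt ys).
  by rewrite cmod_real.
Qed.

Lemma ana_at_lipschitz f t0 : D t0 -> ana_at f t0 ->
  exists r L : R, [/\ 0 < r, 0 <= L & forall t, D t -> `|t - t0| <= r ->
  cmod (f t - f t0) <= L * `|t - t0|].
Proof.
move=> Dt0 [r [M [c [r0 w h]]]]; exists r, (M / r); split => //.
  by rewrite divr_ge0 ?(weight_le_ge0 w) ?ltW.
move=> t Dt tr; have := pser_drop0 (h t Dt tr); rewrite (pser_center Dt0 r0 h) => py.
have k1 : 0 <= `|t - t0| / r <= 1.
  by rewrite divr_ge0 ?(ltW r0) //= ler_pdivrMr// mul1r.
have wd := weight_drop0_scale (ltW r0) k1 w.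
rewrite (_ : M / r * _ = `|t - t0| / r * M); last by ring.
by apply: pser_le wd _ py; rewrite cmod_real divfK// gt_eqF.
Qed.

Lemma ana_at_cst (b : C) t0 : ana_at (fun=> b) t0.
Proof.
exists 1, (cmod b), (fun k => if k is 0%N then b else 0); split => //.
  move=> [|n]; first by rewrite big_nil cmod_ge0.
  rewrite big_nat_recl // expr0 mulr1 big1 ?addr0// => k _.
  by rewrite cmod0 mul0r.
move=> t _ _ e e0; exists 1%N => -[//|N] _; rewrite /psum big_nat_recl //.
rewrite expr0 mulr1 big1 ?addr0 ?subrr ?cmod0// => k _; by rewrite mul0r.
Qed.

Lemma ana_at_id t0 : ana_at (fun t => t%:C) t0.
Proof.
exists 1, (`|t0| + 1), (fun k => if k is 0%N then t0%:C else if k is 1%N then 1 else 0).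
split => //.
  move=> [|[|n]]; first by rewrite big_nil addr_ge0.
    by rewrite big_nat1 expr0 mulr1 cmod_real lerDl.
  rewrite big_nat_recl // big_nat_recl //= expr0 !expr1n !mulr1 cmod1 cmod_real.
  by rewrite big1 ?addr0// => k _; rewrite cmod0 mul0r.
move=> t _ _ e e0; exists 2%N => -[//|[//|N]] _; rewrite /psum !big_nat_recl //.
rewrite expr0 mulr1 expr1 mul1r big1 ?addr0; last by move=> k _; rewrite mul0r.
by rewrite rmorphB [X in cmod X](_ : _ = 0) ?cmod0//; ring.
Qed.

Lemma ana_at_add f g t0 : ana_at f t0 -> ana_at g t0 -> ana_at (fun t => f t + g t) t0.
Proof.
move=> [r [M [c [r0 w h]]]] /(ana_at_shrink r0) [r' [M' [c' [r'0 r'r w' h']]]].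
exists r', (M + M'), (fun k => c k + c' k); split => //.
  move=> n; apply: le_trans (lerD (weight_leW (ltW r'0) r'r w n) (w' n)).
  rewrite -big_split /=; apply: ler_sum => k _; rewrite -mulrDl.
  by rewrite ler_wpM2r ?exprn_ge0 ?(ltW r'0)// cmodD.
move=> t Dt tr e e0.
have [N hN] := h t Dt (le_trans tr r'r) (e / 2) (divr_gt0 e0 (ltr0n _ 2)).
have [N' hN'] := h' t Dt tr (e / 2) (divr_gt0 e0 (ltr0n _ 2)).
exists (maxn N N') => n; rewrite geq_max => /andP[/hN h1 /hN' h2].
have -> : psum (fun k => c k + c' k) (t - t0)%:C n =
    psum c (t - t0)%:C n + psum c' (t - t0)%:C n.
  by rewrite /psum -big_split; apply: eq_bigr => k _; rewrite mulrDl.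
rewrite opprD addrACA (le_lt_trans (cmodD _ _))//; lra.
Qed.

Lemma ana_at_scale f t0 (b : C) : ana_at f t0 -> ana_at (fun t => b * f t) t0.
Proof.
move=> [r [M [c [r0 w h]]]]; exists r, (cmod b * M), (fun k => b * c k); split => //.
  move=> n; apply: le_trans (ler_wpM2l (cmod_ge0 b) (w n)).
  by rewrite mulr_sumr; apply: ler_sum => k _; rewrite cmodM mulrA.
move=> t Dt tr e e0.
have b0 : 0 < cmod b + 1 by rewrite ltr_wpDl ?cmod_ge0.
have [N hN] := h t Dt tr (e / (cmod b + 1)) (divr_gt0 e0 b0).
exists N => n /hN; rewrite ltr_pdivlMr// => hn.
have -> : psum (fun k => b * c k) (t - t0)%:C n = b * psum c (t - t0)%:C n.
  by rewrite /psum mulr_sumr; apply: eq_bigr => k _; rewrite mulrA.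
rewrite -mulrBr cmodM (le_lt_trans _ hn)// mulrC ler_wpM2l ?cmod_ge0// lerDl//.
Qed.

Lemma ana_at_sqr f t0 : D t0 -> ana_at f t0 -> ana_at (fun t => f t ^+ 2) t0.
Proof.
move=> Dt0 hf; set y := f t0.
pose a (k : nat) : C := match k with 0%N => y ^+ 2 | 1%N => 2 * y | 2%N => 1 | _ => 0 end.
apply: (@ana_at_comp f _ t0 1 (cmod (y ^+ 2) + cmod (2 * y) + 1) a Dt0 hf) => //.
  have main n : \sum_(0 <= k < n.+3) cmod (a k) * 1 ^+ k =
      cmod (y ^+ 2) + cmod (2 * y) + 1.
    rewrite !big_nat_recl //= !expr1n !mulr1 cmod1 big1 ?addr0 ?addrA// => k _.
    by rewrite cmod0 mul0r.
  move=> n; rewrite -(main n) (big_cat_nat (n := n) (p := n.+3)) //=; last first.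
    by rewrite -addn3 leq_addr.
  rewrite lerDl; apply: sumr_ge0 => k _.
  by rewrite mulr_ge0 ?cmod_ge0 ?exprn_ge0.
move=> t Dt _ e e0; exists 3%N => -[//|[//|[//|n]]] _.
rewrite /psum !big_nat_recl //= big1 ?addr0; last by move=> k _; rewrite mul0r.
by rewrite -/y [X in cmod X](_ : _ = 0) ?cmod0//; ring.
Qed.

Lemma ana_at_ext f g t0 : (forall t, D t -> f t = g t) -> ana_at f t0 -> ana_at g t0.
Proof. by move=> fg; apply: (ana_at_near ltr01) => t Dt _; exact: fg. Qed.

(** Polarization: 4 f g = (f + g)^2 - (f - g)^2, and squaring is a composition with a polynomial. *)
Lemma ana_at_mul f g t0 : D t0 -> ana_at f t0 -> ana_at g t0 ->
  ana_at (fun t => f t * g t) t0.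
Proof.
move=> Dt0 hf hg.
have h1 := ana_at_scale 4^-1 (ana_at_sqr Dt0 (ana_at_add hf hg)).
have h2 := ana_at_scale (- 4^-1) (ana_at_sqr Dt0 (ana_at_add hf (ana_at_scale (-1) hg))).
apply: ana_at_ext (ana_at_add h1 h2) => t Dt /=.
by move: (f t) (g t) => u v; field.
Qed.

Lemma half_sum_le n : \sum_(0 <= k < n) 2 ^- k <= 2 :> R.
Proof.
have -> : \sum_(0 <= k < n) 2 ^- k = 2 - 2 * 2 ^- n :> R.
  elim: n => [|n IH]; first by rewrite big_nil expr0 invr1 mulr1 subrr.
  by rewrite big_nat_recr //= IH exprS invfM; field; rewrite expf_neq0.
by rewrite lerBlDr lerDl mulr_ge0// invr_ge0 exprn_ge0.
Qed.

(** Composition with the geometric series of 1 / (y + w) at y = f t0. *)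
Lemma ana_at_inv f t0 : D t0 -> f t0 != 0 -> ana_at f t0 ->
  ana_at (fun t => (f t)^-1) t0.
Proof.
move=> Dt0 f0 hf; set y := f t0 in f0 *.
have y0 : 0 < cmod y by rewrite cmod_gt0.
apply: (@ana_at_comp f _ t0 (cmod y / 2) (cmod y^-1 * 2) (fun k => y^-1 * (- y^-1) ^+ k) Dt0 hf).
- by rewrite divr_gt0.
- move=> n; apply: le_trans (ler_wpM2l (cmod_ge0 _) (half_sum_le n)).
  rewrite mulr_sumr; apply: ler_sum => k _.
  rewrite cmodM cmodX cmodN cmodV -mulrA -exprMn mulrA mulVf ?gt_eqF// mul1r.
  by rewrite exprVn.
- move=> t Dt; rewrite -/y => ty; set w := f t - y.
  have fE : f t = y + w by rewrite /w addrC subrK.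
  pose q := - y^-1 * w.
  have q2 : cmod q <= 1 / 2.
    rewrite /q cmodM cmodN cmodV ler_pdivrMl// (le_trans ty)// ler_pdivrMr// mul1r.
    by rewrite ler_peMr ?divr_ge0 ?(ltW y0)// ler1n.
  have ft0 : y + w != 0.
    have : cmod y / 2 <= cmod (y + w).
      have := cmodD (y + w) (- w); rewrite addrK cmodN.
      move: ty; rewrite -/w; lra.
    by rewrite -cmod_gt0 => /(lt_le_trans _); apply; rewrite divr_gt0.
  have geo N : psum (fun k => y^-1 * (- y^-1) ^+ k) w N = (1 - q ^+ N) / (y + w).
    apply: (mulIf ft0); rewrite divfK// /psum.
    elim: N => [|N IH]; first by rewrite big_nil mul0r expr0 subrr.
    rewrite big_nat_recr //= mulrDl IH -[_ * _ ^+ N * _ ^+ N]mulrA -exprMn -/q exprS.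
    by rewrite /q; field.
  move=> e e0.
  have e1 : 0 < e * cmod (y + w) by rewrite mulr_gt0 ?cmod_gt0.
  have [N0 hN] := half_power_lt 1 e1; exists N0 => N /hN.
  rewrite mulr1 fE geo => h.
  have -> : (1 - q ^+ N) / (y + w) - (y + w)^-1 = - q ^+ N / (y + w) by field.
  rewrite cmodM cmodN cmodV ltr_pdivrMr ?cmod_gt0// (le_lt_trans _ h)//.
  rewrite cmodX -exprVn lerXn2r ?nnegrE ?cmod_ge0 ?invr_ge0//.
  by rewrite -[2^-1]mul1r.
Qed.

Lemma ana_at_psqrt f t0 : D t0 -> f t0 = 1 -> ana_at f t0 ->
  ana_at (fun t => psqrt (f t)) t0.
Proof.
move=> Dt0 f1 hf.
have h : ana_at (fun t => psqrt (f t) - 1) t0.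
  apply: (@ana_at_comp f _ t0 1 1 (@sqrt_coef R) Dt0 hf) => //.
    exact: weight_sqrt_coef.
  move=> t Dt; rewrite f1 mul1r => ft.
  by have := pser_sqrt ft; rewrite [1 + _]addrC subrK.
apply: ana_at_ext (ana_at_add h (ana_at_cst 1 t0)) => t _ /=.
by rewrite subrK.
Qed.

Lemma Re_gt0_sqr_inj (u v : C) : 0 < complex.Re u -> 0 < complex.Re v ->
  u ^+ 2 = v ^+ 2 -> u = v.
Proof.
move=> u0 v0 /eqP; rewrite eqf_sqr => /orP[/eqP //|/eqP uv].
exfalso; move: u0 v0; rewrite uv; case: v {uv} => x y /=; lra.
Qed.

(** Near t0 continuity keeps f / f t0 close to 1; it is then the root of positive real part of its
    square, that is, its principal root. *)
Lemma ana_at_sqrt f t0 : D t0 -> f t0 != 0 -> {within D, continuous f} ->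
  ana_at (fun t => f t ^+ 2) t0 -> ana_at f t0.
Proof.
move=> Dt0 f0 cf hq; set y := f t0 in f0 *.
have hq1 : ana_at (fun t => y ^- 2 * f t ^+ 2) t0 by exact: ana_at_scale.
have hs : ana_at (fun t => y * psqrt (y ^- 2 * f t ^+ 2)) t0.
  apply: ana_at_scale; apply: ana_at_psqrt => //.
  by rewrite -/y mulVf// expf_neq0.
have y0 : 0 < cmod y by rewrite cmod_gt0.
have /cvgCP /(_ (cmod y / 4) (divr_gt0 y0 (ltr0n _ 4))) /withinRP [e e0 he] :=
  within_cvg cf Dt0.
apply: (ana_at_near e0 _ hs) => t Dt te; have := he _ te Dt; rewrite -/y => ft.
pose v := f t / y.
have v1 : cmod (v - 1) < 1 / 4.
  have -> : v - 1 = (f t - y) / y by rewrite /v; field.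
  by rewrite cmodM cmodV ltr_pdivrMr// mulrC mulrA mulr1.
have vE : y ^- 2 * f t ^+ 2 = v ^+ 2 by rewrite /v; field.
have fE : f t = y * v by rewrite /v; field.
have v21 : cmod (v ^+ 2 - 1) < 1.
  have -> : v ^+ 2 - 1 = (v - 1) * (v - 1) + (v - 1) * 2 by ring.
  rewrite (le_lt_trans (cmodD _ _))// !cmodM (_ : cmod 2 = 2); last first.
    by rewrite -(rmorph_nat (real_complex R)) cmod_real ger0_norm.
  by move: v1 (cmod_ge0 (v - 1)); move: (cmod _) => x; nra.
rewrite vE fE; congr (_ * _); apply: Re_gt0_sqr_inj.
- by apply: Re_psqrt_gt0; exact: Re_gt0_ball.
- by apply: Re_gt0_ball; lra.
- by rewrite psqrt_sqr//; exact: Re_gt0_ball.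
Qed.

(** Convergence at one further point t1 of D bounds the terms c_n (t1 - t0)^n, which gives geometric
    decay at half the distance. If D has no other point within r of t0, a constant series serves. *)
Lemma ana_at_real_analytic f : real_analytic_on D f <-> forall t, D t -> ana_at f t.
Proof.
split=> [hf t0 Dt0|hf t0 Dt0]; last first.
  have [r [M [c [r0 w h]]]] := hf t0 Dt0.
  by exists r => //; exists c => t Dt tr; apply/pserP/h => //; exact: ltW.
have [r r0 [c hc]] := hf t0 Dt0.
have [[t1 [Dt1 t1r t10]]|iso] := pselect (exists t1, [/\ D t1, `|t1 - t0| < r & t1 != t0]).
  set z := (t1 - t0)%:C.
  have /pserP /(_ 1 ltr01) [N0 hN] := hc t1 Dt1 t1r.
  have tb n : (N0 <= n)%N -> cmod (c n * z ^+ n) <= 2.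
    move=> Nn; have h1 := hN n Nn; have := hN n.+1 (leqW Nn).
    have -> : psum c z n.+1 = psum c z n + c n * z ^+ n by rewrite /psum big_nat_recr.
    have := cmodBD (psum c z n + c n * z ^+ n - f t1) (psum c z n - f t1).
    by rewrite [X in cmod X <= _](_ : _ = c n * z ^+ n); [lra|ring].
  pose M := 2 + \sum_(0 <= k < N0) cmod (c k * z ^+ k).
  have tM n : cmod (c n) * cmod z ^+ n <= M.
    rewrite -cmodX -cmodM /M; have [/tb h|nN] := leqP N0 n.
      by rewrite (le_trans h)// lerDl sumr_ge0// => k _; exact: cmod_ge0.
    rewrite (bigD1_seq n) ?mem_index_iota ?iota_uniq//=.
    rewrite addrCA lerDl addr_ge0// sumr_ge0// => k _; exact: cmod_ge0.
  have z0 : 0 < cmod z by rewrite cmod_real normr_gt0 subr_eq0.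
  exists (cmod z / 2), (M * 2), c; split; first by rewrite divr_gt0.
    move=> n; have M0 : 0 <= M by rewrite addr_ge0// sumr_ge0// => k _; exact: cmod_ge0.
    apply: le_trans (ler_wpM2l M0 (half_sum_le n)); rewrite mulr_sumr.
    apply: ler_sum => k _; rewrite expr_div_n mulrA ler_wpM2r ?invr_ge0 ?exprn_ge0//.
  move=> t Dt tz; apply/pserP/hc => //; apply: le_lt_trans t1r.
  by rewrite (le_trans tz)// cmod_real ler_pdivrMr// ler_peMr// ler1n.
apply: (ana_at_near r0 _ (ana_at_cst (f t0) t0)) => t Dt tr.
have [->//|tt] := eqVneq t t0; by exfalso; apply: iso; exists t.
Qed.

Lemma regularity_analytic : regularity_class D (real_analytic_on D).
Proof.
split.
- move=> f /ana_at_real_analytic hf; apply/within_continuousCP => t Dt.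
  have [r [L [r0 L0 h]]] := ana_at_lipschitz Dt (hf t Dt).
  apply/cvgCP => e e0; apply/withinRP.
  exists (Num.min r (e / (L + 1))); first by rewrite lt_min r0 divr_gt0// ltr_wpDl.
  move=> s; rewrite lt_min => /andP[sr se] Ds.
  apply: le_lt_trans (h s Ds (ltW sr)) _.
  move: se; rewrite ltr_pdivlMr ?ltr_wpDl//; have := normr_ge0 (s - t); nra.
- move=> f g fg /ana_at_real_analytic hf; apply/ana_at_real_analytic => t Dt.
  exact: ana_at_ext fg (hf t Dt).
- by move=> c; apply/ana_at_real_analytic => t _; exact: ana_at_cst.
- move=> f g /ana_at_real_analytic hf /ana_at_real_analytic hg.
  by apply/ana_at_real_analytic => t Dt; apply: ana_at_add; [exact: hf|exact: hg].
- move=> f g /ana_at_real_analytic hf /ana_at_real_analytic hg.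
  by apply/ana_at_real_analytic => t Dt; apply: ana_at_mul; [|exact: hf|exact: hg].
- move=> f f0 /ana_at_real_analytic hf; apply/ana_at_real_analytic => t Dt.
  by apply: ana_at_inv; [|exact: f0|exact: hf].
- move=> f f0 cf /ana_at_real_analytic hf; apply/ana_at_real_analytic => t Dt.
  by apply: ana_at_sqrt; [|exact: f0|exact: cf|exact: hf].
Qed.

End AnalyticAt.

Section AnalyticExamples.
Variable R : realType.
Local Notation C := (R[i]).

Lemma ana_at_comp_real (D E : set R) (u : R -> R) (g : R -> C) t0 :
  D t0 -> (forall t, D t -> E (u t)) -> ana_at D (fun t => (u t)%:C) t0 ->
  ana_at E g (u t0) -> ana_at D (g \o u) t0.
Proof.
move=> Dt0 DE hu [r [M [c [r0 w h]]]].
apply: (@ana_at_comp _ _ (fun t => (u t)%:C) _ t0 r M c) => // t Dt.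
rewrite -rmorphB cmod_real => ut; apply: h; first exact: DE.
by rewrite (le_trans ut)// ler_pdivrMr// ler_pMr// ler1n.
Qed.

Lemma pser_real (c : nat -> R) (x l : R) :
  series (fun n => c n * x ^+ n) @ \oo --> l -> pser (fun n => (c n)%:C) x%:C l%:C.
Proof.
move=> /cvgrPdist_lt h e e0; have [N _ hN] := h e e0; exists N => n /hN.
rewrite /= distrC; congr (_ < _); rewrite -cmod_real rmorphB; congr (cmod (_ - _)).
rewrite /series /= rmorph_sum; apply: eq_bigr => k _.
by rewrite rmorphM rmorphXn.
Qed.

Lemma fact_weight (c : nat -> R) : (forall n, `|c n| <= 1) ->
  weight_le (fun n => (c n)%:C) 2^-1 2.
Proof.
move=> c1 n; apply: le_trans (half_sum_le R n); apply: ler_sum => k _.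
by rewrite cmod_real exprVn ler_piMl// invr_ge0 exprn_ge0.
Qed.

Let inv_fact_le1 n : (n`!%:R : R)^-1 <= 1.
Proof. by rewrite invf_le1 ?ltr0n ?fact_gt0// ler1n fact_gt0. Qed.

Lemma pser_cos : exists c : nat -> C, weight_le c 2^-1 2 /\
  forall x : R, pser c x%:C (cos x)%:C.
Proof.
exists (fun n => ((~~ odd n)%:R * (-1) ^+ n./2 * (n`!%:R)^-1 : R)%:C); split.
  apply: fact_weight => n; rewrite !normrM normrX normrN1 expr1n mulr1.
  rewrite [X in _ * X]ger0_norm ?invr_ge0//.
  by case: (odd n); rewrite /= ?normr0 ?mul0r// normr1 mul1r.
move=> x; apply: pser_real; have := @is_cvg_series_cos_coeff R x.
by move=> h; rewrite cos.unlock; move: h; rewrite cos_coeffE.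
Qed.

Lemma pser_sin : exists c : nat -> C, weight_le c 2^-1 2 /\
  forall x : R, pser c x%:C (sin x)%:C.
Proof.
exists (fun n => ((odd n)%:R * (-1) ^+ n.-1./2 * (n`!%:R)^-1 : R)%:C); split.
  apply: fact_weight => n; rewrite !normrM normrX normrN1 expr1n mulr1.
  rewrite [X in _ * X]ger0_norm ?invr_ge0//.
  by case: (odd n); rewrite /= ?normr0 ?mul0r// normr1 mul1r.
move=> x; apply: pser_real; have := @is_cvg_series_sin_coeff R x.
by move=> h; rewrite sin.unlock; move: h; rewrite sin_coeffE.
Qed.

(** The addition formulas carry the expansions at 0 over to t0. *)
Lemma ana_at_cos_sin (D : set R) t0 :
  ana_at D (fun t => (cos t)%:C) t0 /\ ana_at D (fun t => (sin t)%:C) t0.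
Proof.
have [c [wc hc]] := pser_cos; have [s [ws hs]] := pser_sin.
have ac : ana_at D (fun t => (cos (t - t0))%:C) t0.
  by exists 2^-1, 2, c; split => // t _ _.
have as_ : ana_at D (fun t => (sin (t - t0))%:C) t0.
  by exists 2^-1, 2, s; split => // t _ _.
split.
  apply: ana_at_ext (ana_at_add (ana_at_scale (cos t0)%:C ac)
     (ana_at_scale (- (sin t0)%:C) as_)) => t _ /=.
  have -> : cos t = cos (t - t0) * cos t0 - sin (t - t0) * sin t0.
    by rewrite -cosD subrK.
  by rewrite rmorphB !rmorphM /=; ring.
apply: ana_at_ext (ana_at_add (ana_at_scale (cos t0)%:C as_)
   (ana_at_scale (sin t0)%:C ac)) => t _ /=.
have -> : sin t = sin (t - t0) * cos t0 + cos (t - t0) * sin t0.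
  by rewrite -sinD subrK.
by rewrite rmorphD !rmorphM /=; ring.
Qed.

End AnalyticExamples.

(** * Derivatives of real-analytic functions *)

Section AnalyticDerivative.
Variable R : realType.
Local Notation C := (R[i]).

(* Makes derivatives along D unique. *)
Definition perfect_on (D : set R) : Prop := forall t, D t -> forall e, 0 < e ->
  exists s, [/\ D s, s != t & `|s - t| < e].

Lemma is_deriv_on_unique (D : set R) (f f1 f2 : R -> C) : perfect_on D ->
  is_deriv_on D f f1 -> is_deriv_on D f f2 -> forall t, D t -> f1 t = f2 t.
Proof.
move=> pD /is_deriv_onP h1 /is_deriv_onP h2 t Dt; apply/eqP.
rewrite -subr_eq0 -cmod_eq0 eq_le cmod_ge0 andbT; apply/ler_addgt0Pr => e e0.
have e2 : 0 < e / 2 by rewrite divr_gt0.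
have [n1 n10 hn1] := h1 t Dt _ e2; have [n2 n20 hn2] := h2 t Dt _ e2.
have [|s [Ds st]] := pD t Dt (Num.min n1 n2); first by rewrite lt_min n10.
rewrite lt_min => /andP[s1 s2].
have := hn1 s s1 st Ds; have := hn2 s s2 st Ds; set q := (_ / _) => a1 a2.
have := cmodD (f1 t - q) (q - f2 t); rewrite addrA subrK (cmodB (f1 t) q); lra.
Qed.

(** The first-order Taylor remainder at y of the power of exponent n.+1. *)
Let pow_err (x y : C) n : C := x ^+ n.+1 - y ^+ n.+1 - n.+1%:R * (x - y) * y ^+ n.

Let pow_err_le (x y : C) (p : R) n : cmod x <= p -> cmod y <= p ->
  cmod (pow_err x y n) * p <= n.+1%:R ^+ 2 * p ^+ n * cmod (x - y) ^+ 2.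
Proof.
move=> xp yp; have p0 : 0 <= p := le_trans (cmod_ge0 x) xp.
have nR m : cmod m%:R = m%:R :> R.
  by rewrite -(rmorph_nat (real_complex R)) cmod_real ger0_norm.
elim: n => [|n IH].
  rewrite /pow_err !expr1 expr0 mulr1 mul1r subrr cmod0 mul0r.
  by rewrite !mulr_ge0 ?exprn_ge0 ?cmod_ge0.
have -> : pow_err x y n.+1 = x * pow_err x y n + n.+1%:R * y ^+ n * (x - y) ^+ 2.
  rewrite /pow_err !exprS -[n.+2%:R]natr1; ring.
have := cmodD (x * pow_err x y n) (n.+1%:R * y ^+ n * (x - y) ^+ 2).
move=> /(ler_wpM2r p0) /le_trans; apply; rewrite mulrDl !cmodM nR !cmodX.
have h1 : cmod x * cmod (pow_err x y n) * p <=
    p * (n.+1%:R ^+ 2 * p ^+ n * cmod (x - y) ^+ 2).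
  by rewrite -mulrA ler_pM ?cmod_ge0 ?mulr_ge0 ?cmod_ge0.
have h2 : n.+1%:R * cmod y ^+ n * cmod (x - y) ^+ 2 * p <=
    n.+1%:R * (p ^+ n.+1 * cmod (x - y) ^+ 2).
  rewrite -!mulrA ler_wpM2l// exprS.
  rewrite [leRHS](_ : _ = p ^+ n * (cmod (x - y) ^+ 2 * p)); last by ring.
  rewrite (mulrA (cmod (x - y))) -expr2.
  by rewrite ler_wpM2r ?mulr_ge0 ?exprn_ge0 ?cmod_ge0// lerXn2r ?nnegrE ?cmod_ge0.
apply: le_trans (lerD h1 h2) _.
rewrite [leLHS](_ : _ = (n.+1%:R ^+ 2 + n.+1%:R) * (p ^+ n.+1 * cmod (x - y) ^+ 2)); last first.
  by rewrite (exprS p n); ring.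
rewrite -[leRHS]mulrA ler_wpM2r ?mulr_ge0 ?exprn_ge0 ?cmod_ge0//.
by rewrite -(natr1 n.+1); have := ler0n R n.+1; nra.
Qed.

(** This is why the radius drops to r / 4 below: the factor n^2 in the remainders is absorbed by
    4^n. *)
Let sqr_le_exp4 n : (n%:R : R) ^+ 2 <= 4 ^+ n.
Proof.
have -> : (4 : R) = 2 ^+ 2 by ring.
rewrite exprAC lerXn2r ?nnegrE ?exprn_ge0// -natrX ler_nat.
exact/ltnW/ltn_expl.
Qed.

Definition deriv_coef (c : nat -> C) (n : nat) : C := n.+1%:R * c n.+1.

Let nR m : cmod m%:R = m%:R :> R.
Proof. by rewrite -(rmorph_nat (real_complex R)) cmod_real ger0_norm. Qed.

Lemma weight_deriv_coef c (r M : R) : 0 < r -> weight_le c r M ->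
  weight_le (deriv_coef c) (r / 4) (4 * M / r).
Proof.
move=> r0 w n; rewrite -(ler_pM2r (divr_gt0 r0 (ltr0n _ 4))).
rewrite [leRHS](_ : _ = M); last by field; rewrite gt_eqF.
apply: le_trans (w n.+1); rewrite big_nat_recl //= ler_wpDl //.
  by rewrite mulr_ge0 ?cmod_ge0 ?exprn_ge0 ?(ltW r0).
rewrite mulr_suml; apply: ler_sum => k _.
rewrite -mulrA -exprSr cmodM nR mulrAC mulrC ler_wpM2l ?cmod_ge0//.
rewrite expr_div_n mulrCA ler_piMr ?exprn_ge0 ?(ltW r0)// ler_pdivrMr ?exprn_gt0// mul1r.
apply: le_trans (sqr_le_exp4 k.+1).
by rewrite expr2 ler_peMr// ler1n.
Qed.

Lemma series_abs_bounded_cvg (u : nat -> R) (M : R) :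
  (forall n, \sum_(0 <= k < n) `|u k| <= M) -> cvgn (series u).
Proof.
move=> h; apply: normed_cvg; apply: nondecreasing_is_cvgn.
  by apply: nondecreasing_series => n _ _; exact: normr_ge0.
by exists M => _ [n _ <-]; exact: h.
Qed.

Lemma weight_cvg_pser c (r M : R) z : weight_le c r M -> cmod z <= r ->
  exists l, pser c z l.
Proof.
move=> w zr; pose u k := c k * z ^+ k.
have bd n : \sum_(0 <= k < n) cmod (u k) <= M.
  apply: le_trans (w n); apply: ler_sum => k _; rewrite cmodM cmodX.
  by rewrite ler_wpM2l ?cmod_ge0// lerXn2r ?nnegrE ?cmod_ge0// (le_trans (cmod_ge0 z)).
have cr : cvgn (series (fun k => complex.Re (u k))).
  apply: (@series_abs_bounded_cvg _ M) => n; apply: le_trans (bd n).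
  by apply: ler_sum => k _; exact: cmod_Re.
have ci : cvgn (series (fun k => complex.Im (u k))).
  apply: (@series_abs_bounded_cvg _ M) => n; apply: le_trans (bd n).
  by apply: ler_sum => k _; exact: cmod_Im.
exists (limn (series (fun k => complex.Re (u k))) +i* limn (series (fun k => complex.Im (u k)))).
apply/pserP; have h : (fun n => series (fun k => complex.Re (u k)) n +i*
    series (fun k => complex.Im (u k)) n) @ \oo --> (limn (series (fun k => complex.Re (u k)))
    +i* limn (series (fun k => complex.Im (u k))) : C) by apply: cvg_complex.
rewrite -/u (_ : series u = (fun n => series (fun k => complex.Re (u k)) n +i*
    series (fun k => complex.Im (u k)) n)); first exact: h.
apply/funext => n; rewrite /series /=; apply/eqP.
by rewrite eq_complex /= !raddf_sum !eqxx.
Qed.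

Lemma psum_deriv_err c (r M : R) x y n : 0 < r -> weight_le c r M ->
  cmod x <= r / 4 -> cmod y <= r / 4 ->
  cmod (psum c x n.+1 - psum c y n.+1 - (x - y) * psum (deriv_coef c) y n) <=
  16 * M / r ^+ 2 * cmod (x - y) ^+ 2.
Proof.
move=> r0 w xr yr; have r4 : 0 < r / 4 by rewrite divr_gt0.
have -> : psum c x n.+1 - psum c y n.+1 - (x - y) * psum (deriv_coef c) y n =
    \sum_(0 <= k < n) c k.+1 * pow_err x y k.
  rewrite /psum !big_nat_recl // !expr0 !mulr1 mulr_sumr opprD addrACA subrr add0r.
  rewrite -!sumrB; apply: eq_bigr => k _; rewrite /deriv_coef /pow_err; ring.
have -> : 16 * M / r ^+ 2 * cmod (x - y) ^+ 2 = M * cmod (x - y) ^+ 2 / (r / 4) / (r / 4).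
  by field; rewrite gt_eqF.
rewrite ler_pdivlMr// ler_pdivlMr//.
apply: le_trans (ler_wpM2r (exprn_ge0 2 (cmod_ge0 (x - y))) (w n.+1)).
rewrite big_nat_recl //= mulrDl ler_wpDl //.
  by rewrite !mulr_ge0 ?cmod_ge0 ?exprn_ge0 ?(ltW r0) ?cmod_ge0.
rewrite (le_trans (ler_wpM2r (ltW r4) (ler_wpM2r (ltW r4) (cmod_sum _ _ _))))//.
rewrite !mulr_suml; apply: ler_sum => k _; rewrite cmodM -!mulrA ler_wpM2l ?cmod_ge0//.
rewrite (_ : cmod _ * _ = cmod (pow_err x y k) * (r / 4) * (r / 4)); last by ring.
rewrite (le_trans (ler_wpM2r (ltW r4) (pow_err_le k xr yr)))//.
rewrite mulrAC ler_wpM2r ?exprn_ge0 ?cmod_ge0// -mulrA -exprSr expr_div_n mulrCA.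
rewrite ler_piMr ?exprn_ge0 ?(ltW r0)// ler_pdivrMr ?exprn_gt0// mul1r.
exact: sqr_le_exp4.
Qed.

(** The quadratic remainder is uniform in s and t, so one function [f1] is the derivative at all
    parameters near t0 and not just at t0. *)
Lemma ana_at_deriv (D : set R) (f : R -> C) t0 : D t0 -> ana_at D f t0 ->
  exists r K f1, [/\ 0 < r, ana_at D f1 t0 & forall s t, D s -> D t ->
    `|s - t0| <= r -> `|t - t0| <= r ->
    cmod (f s - f t - (s - t)%:C * f1 t) <= K * `|s - t| ^+ 2].
Proof.
move=> Dt0 [r [M [c [r0 w h]]]].
have r4 : 0 < r / 4 by rewrite divr_gt0.
have r8 : 0 < r / 4 / 2 by rewrite divr_gt0.
have wd := weight_deriv_coef r0 w.
have [f1 hf1] : exists f1 : R -> C, forall t, `|t - t0| <= r / 4 ->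
    pser (deriv_coef c) (t - t0)%:C (f1 t).
  have : forall t, exists l, `|t - t0| <= r / 4 -> pser (deriv_coef c) (t - t0)%:C l.
    move=> t; have [tr|_] := leP `|t - t0| (r / 4); last by exists 0.
    have [|l hl] := @weight_cvg_pser _ _ _ (t - t0)%:C wd; first by rewrite cmod_real.
    by exists l.
  by move=> /choice [f1 hf1]; exists f1.
exists (r / 4), (16 * M / r ^+ 2), f1; split => //.
  exists (r / 4), (4 * M / r), (deriv_coef c); split => // t _ tr; exact: hf1.
move=> s t Ds Dt sr tr.
have r41 : r / 4 <= r by rewrite ler_pdivrMr// ler_peMr ?(ltW r0)// ler1n.
have ps := h s Ds (le_trans sr r41); have pt := h t Dt (le_trans tr r41).
have p1 := hf1 t tr; set K := 16 * M / r ^+ 2.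
apply/ler_addgt0Pr => e e0; have e4 : 0 < e / 3 by rewrite divr_gt0.
have e5 : 0 < e / 3 / (`|s - t| + 1) by rewrite divr_gt0 // ltr_wpDl.
have [N1 h1] := ps _ e4; have [N2 h2] := pt _ e4; have [N3 h3] := p1 _ e5.
pose N := maxn N1 (maxn N2 N3).
have b1 := h1 N.+1 (leqW (leq_maxl _ _)).
have b2 := h2 N.+1 (leqW (leq_trans (leq_maxl _ _) (leq_maxr _ _))).
have b3 := h3 N (leq_trans (leq_maxr _ _) (leq_maxr _ _)).
have sr' : cmod (s - t0)%:C <= r / 4 by rewrite cmod_real.
have tr' : cmod (t - t0)%:C <= r / 4 by rewrite cmod_real.
have := psum_deriv_err N r0 w sr' tr'; rewrite -/K -rmorphB opprB addrA subrK cmod_real.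
set x := psum c (s - t0)%:C N.+1 in b1 *; set y := psum c (t - t0)%:C N.+1 in b2 *.
set z := psum _ _ _ in b3 * => b4.
have b5 : cmod ((s - t)%:C * (z - f1 t)) < e / 3.
  rewrite cmodM cmod_real; move: b3; rewrite ltr_pdivlMr ?ltr_wpDl//.
  by apply: le_lt_trans; rewrite mulrC ler_wpM2l ?cmod_ge0// lerDl.
have -> : f s - f t - (s - t)%:C * f1 t = (x - y - (s - t)%:C * z) +
    (- (x - f s) + (y - f t) + (s - t)%:C * (z - f1 t)) by ring.
have a1 := cmodD (x - y - (s - t)%:C * z) (- (x - f s) + (y - f t) + (s - t)%:C * (z - f1 t)).
have a2 := cmodD (- (x - f s) + (y - f t)) ((s - t)%:C * (z - f1 t)).
have a3 := cmodD (- (x - f s)) (y - f t); rewrite cmodN in a3.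
by move: a1 a2 a3 b1 b2 b4 b5; lra.
Qed.

Lemma real_analytic_deriv (D : set R) (f : R -> C) : perfect_on D ->
  real_analytic_on D f -> exists2 f1, is_deriv_on D f f1 & real_analytic_on D f1.
Proof.
move=> pD /ana_at_real_analytic hf.
(* The derivatives found around different centres must be glued. All local ones take the same value
   [l] at t, so a choice of [l] for each t defines a global derivative; 0 is a default off D. *)
have loc t : exists l, D t -> forall r K f1, 0 < r ->
    (forall s u, D s -> D u -> `|s - t| <= r -> `|u - t| <= r ->
    cmod (f s - f u - (s - u)%:C * f1 u) <= K * `|s - u| ^+ 2) -> f1 t = l.
  have [Dt|] := pselect (D t); last by exists 0.
  have [r [K [f1 [r0 af1 hf1]]]] := ana_at_deriv Dt (hf t Dt).
  exists (f1 t) => _ r' K' f1' r'0 hf1'.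
  (* The part of D on which both remainder estimates hold. It is again perfect, so derivatives along
     it are unique. *)
  pose D' := D `&` [set s | `|s - t| < Num.min r r'].
  have m0 : 0 < Num.min r r' by rewrite lt_min r0.
  have D't : D' t by split; rewrite //= subrr normr0.
  have pD' : perfect_on D'.
    move=> s [Ds /= sm] e e0.
    have [|u [Du us]] := pD s Ds (Num.min e (Num.min r r' - `|s - t|)).
      by rewrite lt_min e0 subr_gt0.
    rewrite lt_min => /andP[ue um]; exists u; split => //; split => //=.
    by have := ler_normD (u - s) (s - t); rewrite addrA subrK; lra.
  have der q L (g1 : R -> C) : Num.min r r' <= q -> (forall s u, D s -> D u -> `|s - t| <= q -> `|u - t| <= q ->
      cmod (f s - f u - (s - u)%:C * g1 u) <= L * `|s - u| ^+ 2) -> is_deriv_on D' f g1.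
    move=> mq hg; apply/is_deriv_onP => u [Du um] e e0.
    exists (e / (`|L| + 1)); first by rewrite divr_gt0 // ltr_wpDl.
    move=> s; rewrite ltr_pdivlMr ?ltr_wpDl// => su st [Ds sm].
    have st0 : (s - u)%:C != 0 by rewrite eq_complex /= eqxx andbT subr_eq0.
    have := hg s u Ds Du (ltW (lt_le_trans sm mq)) (ltW (lt_le_trans um mq)).
    have -> : (f s - f u) / (s - u)%:C - g1 u = (f s - f u - (s - u)%:C * g1 u) / (s - u)%:C.
      by move: (s - u)%:C st0 => d d0; field.
    rewrite cmodM cmodV cmod_real => hh.
    have sup : 0 < `|s - u| by rewrite normr_gt0 subr_eq0.
    rewrite ltr_pdivrMr// (le_lt_trans hh)// expr2 mulrA ltr_pM2r//.
    apply: le_lt_trans su; rewrite mulrC ler_wpM2l// (le_trans (ler_norm L))// lerDl//.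
  symmetry; apply: (is_deriv_on_unique pD' (der _ _ _ _ hf1) (der _ _ _ _ hf1')) => //.
    by rewrite ge_min lexx.
  by rewrite ge_min lexx orbT.
have [f1 hf1] := choice loc; exists f1.
- apply/is_deriv_onP => t Dt e e0.
  have [r [K [g [r0 ag hg]]]] := ana_at_deriv Dt (hf t Dt).
  rewrite -(hf1 t Dt r K g r0 hg).
  exists (Num.min r (e / (`|K| + 1))); first by rewrite lt_min r0 divr_gt0 // ltr_wpDl.
  move=> s; rewrite lt_min ltr_pdivlMr ?ltr_wpDl// => /andP[sr su] st Ds.
  have st0 : (s - t)%:C != 0 by rewrite eq_complex /= eqxx andbT subr_eq0.
  have := hg s t Ds Dt (ltW sr); rewrite subrr normr0 => /(_ (ltW r0)).
  have -> : (f s - f t) / (s - t)%:C - g t = (f s - f t - (s - t)%:C * g t) / (s - t)%:C.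
    by move: (s - t)%:C st0 => d d0; field.
  rewrite cmodM cmodV cmod_real => hh.
  have sup : 0 < `|s - t| by rewrite normr_gt0 subr_eq0.
  rewrite ltr_pdivrMr// (le_lt_trans hh)// expr2 mulrA ltr_pM2r//.
  apply: le_lt_trans su; rewrite mulrC ler_wpM2l// (le_trans (ler_norm K))// lerDl//.
- apply/ana_at_real_analytic => t Dt.
  have [r [K [g [r0 ag hg]]]] := ana_at_deriv Dt (hf t Dt).
  apply: (ana_at_near (e := r / 2) _ _ ag); first by rewrite divr_gt0.
  move=> u Du ut.
  have r2 : 0 < r / 2 by rewrite divr_gt0.
  apply: (hf1 u Du (r / 2) K g r2) => v w Dv Dw vu wu; apply: hg => //.
    by have := ler_normD (v - u) (u - t); rewrite addrA subrK; lra.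
  by have := ler_normD (w - u) (u - t); rewrite addrA subrK; lra.
Qed.

Lemma real_analytic_Cn (D : set R) n (f : R -> C) : perfect_on D ->
  real_analytic_on D f -> Cn D n f.
Proof.
move=> pD; elim: n f => [|n IH] f hf.
  exact: (rc_continuous (@regularity_analytic R D) hf).
by have [f1 fd hf1] := real_analytic_deriv pD hf; exists f1; [exact: fd|exact: IH].
Qed.

End AnalyticDerivative.

Section ChainRule.
Variable R : realType.
Local Notation C := (R[i]).

Lemma is_deriv_on_comp (D E : set R) (u : R -> R) (u' g g' : R -> C) :
  (forall t, D t -> E (u t)) -> is_deriv_on D (fun t => (u t)%:C) u' ->
  is_deriv_on E g g' -> is_deriv_on D (g \o u) (fun t => g' (u t) * u' t).
Proof.
move=> DE ud gd t Dt.
(* The difference quotient of g at u t, completed by g' (u t) at parameters where u s = u t; this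
   makes it continuous along D at t. *)
pose q (s : R) : C := if u s == u t then g' (u t)
   else (g (u s) - g (u t)) / (u s - u t)%:C.
have uc : (fun s => (u s)%:C) @ within D t^' --> (u t)%:C.
  apply: cvg_dnbhs_continuous Dt; exact: is_deriv_on_continuous ud.
have qc : q @ within D t^' --> g' (u t).
  apply/cvgCP => e e0.
  have [n n0 hn] := (is_deriv_onP _ _ _).1 gd (u t) (DE _ Dt) e e0.
  have /cvgCP /(_ n n0) nu := uc.
  have DF : \forall s \near within D t^', D s by apply: near_dnbhs_in.
  apply: filterS2 DF nu => s Ds su; rewrite /q; case: eqVneq => [_|st].
    by rewrite subrr cmod0.
  by apply: hn; [rewrite -cmod_real rmorphB|exact: st|exact: DE].
have h : (fun s => q s * (((u s)%:C - (u t)%:C) / (s - t)%:C)) @ within D t^' -->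
    g' (u t) * u' t by apply: cvgM; [exact: qc|exact: ud].
move: h; apply: cvg_dnbhs_near_eq; apply: near_dnbhs_in => s Ds /=.
rewrite /q; case: eqVneq => [->|st]; first by rewrite !subrr !mul0r mulr0.
have st0 : (u s - u t)%:C != 0 by rewrite eq_complex /= eqxx andbT subr_eq0.
by rewrite -rmorphB mulrA divfK.
Qed.

Lemma Cn_comp (D E : set R) n (u : R -> R) (g : R -> C) :
  (forall t, D t -> E (u t)) -> Cn D n (fun t => (u t)%:C) -> Cn E n g ->
  Cn D n (g \o u).
Proof.
move=> DE; elim: n g => [|n IH] g.
  move=> /= cu cg; apply/within_continuousCP => t Dt.
  have := within_cvg cu Dt => /cvgCP hu; apply/cvgCP => e e0.
  have /cvgCP /(_ e e0) /withinRP [d d0 hd] := within_cvg cg (DE _ Dt).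
  have DF : \forall s \near within D (nbhs t), D s.
    by apply/withinRP; exists 1.
  apply: filterS2 DF (hu d d0) => s Ds su; apply: hd; last exact: DE.
  by rewrite -cmod_real rmorphB.
move=> /[dup] /CnW cu [u' ud cu'] [g' gd cg'].
exists (fun t => g' (u t) * u' t); first exact: is_deriv_on_comp gd.
apply: (rc_mul (regularity_Cn D n) (f := g' \o u)); last exact: cu'.
by apply: IH; [exact: cu|exact: cg'].
Qed.

Lemma real_analytic_comp (D E : set R) (u : R -> R) (g : R -> C) :
  (forall t, D t -> E (u t)) -> real_analytic_on D (fun t => (u t)%:C) ->
  real_analytic_on E g -> real_analytic_on D (g \o u).
Proof.
move=> DE /ana_at_real_analytic hu /ana_at_real_analytic hg.
apply/ana_at_real_analytic => t Dt.
by apply: ana_at_comp_real Dt DE (hu _ Dt) (hg _ (DE _ Dt)).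
Qed.

End ChainRule.

(** * Difference quotients with a fixed base point *)

Section SlopeFunction.
Variable R : realType.
Local Notation C := (R[i]).
Variables (D : set R) (x0 : R).
Hypothesis Dx0 : D x0.
Hypothesis Dconvex : forall s t, D s -> D t -> forall x, s <= x <= t -> D x.

Definition slope (g g' : R -> C) (x : R) : C :=
  if x == x0 then g' x0 else (g x - g x0) / (x - x0)%:C.

(** Away from x0 the derivative of the slope B is (g1 - B) / (x - x0). At x0 the quotients (g1 - g1
    x0) / (x - x0) and (B - g1 x0) / (x - x0) tend to g2 x0 and g2 x0 / 2, which gives both the
    derivative g2 x0 / 2 and its continuity. *)
Lemma slope_C1 (g g1 : R -> C) : is_deriv_on D g g1 -> Cn D 1 g1 -> Cn D 1 (slope g g1).
Proof.
move=> gd [g2 g1d cg2].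
pose B := slope g g1.
pose B1 x : C := if x == x0 then g2 x0 / 2 else (g1 x - B x) / (x - x0)%:C.
have Cneq x : x != x0 -> (x - x0)%:C != 0.
  by move=> h; rewrite eq_complex /= eqxx andbT subr_eq0.
(* Second-order Taylor expansion of g at x0, from the mean value inequality for g - T with T the
   Taylor polynomial; the factor 2 is the one of [mean_value_le]. *)
have taylor e : 0 < e -> exists2 n, 0 < n & forall x, D x -> `|x - x0| < n -> x != x0 ->
    cmod ((g1 x - g1 x0) / (x - x0)%:C - g2 x0) <= e /\ cmod ((B x - g1 x0) / (x - x0)%:C - g2 x0 / 2) <= 2 * e.
  move=> e0; have [n n0 hn] := (is_deriv_onP _ _ _).1 g1d x0 Dx0 e e0.
  exists n => // x Dx xn xx; have h1 := hn x xn xx Dx; split; first exact: ltW.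
  pose T t : C := g x0 + g1 x0 * (t%:C - x0%:C) + g2 x0 / 2 * (t%:C - x0%:C) ^+ 2.
  pose T1 t : C := g1 x0 + g2 x0 * (t%:C - x0%:C).
  have Td : is_deriv_on D (fun t => g t - T t) (fun t => g1 t - T1 t).
    have lin : is_deriv_on D (fun t => t%:C - x0%:C) (fun=> 1 + 0).
      by apply: is_deriv_onD; [exact: is_deriv_on_id|exact: is_deriv_on_cst].
    have sq := is_deriv_onM lin lin.
    have k (b : C) f f' : is_deriv_on D f f' -> is_deriv_on D (fun t => b * f t) (fun t => 0 * f t + b * f' t).
      by move=> fd; apply: is_deriv_onM; [exact: is_deriv_on_cst|exact: fd].
    have tot := is_deriv_onD gd (k (-1) _ _ (is_deriv_onD (is_deriv_onD (@is_deriv_on_cst R D (g x0))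
      (k (g1 x0) _ _ lin)) (k (g2 x0 / 2) _ _ sq))).
    move=> t Dt; have := tot t Dt.
    have -> : g1 t - T1 t = let d : C := t%:C - x0%:C in
        g1 t + (0 * (g x0 + g1 x0 * d + g2 x0 / 2 * (d * d)) +
        -1 * (0 + (0 * d + g1 x0 * (1 + 0)) + (0 * (d * d) +
        g2 x0 / 2 * ((1 + 0) * d + d * (1 + 0))))) by rewrite /T1 /=; field.
    apply: cvg_dnbhs_near_eq; apply: near_dnbhs_in => s Ds /=.
    by congr (_ / _); rewrite /T; ring.
  have bnd t : D t -> `|t - x0| <= `|x - x0| -> cmod (g1 t - T1 t) <= e * `|x - x0|.
    move=> Dt tx; have [->|tx0] := eqVneq t x0.
      by rewrite /T1 !subrr mulr0 addr0 subrr cmod0 mulr_ge0 // ltW.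
    have := hn t (le_lt_trans tx xn) tx0 Dt.
    have -> : (g1 t - g1 x0) / (t - x0)%:C - g2 x0 = (g1 t - T1 t) / (t - x0)%:C.
      have E : (t - x0)%:C = t%:C - x0%:C by rewrite rmorphB.
      have d0 := Cneq _ tx0; rewrite /T1 E in d0 *.
      by move: (t%:C - x0%:C) d0 => d d0; field.
    rewrite cmodM cmodV cmod_real ltr_pdivrMr ?normr_gt0 ?subr_eq0// => /ltW h.
    by rewrite (le_trans h)// ler_wpM2l// ltW.
  have main : cmod (g x - T x) <= 2 * (e * `|x - x0|) * `|x - x0|.
    have T0 : g x0 - T x0 = 0 by rewrite /T; ring.
    have [lt|gt|eq] := ltgtP x x0.
    - have := @mean_value_le R D _ _ x x0 (e * `|x - x0|) Td lt.
      rewrite T0 sub0r cmodN (ltr0_norm (x := x - x0)) ?subr_lt0// opprB; apply.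
        exact: Dconvex.
      move=> t tI; rewrite -[x0 - x]opprB -(ltr0_norm (x := x - x0)) ?subr_lt0//.
      apply: bnd; first exact: Dconvex tI.
      by case/andP: tI => a b; rewrite !ler0_norm ?subr_le0 ?(ltW lt)//; lra.
    - have := @mean_value_le R D _ _ x0 x (e * `|x - x0|) Td gt.
      rewrite T0 subr0 (gtr0_norm (x := x - x0)) ?subr_gt0//; apply.
        exact: Dconvex.
      move=> t tI; rewrite -(gtr0_norm (x := x - x0)) ?subr_gt0//.
      apply: bnd; first exact: Dconvex tI.
      by case/andP: tI => a b; rewrite !ger0_norm ?subr_ge0 ?(ltW gt)//; lra.
    - by rewrite eq eqxx in xx.
  have -> : (B x - g1 x0) / (x - x0)%:C - g2 x0 / 2 = (g x - T x) / (x - x0)%:C ^+ 2.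
    have E : (x - x0)%:C = x%:C - x0%:C by rewrite rmorphB.
    have d0 := Cneq _ xx; rewrite /B /slope (negPf xx) /T E in d0 *.
    by move: (x%:C - x0%:C) d0 => d d0; field.
  rewrite cmodM cmodV cmodX cmod_real ler_pdivrMr ?exprn_gt0 ?normr_gt0 ?subr_eq0//.
  by rewrite (le_trans main)// expr2 !mulrA.
have Bd : is_deriv_on D B B1.
  move=> x Dx; have [->|xx] := eqVneq x x0.
    apply/cvgCP => e e0; have e4 : 0 < e / 4 by rewrite divr_gt0.
    have [n n0 hn] := taylor _ e4.
    apply/dnbhsP; exists n => // s sn sx Ds.
    have B0 : B x0 = g1 x0 by rewrite /B /slope eqxx.
    have [_] := hn s Ds sn sx; rewrite /B1 eqxx B0; lra.
  have d0 := Cneq _ xx.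
  have h : (fun s => ((g s - g x) / (s - x)%:C - B x) / (s - x0)%:C) @ within D x^' -->
      (g1 x - B x) / (x - x0)%:C.
    apply: cvgM; first by apply: cvgB; [exact: gd|exact: cvg_cst].
    apply: cvgV; first exact: d0.
    apply: (cvg_dnbhs_continuous (f := fun s => (s - x0)%:C)) Dx.
    apply: continuous_subspaceT => y.
    by apply: cvg_RtoC; apply: cvgB; [exact: cvg_id|exact: cvg_cst].
  rewrite /B1 (negPf xx); move: h; apply: cvg_dnbhs_near_eq.
  apply/dnbhsP; exists `|x - x0|; first by rewrite normr_gt0 subr_eq0.
  move=> s sx sx' Ds.
  have sx0 : s != x0 by apply: contraTneq sx => ->; rewrite distrC ltxx.
  have d1 := Cneq _ sx0.
  have d2 : (s - x)%:C != 0 by rewrite eq_complex /= eqxx andbT subr_eq0.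
  rewrite /B /slope (negPf xx) (negPf sx0).
  have -> : (s - x)%:C = (s - x0)%:C - (x - x0)%:C by rewrite -rmorphB; congr (_%:C); ring.
  have d3 : (s - x0)%:C - (x - x0)%:C != 0.
    by rewrite -rmorphB (_ : s - x0 - (x - x0) = s - x) //; ring.
  move: (s - x0)%:C (x - x0)%:C d0 d1 d3 => p q d0 d1 d3.
  by field; rewrite d0 d1 d3.
exists B1; first exact: Bd.
have cB := is_deriv_on_continuous Bd.
apply/within_continuousCP => x Dx; have [->|xx] := eqVneq x x0.
  apply/cvgCP => e e0; have e4 : 0 < e / 4 by rewrite divr_gt0.
  have [n n0 hn] := taylor _ e4.
  apply/withinRP; exists n => // s sn Ds.
  have [->|sx] := eqVneq s x0; first by rewrite subrr cmod0.
  have [h1 h2] := hn s Ds sn sx; rewrite /B1 eqxx (negPf sx).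
  have -> : (g1 s - B s) / (s - x0)%:C - g2 x0 / 2 =
     ((g1 s - g1 x0) / (s - x0)%:C - g2 x0) - ((B s - g1 x0) / (s - x0)%:C - g2 x0 / 2).
    by move: (Cneq _ sx); move: (s - x0)%:C => d d0; field.
  by rewrite (le_lt_trans (cmodBD _ _))//; lra.
have h : (fun s => (g1 s - B s) / (s - x0)%:C) @ within D (nbhs x) -->
    (g1 x - B x) / (x - x0)%:C.
  apply: cvgM.
    apply: cvgB; first exact: within_cvg (is_deriv_on_continuous g1d) Dx.
    exact: within_cvg cB Dx.
  apply: cvgV; first exact: Cneq.
  apply: (within_cvg (f := fun s => (s - x0)%:C)) Dx.
  apply: continuous_subspaceT => y.
  by apply: cvg_RtoC; apply: cvgB; [exact: cvg_id|exact: cvg_cst].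
rewrite {2}/B1 (negPf xx) => A /h /withinRP [e e0 he]; apply/withinRP.
exists (Num.min e `|x - x0|); first by rewrite lt_min e0 normr_gt0 subr_eq0.
move=> s; rewrite lt_min => /andP[se sx] Ds.
have sx0 : s != x0 by apply: contraTneq sx => ->; rewrite distrC ltxx.
by rewrite /preimage /= /B1 (negPf sx0); exact: (he s se Ds).
Qed.

(** At x0 the expansion is that of g shifted by one index; elsewhere the slope is a quotient of
    analytic functions. *)
Lemma slope_analytic (g g1 : R -> C) : perfect_on D -> is_deriv_on D g g1 ->
  real_analytic_on D g -> real_analytic_on D (slope g g1).
Proof.
move=> pD gd ga; have /ana_at_real_analytic hg := ga.
apply/ana_at_real_analytic => x Dx; have [->|xx] := eqVneq x x0; last first.
  have d0 : (fun t : R => t%:C - x0%:C) x != 0.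
    by rewrite -rmorphB eq_complex /= eqxx andbT subr_eq0.
  have a1 := ana_at_add (hg _ Dx) (ana_at_cst D (- g x0) x).
  have a2 := ana_at_inv Dx d0 (ana_at_add (ana_at_id D x) (ana_at_cst D (- x0%:C) x)).
  apply: (ana_at_near (e := `|x - x0|) _ _ (ana_at_mul Dx a1 a2)).
    by rewrite normr_gt0 subr_eq0.
  move=> s Ds sx; have sx0 : s != x0.
    by apply: contraTneq sx => ->; rewrite distrC ltxx.
  by rewrite /slope (negPf sx0) rmorphB.
have [r [M [c [r0 w h]]]] := hg x0 Dx0.
have cE := pser_center Dx0 r0 h.
have w1 : weight_le (fun n => c n.+1) r (M / r).
  move=> n; rewrite ler_pdivlMr//; apply: le_trans (w n.+1).
  rewrite big_nat_recl //= ler_wpDl ?mulr_ge0 ?cmod_ge0 ?exprn_ge0 ?(ltW r0)//.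
  by rewrite mulr_suml; apply: ler_sum => k _; rewrite -mulrA -exprSr.
have ser t : D t -> `|t - x0| <= r -> t != x0 ->
    pser (fun n => c n.+1) (t - x0)%:C ((g t - g x0) / (t - x0)%:C).
  move=> Dt tr tx e e0.
  have d0 : (t - x0)%:C != 0 by rewrite eq_complex /= eqxx andbT subr_eq0.
  have dp : 0 < cmod (t - x0)%:C by rewrite cmod_gt0.
  have [N0 hN] := h t Dt tr (e * cmod (t - x0)%:C) (mulr_gt0 e0 dp).
  exists N0 => N NN; rewrite -(ltr_pM2r dp) -cmodM mulrBl divfK//.
  have := hN N.+1 (leqW NN).
  rewrite /psum big_nat_recl // expr0 mulr1 cE mulr_suml.
  have -> : \sum_(0 <= k < N) c k.+1 * (t - x0)%:C ^+ k * (t - x0)%:C =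
      \sum_(0 <= k < N) c k.+1 * (t - x0)%:C ^+ k.+1.
    by apply: eq_bigr => k _; rewrite -mulrA -exprSr.
  by congr (cmod _ < _); ring.
exists r, (M / r), (fun n => c n.+1); split => // t Dt tr.
rewrite /slope; case: eqVneq => [->|tx]; last exact: ser.
rewrite subrr (_ : g1 x0 = c 1%N); first exact: pser0.
(* both are the limit at x0 of the difference quotients *)
apply/eqP; rewrite -subr_eq0 -cmod_eq0 eq_le cmod_ge0 andbT; apply/ler_addgt0Pr => e e0.
have e2 : 0 < e / 2 by rewrite divr_gt0.
have [n n0 hn] := (is_deriv_onP _ _ _).1 gd x0 Dx0 _ e2.
have M0 : 0 <= M := weight_le_ge0 w.
have k0 : 0 < e / 2 / (M / r + 1) * r.
  by rewrite mulr_gt0// divr_gt0// ltr_wpDl// divr_ge0// ltW.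
have [|s [Ds sx]] := pD x0 Dx0 (Num.min n (Num.min r (e / 2 / (M / r + 1) * r))).
  by rewrite !lt_min n0 r0.
rewrite !lt_min => /and3P[sn sr sk].
have h1 := hn s sn sx Ds.
have py := pser_drop0 (ser s Ds (ltW sr) sx).
have k1 : 0 <= `|s - x0| / r <= 1.
  by rewrite divr_ge0 ?(ltW r0) //= ler_pdivrMr// mul1r ltW.
have wd := weight_drop0_scale (ltW r0) k1 w1.
have h2 : cmod ((g s - g x0) / (s - x0)%:C - c 1%N) <= `|s - x0| / r * (M / r).
  by apply: pser_le wd _ py; rewrite cmod_real divfK// gt_eqF.
have h3 : `|s - x0| / r * (M / r) <= e / 2.
  rewrite -ltr_pdivrMr // in sk; move/ltW: sk; rewrite ler_pdivlMr; last first.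
    by rewrite ltr_wpDl// divr_ge0// ltW.
  apply: le_trans; rewrite ler_wpM2l ?divr_ge0 ?(ltW r0)// lerDl//.
set q := _ / _ in h1 h2.
have := cmodD (g1 x0 - q) (q - c 1%N); rewrite addrA subrK (cmodB (g1 x0) q).
by rewrite add0r; lra.
Qed.

End SlopeFunction.

(** * The boundary curve of the domain of one arc *)

Section Circle.
Variable R : realType.
Local Notation C := (R[i]).
Local Notation I := (`[(- 1), 1]%classic : set R).

Lemma perfect_setT : perfect_on [set: R].
Proof.
move=> t _ e e0; exists (t + e / 2); split => //.
  by rewrite -subr_eq0 addrAC subrr add0r gt_eqF// divr_gt0.
by rewrite addrAC subrr add0r gtr0_norm ?divr_gt0// ltr_pdivrMr// ltr_pMr// ltr1n.
Qed.

Lemma perfect_segment : perfect_on I.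
Proof.
move=> t; rewrite /= in_itv /= => /andP[t1 t2] e e0.
pose d := Num.min 1 (e / 2).
have d0 : 0 < d by rewrite lt_min ltr01 divr_gt0.
have d1 : d <= 1 by rewrite ge_min lexx.
have de : d < e.
  by rewrite (@le_lt_trans _ _ (e / 2)) ?ge_min ?lexx ?orbT// ltr_pdivrMr// ltr_pMr// ltr1n.
have [t0|t0] := leP t 0.
  exists (t + d); split; rewrite /= ?in_itv /=; first by move: d0 d1; lra.
    by rewrite -subr_eq0 addrAC subrr add0r gt_eqF.
  by rewrite addrAC subrr add0r gtr0_norm.
exists (t - d); split; rewrite /= ?in_itv /=; first by move: d0 d1; lra.
  by rewrite -subr_eq0 addrAC subrr add0r oppr_eq0 gt_eqF.
by rewrite addrAC subrr add0r normrN gtr0_norm.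
Qed.

Lemma convex_segment (s t : R) : I s -> I t -> forall x, s <= x <= t -> I x.
Proof. by rewrite /= !in_itv /= => hs ht x hx; rewrite in_itv /=; lra. Qed.

Lemma cosI (t : R) : I (cos t).
Proof. by rewrite /= in_itv /= cos_geN1 cos_le1. Qed.

Lemma unit_circleP (z : C) : unit_circle z <->
  complex.Re z ^+ 2 + complex.Im z ^+ 2 = 1.
Proof.
rewrite /unit_circle /= -cmodE normCE; split.
  by move=> [->]; rewrite expr1n.
move=> /eqP; rewrite sqrp_eq1 ?cmod_ge0// => /eqP ->; by [].
Qed.

Lemma circle_param (z : C) (t0 : R) : unit_circle z ->
  exists2 t, `|t - t0| <= pi & z = cos t +i* sin t.
Proof.
move=> /unit_circleP; case: z => x y /= xy.
(* p + i q is z rotated by - t0, so t - t0 is [acos p] with the sign of q. *)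
pose p := x * cos t0 + y * sin t0; pose q := y * cos t0 - x * sin t0.
have pq : p ^+ 2 + q ^+ 2 = 1.
  rewrite (_ : _ + _ = (x ^+ 2 + y ^+ 2) * (cos t0 ^+ 2 + sin t0 ^+ 2)).
    by rewrite xy cos2Dsin2 mulr1.
  by rewrite /p /q; ring.
have xE : x = p * cos t0 - q * sin t0.
  rewrite (_ : _ - _ = x * (cos t0 ^+ 2 + sin t0 ^+ 2)); first by rewrite cos2Dsin2 mulr1.
  by rewrite /p /q; ring.
have yE : y = q * cos t0 + p * sin t0.
  rewrite (_ : _ + _ = y * (cos t0 ^+ 2 + sin t0 ^+ 2)); first by rewrite cos2Dsin2 mulr1.
  by rewrite /p /q; ring.
have pI : -1 <= p <= 1.
  have := sqr_ge0 q; have : p ^+ 2 <= 1 by rewrite -pq lerDl sqr_ge0.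
  by move=> h _; clear -h; apply/andP; split; nra.
have ca : cos (acos p) = p by rewrite acosK// in_itv.
have sa : sin (acos p) = `|q|.
  by rewrite sin_acos// -sqrtr_sqr; congr Num.sqrt; rewrite -pq; ring.
have ap : `|acos p| <= pi by rewrite ger0_norm ?acos_lepi// acos_ge0.
have [q0|q0] := leP 0 q.
  exists (acos p + t0); first by rewrite addrK.
  by rewrite cosD sinD ca sa ger0_norm // -xE yE.
exists (- acos p + t0); first by rewrite addrK normrN.
by rewrite cosD sinD cosN sinN ca sa ltr0_norm // opprK -xE yE.
Qed.

Lemma circle_param_inj (t t0 : R) : `|t - t0| <= pi -> cos t = cos t0 ->
  sin t = sin t0 -> t = t0.
Proof.
move=> tp ct st; have : cos `|t - t0| = cos 0.
  by rewrite cos_norm cosB ct st -!expr2 cos2Dsin2 cos0.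
move=> /cos_inj h; apply/eqP; rewrite -subr_eq0 -normr_eq0 h//.
  by rewrite in_itv /= normr_ge0.
by rewrite in_itv /= lexx pi_ge0.
Qed.

Lemma unit_circle_cos_sin (t : R) : unit_circle (cos t +i* sin t : C).
Proof. by apply/unit_circleP; rewrite /= cos2Dsin2. Qed.

Lemma is_deriv_on_real (f f' : R -> R) : (forall x : R, is_derive x (1 : R) f (f' x)) ->
  is_deriv_on setT (fun t => (f t)%:C) (fun t => (f' t)%:C).
Proof.
move=> fd; apply/is_deriv_onP => t _ e e0.
have [/cvg_ex [l hl] ld] := fd t.
have lE : f' t = l by rewrite -ld; exact: cvg_lim hl.
have /cvgrPdist_lt /(_ e e0) /nbhs_ballP [d /= d0 hd] := hl.
exists d => // s sd st _.
have := hd (s - t); rewrite /ball /= sub0r normrN subr_eq0 => /(_ sd st).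
rewrite [(s - t) *: 1]mulr1 subrK distrC lE => h.
by rewrite -rmorphB -(fmorphV (real_complex R)) -rmorphM -rmorphB cmod_real mulrC.
Qed.

Lemma real_analytic_cos_half :
  real_analytic_on setT (fun t : R => (cos (t / 2))%:C) /\
  real_analytic_on setT (fun t : R => (sin (t / 2))%:C).
Proof.
have hu : real_analytic_on setT (fun t : R => (t / 2)%:C).
  apply/ana_at_real_analytic => t _.
  apply: ana_at_ext (ana_at_scale (2^-1)%:C (@ana_at_id R setT t)) => s _.
  by rewrite -rmorphM mulrC.
split.
  apply: (@real_analytic_comp R setT setT (fun t => t / 2) (fun y => (cos y)%:C)); [by []|exact: hu|].
  by apply/ana_at_real_analytic => t _; have [] := @ana_at_cos_sin R setT t.
apply: (@real_analytic_comp R setT setT (fun t => t / 2) (fun y => (sin y)%:C)); [by []|exact: hu|].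
by apply/ana_at_real_analytic => t _; have [] := @ana_at_cos_sin R setT t.
Qed.

Lemma real_analytic_cos : real_analytic_on setT (fun t : R => (cos t)%:C).
Proof. by apply/ana_at_real_analytic => t _; have [] := @ana_at_cos_sin R setT t. Qed.

Lemma cos_half_sqr (t : R) : cos (t / 2) ^+ 2 = (1 + cos t) / 2.
Proof.
have := cos_mulr2n (t / 2); rewrite (_ : t / 2 *+ 2 = t); last by rewrite -mulr_natr divfK.
by move=> ->; rewrite -mulr_natr; field.
Qed.

Lemma sin_half_sqr (t : R) : sin (t / 2) ^+ 2 = (1 - cos t) / 2.
Proof. by rewrite sin2cos2 cos_half_sqr; field. Qed.

Lemma sin_half_mul (t : R) : sin t = 2 * (sin (t / 2) * cos (t / 2)).
Proof.
have := sin_mulr2n (t / 2); rewrite (_ : t / 2 *+ 2 = t); last by rewrite -mulr_natr divfK.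
by move=> ->; rewrite -mulr_natr; ring.
Qed.

Lemma within_setT_continuous (f : R -> C) : {within setT, continuous f} -> continuous f.
Proof.
move=> cf t; have /cvgCP h := within_cvg cf (t := t) Logic.I.
by apply/cvgCP => e /h /withinRP [d d0 hd]; apply/nbhsRP; exists d => // u /hd; exact.
Qed.

End Circle.

(** * The closed curve over an arc *)

Section ArcCurve.
Variable R : realType.
Local Notation C := (R[i]).
Local Notation S := (Cinf R).
Local Notation I := (`[(- 1), 1]%classic : set R).
Variables g g1 : R -> C.
Hypothesis gd : is_deriv_on I g g1.
Hypothesis cg1 : Cn I 1 g1.
Hypothesis g10 : forall t, I t -> g1 t != 0.
Hypothesis ig : set_inj I g.

Local Notation a := (g (- 1)).
Local Notation b := (g 1).
Let In1 : I (-1). Proof. by rewrite /= in_itv /= lexx; lra. Qed.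
Let I1 : I 1. Proof. by rewrite /= in_itv /= lexx; lra. Qed.
Let cg : {within I, continuous g}. Proof. exact: is_deriv_on_continuous gd. Qed.
Let ab0 : b - a != 0. Proof. by rewrite subr_eq0 eq_sym; exact: arc_ends. Qed.

Let A := slope (-1) g g1.
Let B := slope 1 g g1.

Let slope0 x0 t : I x0 -> I t -> slope x0 g g1 t != 0.
Proof.
move=> Ix It; rewrite /slope; case: (eqVneq t x0) => [_|tx]; first exact: (g10 Ix).
rewrite mulf_neq0 ?invr_eq0 //; last by rewrite eq_complex /= eqxx andbT subr_eq0.
rewrite subr_eq0; apply: contra tx => /eqP gg; apply/eqP.
by apply: ig => //; rewrite inE.
Qed.

Let AE t : A t * (1 + t)%:C = g t - a.
Proof.
rewrite /A /slope; case: eqVneq => [->|tx]; first by rewrite !subrr mulr0.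
by rewrite opprK [t + 1]addrC divfK// eq_complex /= eqxx andbT addrC -[1]opprK subr_eq0.
Qed.

Let BE t : B t * (t - 1)%:C = g t - b.
Proof.
rewrite /B /slope; case: eqVneq => [->|tx]; first by rewrite !subrr mulr0.
by rewrite divfK// eq_complex /= eqxx andbT subr_eq0.
Qed.

Let class_quot (P : (R -> C) -> Prop) : regularity_class I P -> P A -> P B ->
  P (fun t => - (B t / A t)).
Proof.
move=> rc PA PB.
have h : P (fun t => -1 * (B t / A t)).
  apply: (rc_mul rc (f := fun=> -1)); first exact: (rc_cst rc).
  by apply: (rc_div rc); [move=> t It; exact: slope0 In1 It|exact: PB|exact: PA].
by apply: (rc_ext rc) h => t _; rewrite mulN1r.
Qed.

Let cA : Cn I 1 A.
Proof. exact: (slope_C1 In1 (@convex_segment R) gd cg1). Qed.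
Let cB : Cn I 1 B.
Proof. exact: (slope_C1 I1 (@convex_segment R) gd cg1). Qed.

(** [A] and [B] have no zeros: off the base point because g is injective, at the base point because
    g1 does not vanish. Hence - B / A has a continuous root, which inherits the regularity of [A]
    and [B]. *)
Lemma arc_rho : exists rho : R -> C, [/\ forall t, I t -> rho t != 0,
  forall t, I t -> rho t ^+ 2 = - (B t / A t), Cn I 1 rho &
  real_analytic_on I g -> real_analytic_on I rho].
Proof.
have c0 : {within I, continuous (fun t => - (B t / A t))}.
  exact: (class_quot (regularity_Cn I 0) (CnW cA) (CnW cB)).
have q0 t : I t -> - (B t / A t) != 0.
  move=> It; rewrite oppr_eq0 mulf_neq0 ?invr_eq0//.
    exact: slope0 I1 It.
  exact: slope0 In1 It.
have [rho [cr _ rE]] := continuous_sqrt_lift c0 q0 (sqr_sqrtc (- (B (-1) / A (-1)))).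
exists rho.
have r0 t : I t -> rho t != 0 by move=> It; rewrite -sqrf_eq0 rE// q0.
have cr' : {within I, continuous rho} by exact: continuous_subspaceT.
have lift P : regularity_class I P -> P A -> P B -> P rho.
  move=> rc PA PB; apply: (rc_sqrt rc); [exact: r0|exact: cr'|].
  by apply: (rc_ext rc) (class_quot rc PA PB) => t It; rewrite rE.
split; [exact: r0|exact: rE|exact: lift (regularity_Cn I 1) cA cB|].
move=> ga; apply: (lift _ (@regularity_analytic R I)).
  exact: (slope_analytic In1 (@perfect_segment R) gd ga).
exact: (slope_analytic I1 (@perfect_segment R) gd ga).
Qed.

(* With x = cos t, c = cos (t/2) and s = sin (t/2), the points of the curve
   over g x are (h + 1) / (1 - h) for h ^+ 2 = (g x - b) / (g x - a)
   = - (1 - x) B / ((1 + x) A) = (s rho / c) ^+ 2, where rho is a smooth square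
   root of - B / A; the two signs of h are the two signs of t. *)
Variable rho : R -> C.
Hypothesis rho0 : forall t, I t -> rho t != 0.
Hypothesis rhoE : forall t, I t -> rho t ^+ 2 = - (B t / A t).
Hypothesis crho : Cn I 1 rho.

Let c (t : R) : C := (cos (t / 2))%:C.
Let s (t : R) : C := (sin (t / 2))%:C.
Let rh (t : R) : C := rho (cos t).
Let num t := c t + s t * rh t.
Let den t := c t - s t * rh t.

Definition arc_loop (t : R) : C := num t / den t.

(* [arc_loop] as a function of exp (i t): numerator and denominator times
   2 cos (t/2); at -1 the quotient is 0 / 0. *)
Definition circle_map (z : C) : C :=
  let x := (complex.Re z)%:C in let y := (complex.Im z)%:C in
  if complex.Re z == -1 then -1
  else (1 + x + y * rho (complex.Re z)) / (1 + x - y * rho (complex.Re z)).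

Let c2 t : c t ^+ 2 = (1 + cos t)%:C / 2.
Proof.
rewrite /c -rmorphXn cos_half_sqr rmorphM; congr (_ * _).
by rewrite fmorphV rmorph_nat.
Qed.

Let s2 t : s t ^+ 2 = (1 - cos t)%:C / 2.
Proof.
rewrite /s -rmorphXn sin_half_sqr rmorphM; congr (_ * _).
by rewrite fmorphV rmorph_nat.
Qed.

Let cs2 t : c t ^+ 2 + s t ^+ 2 = 1.
Proof. by rewrite c2 s2 !(rmorphB, rmorphD) rmorph1; field. Qed.

Let sc t : (sin t)%:C = 2 * (s t * c t).
Proof. by rewrite /s /c sin_half_mul !rmorphM rmorph_nat. Qed.

Let A0 t : A (cos t) != 0. Proof. exact: slope0 In1 (cosI t). Qed.

Let c2A t : c t ^+ 2 = (g (cos t) - a) / (2 * A (cos t)).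
Proof. by rewrite c2 -AE; have := A0 t; move: (A _) => x x0; field. Qed.

Let srh2 t : (s t * rh t) ^+ 2 = (g (cos t) - b) / (2 * A (cos t)).
Proof.
rewrite exprMn s2 rhoE; last exact: cosI.
rewrite -BE (_ : 1 - cos t = - (cos t - 1)); last by ring.
by rewrite rmorphN /=; have := A0 t; move: (A _) => x x0; field.
Qed.

(** The product is (b - a) / (2 A (cos t)), so numerator and denominator have no zeros, even over
    the end points of the arc. *)
Let nd0 t : num t * den t != 0.
Proof.
rewrite /num /den mulrC -subr_sqr c2A srh2 -mulrBl opprD opprK.
rewrite mulf_neq0 ?invr_eq0 ?mulf_neq0 ?pnatr_eq0//.
by rewrite (_ : g (cos t) - a + (- g (cos t) + b) = b - a) //; ring.
Qed.

Let num0 t : num t != 0. Proof. by move: (nd0 t); rewrite mulf_eq0 negb_or => /andP[]. Qed.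
Let den0 t : den t != 0. Proof. by move: (nd0 t); rewrite mulf_eq0 negb_or => /andP[]. Qed.

Lemma arc_loop0 t : arc_loop t != 0.
Proof. by rewrite mulf_neq0 ?invr_eq0. Qed.

Lemma jou_arc_loop t : jou g (arc_loop t) = g (cos t).
Proof.
rewrite /jou /arc_loop invf_div.
have -> : num t / den t + den t / num t = 2 * (c t ^+ 2 + (s t * rh t) ^+ 2) / (num t * den t).
  have n0 := num0 t; have d0 := den0 t; move: n0 d0; rewrite /num /den.
  by move: (s t * rh t) (c t) => x y n0 d0; field; rewrite n0 d0.
have -> : num t * den t = c t ^+ 2 - (s t * rh t) ^+ 2 by rewrite /num /den; ring.
rewrite c2A srh2; have := A0 t; move: (A _) (g (cos t)) => x z x0.
rewrite (_ : (z - a) / (2 * x) - (z - b) / (2 * x) = (b - a) / (2 * x)); last first.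
  by rewrite -mulrBl; congr (_ / _); ring.
move: (g (-1)) (g 1) ab0 => p q pq.
by field; rewrite x0 pq.
Qed.

Lemma arc_loopN t : arc_loop (- t) = (arc_loop t)^-1.
Proof.
rewrite /arc_loop invf_div /num /den /c /s /rh cosN mulNr cosN sinN rmorphN.
by rewrite mulNr opprK.
Qed.

Lemma circle_map_loop t : circle_map (cos t +i* sin t) = arc_loop t.
Proof.
rewrite /circle_map /=.
have r0 : rho (cos t) != 0 := rho0 (cosI t).
case: eqVneq => [ct|ct].
  have c0 : c t = 0.
    by apply/eqP; rewrite -sqrf_eq0 c2 ct addrN mul0r.
  have s0 : s t != 0.
    by rewrite -sqrf_eq0; have := cs2 t; rewrite c0 expr0n add0r => ->; rewrite oner_eq0.
  rewrite /arc_loop /num /den c0 add0r sub0r invrN mulrN divff//.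
  by rewrite mulf_neq0.
have c0 : c t != 0.
  by rewrite -sqrf_eq0 c2 mulf_neq0 ?invr_eq0 ?pnatr_eq0// eq_complex /= eqxx andbT addrC -[1]opprK subr_eq0.
have x1 : 1 + (cos t)%:C = 2 * c t ^+ 2 by rewrite c2 rmorphD rmorph1; field.
rewrite x1 sc /arc_loop /num /den /rh.
have -> : 2 * c t ^+ 2 + 2 * (s t * c t) * rho (cos t) = 2 * c t * (c t + s t * rho (cos t)) by ring.
have -> : 2 * c t ^+ 2 - 2 * (s t * c t) * rho (cos t) = 2 * c t * (c t - s t * rho (cos t)) by ring.
by rewrite -mulf_div divff ?mul1r// mulf_neq0// pnatr_eq0.
Qed.

(** J recovers g (cos t), hence cos t. If the sines are opposite, the common value equals its own
    inverse, so its square is 1, which forces sin u = 0. *)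
Lemma circle_map_inj : set_inj (@unit_circle R) circle_map.
Proof.
move=> z w; rewrite !inE => /(@circle_param R z 0) [t _ ->] /(@circle_param R w 0) [u _ ->].
rewrite !circle_map_loop => tu.
have cE : cos t = cos u.
  apply: ig; rewrite ?inE; try exact: cosI.
  by rewrite -!jou_arc_loop tu.
have : sin t ^+ 2 = sin u ^+ 2 by rewrite !sin2cos2 cE.
move=> /eqP; rewrite eqf_sqr => /orP[/eqP -> //|/eqP sE]; first by rewrite cE.
have uE : arc_loop t = (arc_loop u)^-1.
  rewrite -arc_loopN -!circle_map_loop; congr circle_map.
  by rewrite cosN sinN cE sE.
have s0 : sin u = 0.
  have : arc_loop u ^+ 2 = 1 by rewrite expr2 -{1}tu uE mulVf// arc_loop0.
  rewrite /arc_loop expr_div_n => /(canRL (mulfVK _)).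
  rewrite expf_neq0// => /(_ isT); rewrite mul1r => /eqP.
  rewrite -subr_eq0 subr_sqr.
  have -> : num u - den u = 2 * (s u * rh u) by rewrite /num /den; ring.
  have -> : num u + den u = 2 * c u by rewrite /num /den; ring.
  rewrite (_ : 2 * (s u * rh u) * (2 * c u) = 2 * rh u * (sin u)%:C); last by rewrite sc; ring.
  rewrite mulf_eq0 (negPf (mulf_neq0 _ _)) ?pnatr_eq0 ?rho0//=; last exact: cosI.
  by rewrite eq_complex /= eqxx andbT => /eqP.
by rewrite sE s0 oppr0 cE.
Qed.

Lemma arc_curveE : arc_curve g = Some @` range arc_loop.
Proof.
apply/seteqP; split => [[w|]|_ [_ [t _ <-] <-]].
- rewrite /arc_curve /=; case: (eqVneq w 0) => [_ [? _ []]//|w0] [_ [x Ix <-] [gx]].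
  have xE : cos (acos x) = x by rewrite acosK//; exact: Ix.
  have [] := jou_inj ig (arc_loop0 (acos x)) w0.
  + by rewrite jou_arc_loop xE gx.
  + by move=> ->; exists (arc_loop (acos x)) => //; exists (acos x).
  + by move=> ->; exists (arc_loop (- acos x)); [exists (- acos x)|rewrite arc_loopN].
- by case=> ? _ [].
- rewrite /arc_curve /= (negPf (arc_loop0 t)); exists (g (cos t)).
    by exists (cos t) => //; exact: cosI.
  by rewrite jou_arc_loop.
Qed.

Lemma circle_map_image : circle_map @` (@unit_circle R) = range arc_loop.
Proof.
apply/seteqP; split => [_ [z /(@circle_param R z 0) [t _ ->] <-]|_ [t _ <-]].
  by exists t => //; rewrite circle_map_loop.
exists (cos t +i* sin t); last exact: circle_map_loop.
exact: unit_circle_cos_sin.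
Qed.

Let cos_inner (P : set R -> (R -> C) -> Prop) : regularity_class setT (P setT) ->
  P setT c -> P setT s -> P setT rh -> P setT arc_loop.
Proof.
move=> rc Pc Ps Pr; have Psr := rc_mul rc Ps Pr.
apply: (rc_div rc); first by move=> t _; exact: den0.
  exact: (rc_add rc).
exact: (rc_sub rc).
Qed.

Lemma arc_loop_analytic : real_analytic_on I rho -> real_analytic_on setT arc_loop.
Proof.
move=> ra; apply: (cos_inner (P := fun D => real_analytic_on D)).
- exact: regularity_analytic.
- exact: (@real_analytic_cos_half R).1.
- exact: (@real_analytic_cos_half R).2.
- by refine (@real_analytic_comp R setT I (@cos R) rho _ (@real_analytic_cos R) ra) => t _; exact: cosI.
Qed.

Lemma arc_loop_C1 : Cn setT 1 arc_loop.
Proof.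
have pT := @perfect_setT R; have [hc hs] := @real_analytic_cos_half R.
apply: (cos_inner (P := fun D => Cn D 1)).
- exact: regularity_Cn.
- exact: real_analytic_Cn pT hc.
- exact: real_analytic_Cn pT hs.
- apply: (Cn_comp (u := @cos R)) crho; first by move=> t _; exact: cosI.
  exact: real_analytic_Cn pT (@real_analytic_cos R).
Qed.

(** Where sin t is not 0, differentiating J (arc_loop t) = g (cos t) suffices. Where sin t = 0 both
    sides have derivative 0, and the quotient rule gives (c^2 + s^2) rho / den^2 = rho / den^2
    instead. *)
Lemma arc_loop_deriv_neq0 f1 : is_deriv_on setT arc_loop f1 -> forall t, f1 t != 0.
Proof.
move=> fd t.
have cosd : is_deriv_on setT (fun t : R => (cos t)%:C) (fun t => (- sin t)%:C).
  by apply: is_deriv_on_real => x; exact: is_derive_cos.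
have sind : is_deriv_on setT (fun t : R => (sin t)%:C) (fun t => (cos t)%:C).
  by apply: is_deriv_on_real => x; exact: is_derive_sin.
have [rho1 rhod _] := crho.
have [st|st] := eqVneq (sin t) 0; last first.
  apply: contra st => /eqP ft.
  have fV := is_deriv_onV (fun t _ => arc_loop0 t) fd.
  have jd := is_deriv_onD (@is_deriv_on_cst R setT ((a + b) / 2))
    (is_deriv_onM (@is_deriv_on_cst R setT ((b - a) / 4)) (is_deriv_onD fd fV)).
  have gcd := is_deriv_on_comp (fun t _ => cosI t) cosd gd.
  have jd' := is_deriv_on_ext (g := g \o cos) (fun t _ => jou_arc_loop t) jd.
  have /eqP := is_deriv_on_unique (@perfect_setT R) jd' gcd Logic.I (t := t).
  rewrite ft !(mul0r, mulr0, oppr0, subrr, addr0) eq_sym mulf_eq0 (negPf (g10 (cosI t))) /=.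
  by rewrite eq_complex /= eqxx andbT oppr_eq0.
have halfd : is_deriv_on setT (fun t : R => (t / 2)%:C) (fun=> 2^-1).
  have h := is_deriv_onM (@is_deriv_on_cst R setT (2^-1)) (@is_deriv_on_id R setT).
  have h' : is_deriv_on setT (fun t : R => 2^-1 * t%:C) (fun=> 2^-1).
    move=> x Tx; have := h x Tx; rewrite mul0r add0r mulr1; exact.
  apply: is_deriv_on_ext h' => x _.
  by rewrite rmorphM fmorphV rmorph_nat mulrC.
have cd := is_deriv_on_comp (E := setT) (fun _ _ => Logic.I) halfd cosd.
have sd := is_deriv_on_comp (E := setT) (fun _ _ => Logic.I) halfd sind.
have rd := is_deriv_on_comp (E := I) (fun t _ => cosI t) cosd rhod.
have srd := is_deriv_onM sd rd.
have nd := is_deriv_onD cd srd.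
have dd := is_deriv_onD cd (is_deriv_onM (@is_deriv_on_cst R setT (-1)) srd).
have den'0 x : setT x -> c x + -1 * (s x * rh x) != 0.
  by move=> _; rewrite mulN1r; exact: den0.
have tot := is_deriv_onM nd (is_deriv_onV den'0 dd).
have tot' := is_deriv_on_ext (g := arc_loop) _ tot.
have fE : f1 t = rho (cos t) / den t ^+ 2.
  rewrite (is_deriv_on_unique (@perfect_setT R) fd (tot' _) Logic.I (t := t)); last first.
    by move=> x _; rewrite /arc_loop /num /den mulN1r.
  have := cs2 t; have := den0 t; rewrite /den /= st oppr0 mulr0 /rh /c /s.
  rewrite (_ : (- sin (t / 2))%:C = - (sin (t / 2))%:C); last exact: rmorphN.
  move: (cos (t / 2))%:C (sin (t / 2))%:C (rho (cos t)) => x y z d0 xy.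
  transitivity ((x ^+ 2 + y ^+ 2) * z / (x - y * z) ^+ 2); last by rewrite xy mul1r.
  by field; rewrite ?mulN1r d0.
by rewrite fE mulf_neq0 ?rho0 ?invr_eq0 ?expf_neq0 ?den0//; exact: cosI.
Qed.

Lemma arc_loop_continuous : continuous arc_loop.
Proof.
exact: within_setT_continuous (CnW arc_loop_C1).
Qed.

Lemma arc_loop_mod t t0 : exists t', [/\ `|t' - t0| <= pi, arc_loop t' = arc_loop t
  & arc_loop t = arc_loop t0 -> t' = t0].
Proof.
have [t' t'pi [ct st]] := @circle_param R (cos t +i* sin t) t0 (unit_circle_cos_sin t).
have fE : arc_loop t' = arc_loop t by rewrite -!circle_map_loop ct st.
exists t'; split=> // ft; have : circle_map (cos t' +i* sin t') = circle_map (cos t0 +i* sin t0).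
  by rewrite !circle_map_loop fE.
move=> /circle_map_inj; rewrite !inE => /(_ (unit_circle_cos_sin _) (unit_circle_cos_sin _)).
by move=> [h1 h2]; exact: circle_param_inj.
Qed.

Let loop_far t0 n : 0 < n -> exists2 e, 0 < e & forall t, cmod (arc_loop t - arc_loop t0) < e ->
  exists2 t', `|t' - t0| < n & arc_loop t' = arc_loop t.
Proof.
move=> n0; pose T : set R := `[t0 - pi, t0 - n]%classic `|` `[t0 + n, t0 + pi]%classic.
have cT : compact (arc_loop @` T).
  apply: continuous_compact; last by apply: compactU; exact: segment_compact.
  exact: continuous_subspaceT arc_loop_continuous.
have nT : ~ (arc_loop @` T) (arc_loop t0).
  move=> [t Tt ft]; have [t' [_ _ _]] := arc_loop_mod t t0.
  have : `|t - t0| <= pi.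
    by move: Tt n0; rewrite /T /= !in_itv /= ler_norml => -[]; lra.
  move=> tp; have tt : t = t0.
    have : circle_map (cos t +i* sin t) = circle_map (cos t0 +i* sin t0).
      by rewrite !circle_map_loop.
    move=> /circle_map_inj; rewrite !inE => /(_ (unit_circle_cos_sin _) (unit_circle_cos_sin _)).
    by move=> [h1 h2]; exact: circle_param_inj.
  by move: Tt n0; rewrite tt /T /= !in_itv /=; case; lra.
have : nbhs (arc_loop t0) (~` (arc_loop @` T)).
  apply: open_nbhs_nbhs; split; last exact: nT.
  by apply: closed_openC; exact: compact_closed (@hausdorffC R) cT.
move=> /nbhsCP [e e0 eT]; exists e => // t te.
have [t' [t'p t'E _]] := arc_loop_mod t t0.
exists t'; last exact: t'E.
rewrite ltNge; apply/negP => nt; apply: (eT (arc_loop t)); first exact: te.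
exists t'; last exact: t'E.
move: t'p nt; rewrite /T /= !in_itv /= ler_norml ler_normr => /andP[h1 h2] /orP[h|h]; [right|left];
  apply/andP; split; lra.
Qed.

Lemma arc_curve_two_sided x : arc_curve g x -> two_sided_at (arc_curve g) x.
Proof.
rewrite arc_curveE => -[_ [t0 _ <-] <-]; apply: two_sided_sphere.
have [f1 fd cf1] := arc_loop_C1.
apply: (curve_two_sided (arc_loop_deriv_neq0 fd t0)); last exact: loop_far.
by apply: (strict_deriv fd); exact: within_setT_continuous cf1 t0.
Qed.

Lemma connected_arc_curve : connected (arc_curve g).
Proof.
rewrite arc_curveE (image_comp arc_loop Some); apply: connected_continuous_connected.
  exact/connected_intervalP.
apply: continuous_subspaceT => t; apply: continuous_comp; first exact: arc_loop_continuous.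
exact: one_point_compactification_some_continuous.
Qed.

Lemma circle_map_smooth : smooth_jordan_curve (circle_map @` (@unit_circle R)).
Proof.
exists circle_map; split=> //; first exact: circle_map_inj.
rewrite (_ : (fun _ => _) = arc_loop); last by apply/funext => t; exact: circle_map_loop.
have [f1 fd cf1] := arc_loop_C1; exists f1; split; [exact: fd|exact: cf1|].
by move=> t _; exact: arc_loop_deriv_neq0 fd t.
Qed.

Lemma circle_map_analytic : real_analytic_on I rho ->
  analytic_jordan_curve (circle_map @` (@unit_circle R)).
Proof.
move=> ra; exists circle_map; split=> //; first exact: circle_map_inj.
rewrite (_ : (fun _ => _) = arc_loop); last by apply/funext => t; exact: circle_map_loop.
have fa := arc_loop_analytic ra; split; first exact: fa.
have [f1 fd _] := real_analytic_deriv (@perfect_setT R) fa; exists f1; first exact: fd.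
by move=> t _; exact: arc_loop_deriv_neq0 fd t.
Qed.

End ArcCurve.

Section Parametrization.
Variable R : realType.
Local Notation C := (R[i]).
Local Notation I := (`[(- 1), 1]%classic : set R).

Lemma jordan_arc_segment (reg : set R -> (R -> C) -> Prop) (A : set C) :
  jordan_arc reg A -> exists (a b : R) (g : R -> C) (u : R -> R),
  [/\ a < b, reg `[a, b]%classic g,
      u = (fun t => (b - a) / 2 * t + (a + b) / 2),
      (forall t, I t -> `[a, b]%classic (u t)) &
      set_inj I (g \o u) /\ A = arc_set (g \o u)].
Proof.
move=> [a [b [g [ab ig rg ->]]]].
exists a, b, g, (fun t => (b - a) / 2 * t + (a + b) / 2).
have uI (t : R) : I t -> `[a, b]%classic ((b - a) / 2 * t + (a + b) / 2).
  rewrite /= !in_itv /= => /andP[t1 t2]; have d0 : 0 <= (b - a) / 2 by rewrite divr_ge0 ?subr_ge0 ?ltW.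
  have := ler_wpM2l d0 t1; have := ler_wpM2l d0 t2.
  by move: ((b - a) / 2 * t); clear -ab => x h1 h2; apply/andP; split; lra.
have d0 : b - a != 0 by rewrite subr_eq0 gt_eqF.
split; [exact: ab|exact: rg|by []|exact: uI|split].
  move=> s t; rewrite !inE => Is It /ig; rewrite !inE => /(_ (uI _ Is) (uI _ It)).
  by move=> /addIr /mulfI; apply; rewrite mulf_neq0 ?invr_eq0 ?pnatr_eq0.
apply/seteqP; split => _ [x Ix <-]; last by exists ((b - a) / 2 * x + (a + b) / 2); [exact: uI|].
exists ((x - (a + b) / 2) / ((b - a) / 2)).
  move: Ix; rewrite /= !in_itv /= => /andP[x1 x2].
  have e0 : 0 < (b - a) / 2 by rewrite divr_gt0 ?subr_gt0.
  rewrite ler_pdivlMr// ler_pdivrMr//; clear -x1 x2; apply/andP; split; lra.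
by rewrite /=; congr g; field; rewrite subr_eq0 gt_eqF.
Qed.

Let affine_deriv (D : set R) (p q : R) :
  is_deriv_on D (fun t => (p * t + q)%:C) (fun=> p%:C).
Proof.
have h := is_deriv_onD (is_deriv_onM (@is_deriv_on_cst R D p%:C) (@is_deriv_on_id R D))
  (@is_deriv_on_cst R D q%:C).
apply: is_deriv_on_ext (_ : is_deriv_on D (fun t => p%:C * t%:C + q%:C) _).
  by move=> t _; rewrite !(rmorphD, rmorphM).
by move=> t Dt; have := h t Dt; rewrite mul0r add0r mulr1 addr0; exact.
Qed.

Let affine_analytic (D : set R) (p q : R) : real_analytic_on D (fun t => (p * t + q)%:C).
Proof.
apply/ana_at_real_analytic => t Dt.
apply: ana_at_ext (ana_at_add (ana_at_scale p%:C (ana_at_id D t)) (ana_at_cst D q%:C t)).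
by move=> s _; rewrite !(rmorphD, rmorphM).
Qed.

(** An arc may be analytic through a parametrization other than the given C^2 one. An analytic one
    is taken whenever it exists, so that the same g serves both conclusions. *)
Lemma C2_arc_param (A : set C) : C2_jordan_arc A -> exists g g1 : R -> C,
  [/\ is_deriv_on I g g1, Cn I 1 g1, forall t, I t -> g1 t != 0, set_inj I g &
      A = arc_set g /\ (analytic_jordan_arc A -> real_analytic_on I g)].
Proof.
move=> C2A; have [|nA] := pselect (analytic_jordan_arc A).
  move=> /jordan_arc_segment [a [b [g [u [ab [ga [g1 gd g10]] uE uI [ig AE]]]]]].
  have d0 : ((b - a) / 2)%:C != 0 :> C.
    by rewrite eq_complex /= eqxx andbT mulf_neq0 ?invr_eq0 ?pnatr_eq0// subr_eq0 gt_eqF.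
  have ud : is_deriv_on I (fun t => (u t)%:C) (fun=> ((b - a) / 2)%:C).
    by rewrite uE; exact: affine_deriv.
  have ua : real_analytic_on I (fun t => (u t)%:C) by rewrite uE; exact: affine_analytic.
  have gua := real_analytic_comp uI ua ga.
  have [h hd ch] := real_analytic_Cn 2 (@perfect_segment R) gua.
  exists (g \o u), h; split; [exact: hd|exact: ch| |exact: ig|split; [exact: AE|by move=> _; exact: gua]].
  move=> t It; have gud := is_deriv_on_comp uI ud gd.
  rewrite (is_deriv_on_unique (@perfect_segment R) hd gud It) mulf_neq0//.
  exact: (g10 _ (uI _ It)).
have [a [b [g [u [ab [g1 [g2 [gd g1d cg2 g10]]] uE uI [ig AE]]]]]] := jordan_arc_segment C2A.
have d0 : ((b - a) / 2)%:C != 0 :> C.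
  by rewrite eq_complex /= eqxx andbT mulf_neq0 ?invr_eq0 ?pnatr_eq0// subr_eq0 gt_eqF.
have ud : is_deriv_on I (fun t => (u t)%:C) (fun=> ((b - a) / 2)%:C).
  by rewrite uE; exact: affine_deriv.
have uC : Cn I 1 (fun t => (u t)%:C).
  by rewrite uE; apply: real_analytic_Cn (@perfect_segment R) _; exact: affine_analytic.
have g1C : Cn `[a, b]%classic 1 g1 by exists g2; [exact: g1d|exact: cg2].
exists (g \o u), (fun t => g1 (u t) * ((b - a) / 2)%:C); split.
- exact: is_deriv_on_comp uI ud gd.
- apply: (rc_mul (regularity_Cn I 1) (f := g1 \o u)); last exact: (rc_cst (regularity_Cn I 1)).
  exact: Cn_comp uI uC g1C.
- by move=> t It; rewrite mulf_neq0//; exact: (g10 _ (uI _ It)).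
- exact: ig.
- by split; [exact: AE|move=> /nA].
Qed.

End Parametrization.

Section Preservation.
Variable R : realType.
Local Notation C := (R[i]).

(** Quantified over parameter sets: arcs are parametrized by segments, closed curves by the whole
    line. *)
Definition preserves_off (K : set C) (W : C -> C) (reg : set R -> (R -> C) -> Prop) :=
  forall D f, (forall t, D t -> ~ K (f t)) -> reg D f -> reg D (W \o f).

Variable g : R -> C.
Hypothesis cg : {within `[(- 1), 1]%classic, continuous g}.
Hypothesis ig : set_inj `[(- 1), 1]%classic g.

Lemma open_up_C1 : preserves_off (arc_set g) (open_up g) (@C1_regular_on R).
Proof.
move=> D f nf [f1 [fd cf1 f10]]; have [od o0] := open_up_is_deriv cg ig nf fd.
exists (open_up_deriv g f f1); split; [exact: od| |by move=> t Dt; exact: o0 (f10 _ Dt)].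
apply: (open_up_deriv_regular cg ig (regularity_Cn D 0) nf); last exact: cf1.
exact: is_deriv_on_continuous fd.
Qed.

Lemma open_up_C2 : preserves_off (arc_set g) (open_up g) (@C2_regular_on R).
Proof.
move=> D f nf [f1 [f2 [fd f1d cf2 f10]]]; have [od o0] := open_up_is_deriv cg ig nf fd.
have Cf1 : Cn D 1 f1 by exists f2; [exact: f1d|exact: cf2].
have Cf : Cn D 1 f by exists f1; [exact: fd|exact: CnW Cf1].
have [h hd ch] := open_up_deriv_regular cg ig (regularity_Cn D 1) nf Cf Cf1.
by exists (open_up_deriv g f f1), h; split; [exact: od|exact: hd|exact: ch|move=> t Dt; exact: o0 (f10 _ Dt)].
Qed.

Lemma open_up_analytic : preserves_off (arc_set g) (open_up g) (@analytic_regular_on R).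
Proof.
move=> D f nf [fa [f1 fd f10]]; have [od o0] := open_up_is_deriv cg ig nf fd.
split; first exact: (open_up_regular cg ig (@regularity_analytic R D) nf fa).
by exists (open_up_deriv g f f1); [exact: od|move=> t Dt; exact: o0 (f10 _ Dt)].
Qed.

End Preservation.

(** * The domain of a single arc *)

Section OneArc.
Variable R : realType.
Local Notation C := (R[i]).
Local Notation S := (Cinf R).
Local Notation I := (`[(- 1), 1]%classic : set R).

(** What the induction retains about one arc. The derivatives of g, which serve to parametrize the
    curve, are forgotten here. *)
Record arc_opening (A : set C) (g : R -> C) : Prop := ArcOpening {
  ao_set : A = arc_set g;
  ao_continuous : {within I, continuous g};
  ao_inj : set_inj I g;
  ao_curve : exists c, [/\ arc_curve g = Some @` c, smooth_jordan_curve c &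
    analytic_jordan_arc A -> analytic_jordan_curve c];
  ao_connected : connected (arc_curve g);
  ao_two_sided : forall x, arc_curve g x -> two_sided_at (arc_curve g) x
}.

Lemma arc_opening_ex (A : set C) : C2_jordan_arc A -> exists g, arc_opening A g.
Proof.
move=> /C2_arc_param [g [g1 [gd cg1 g10 ig [AE ga]]]].
have [rho [r0 rE cr ra]] := arc_rho gd cg1 g10 ig.
exists g; split; [exact: AE|exact: is_deriv_on_continuous gd|exact: ig| | |].
- exists (circle_map rho @` @unit_circle R); split.
  + by rewrite (circle_map_image r0); exact: (arc_curveE g10 ig rE).
  + exact: (circle_map_smooth gd g10 ig r0 rE cr).
  + by move=> /ga /ra h; exact: (circle_map_analytic gd g10 ig r0 rE cr h).
- exact: (connected_arc_curve g10 ig rE cr).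
- exact: (arc_curve_two_sided gd g10 ig r0 rE cr).
Qed.

Variables (A : set C) (g : R -> C).
Hypothesis ao : arc_opening A g.
Let cg := ao_continuous ao.
Let ig := ao_inj ao.

Let sphere_inv1 : sphere_inv (Some 1 : S) = Some 1.
Proof. by rewrite /= oner_eq0 invr1. Qed.

Let curve1 : arc_curve g (Some 1).
Proof. exact: (@jouS_fixed R g _ sphere_inv1). Qed.

Lemma arc_one_sided x : arc_curve g x -> one_sided_at (arc_domain g) x.
Proof.
apply: (curve_one_sided (@continuous_sphere_inv R) (@sphere_invK R) (open_arc_domain cg ig)
 (arc_trichotomy cg ig) (@arc_domain_curve R g) (@arc_codomain_curve R g)
 (@arc_domain_codomain R g) (ao_connected ao) (ao_two_sided ao) curve1 sphere_inv1).
Qed.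

Lemma boundary_arc_domain : boundary (arc_domain g) = arc_curve g.
Proof.
rewrite boundary_open; last exact: (open_arc_domain cg ig).
apply: (boundary_side (@continuous_sphere_inv R) (@sphere_invK R) (open_arc_domain cg ig)
 (arc_trichotomy cg ig) (@arc_domain_curve R g) (@arc_codomain_curve R g)
 (@arc_domain_codomain R g) (ao_connected ao) (ao_two_sided ao) curve1 sphere_inv1).
Qed.

Lemma connected_arc_domainC : connected (~` arc_domain g).
Proof.
apply: (connected_other_side (@continuous_sphere_inv R) (@sphere_invK R) (open_arc_domain cg ig)
 (arc_trichotomy cg ig) (@arc_domain_curve R g) (@arc_codomain_curve R g)
 (@arc_domain_codomain R g) (ao_connected ao) (ao_two_sided ao) curve1 sphere_inv1).
exact: connectedS.
Qed.

End OneArc.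

(** * Conformality and rationality *)

Section Conformal.
Variable R : realType.
Local Notation C := (R[i]).
Local Notation S := (Cinf R).
Implicit Types (f : C -> C) (x y : C) (z : S).

(* Caratheodory's form of a nonzero derivative: it composes without limits. *)
Definition cdiff_at f x : Prop := exists phi : C -> C,
  [/\ phi @ nbhs x --> phi x, phi x != 0 &
      \forall y \near x, f y - f x = phi y * (y - x)].

Lemma nearC x (P : C -> Prop) : (forall y, P y) -> \forall y \near x, P y.
Proof. by move=> h; apply/nbhsCP; exists 1. Qed.

Let cvgP f x (l : C) : f @ x^' --> l <->
  forall e, 0 < e -> exists2 d, 0 < d & forall y, cmod (y - x) < d -> y != x -> cmod (f y - l) < e.
Proof.
split.
  by move=> /cvgCP h e /h /nbhsCP [d d0 dP]; exists d.
move=> h; apply/cvgCP => e /h [d d0 dP]; by apply/nbhsCP; exists d.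
Qed.

Let quot f x : C -> C := fun h => h^-1 * (f (h + x) - f x).

Let quotP f x (l : C) : quot f x @ 0^' --> l <->
  (fun y => (f y - f x) / (y - x)) @ x^' --> l.
Proof.
split=> /cvgP h; apply/cvgP => e /h [d d0 dP]; exists d => // y yd yx.
  have := dP (y - x); rewrite subr0 subr_eq0 /quot subrK mulrC; exact.
have := dP (y + x); rewrite addrK /quot mulrC => -> //; first by rewrite -[y]subr0.
by rewrite -subr_eq0 addrK.
Qed.

Let derivableE f x : derivable f x 1 = cvg (quot f x @ 0^').
Proof.
rewrite (_ : quot f x = (fun h => h^-1 *: ((f \o shift x) (h *: (1 : C)) - f x))) //.
by apply/funext => h; rewrite /= [h *: 1]mulr1.
Qed.

Lemma cdiff_atP f x : derivable f x 1 /\ derive1 f x != 0 <-> cdiff_at f x.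
Proof.
have dE : derive1 f x = lim (quot f x @ 0^') by [].
rewrite derivableE dE; split.
  move=> [/cvg_ex [l ql]]; rewrite (cvg_lim (@norm_hausdorff _ _) ql) => l0.
  move: ql => /quotP /cvgP ql.
  exists (fun y => if y == x then l else (f y - f x) / (y - x)); split.
  - apply/cvgCP => e /[dup] e0 /ql [d d0 dP]; apply/nbhsCP; exists d => // y yd.
    rewrite eqxx; case: (eqVneq y x) => [_|]; first by rewrite subrr cmod0.
    exact: dP.
  - by rewrite eqxx.
  - apply: nearC => y; case: (eqVneq y x) => [->|yx]; first by rewrite !subrr mulr0.
    by rewrite divfK// subr_eq0.
move=> [phi [cphi p0 /nbhsCP [d d0 fE]]].
have ql : quot f x @ 0^' --> phi x.
  apply/quotP/cvgP => e e0; have /cvgCP /(_ e e0) /nbhsCP [d' d'0 pd] := cphi.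
  exists (Num.min d d'); first by rewrite lt_min d0.
  move=> y; rewrite lt_min => /andP[yd yd'] yx.
  rewrite fE// mulfK ?subr_eq0//; exact: pd.
by split; [apply/cvg_ex; exists (phi x)|rewrite (cvg_lim (@norm_hausdorff _ _) ql)].
Qed.

Lemma conformal_atP F z : conformal_at F z <->
  {for z, continuous F} /\ cdiff_at (local_expr F z) (chart_coord z).
Proof.
split; first by move=> [cF d1 d2]; split=> //; apply/cdiff_atP.
by move=> [cF /cdiff_atP[d1 d2]]; split.
Qed.

Lemma cdiff_at_comp f g x : {for x, continuous f} -> cdiff_at f x -> cdiff_at g (f x) ->
  cdiff_at (g \o f) x.
Proof.
move=> cf [p [cp p0 fE]] [q [cq q0 gE]]; exists (fun y => q (f y) * p y).
have cqf : q \o f @ nbhs x --> q (f x) by apply: cvg_comp; [exact: cf|exact: cq].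
split; [by apply: cvgM; [exact: cqf|exact: cp]|by rewrite mulf_neq0|].
have gE' : \forall y \near x, g (f y) - g (f x) = q (f y) * (f y - f x) by exact: cf gE.
by apply: filterS2 fE gE' => y h1 h2; rewrite /= h2 h1 mulrA.
Qed.

Lemma cdiff_at_near f g x : (\forall y \near x, f y = g y) -> cdiff_at f x -> cdiff_at g x.
Proof.
move=> fg [p [cp p0 fE]]; exists p; split => //; have fgx := nbhs_singleton fg.
by apply: filterS2 fg fE => y <- h; rewrite -fgx.
Qed.

Lemma chartK z : involutive (chart z).
Proof. by case: z => [w|] //; exact: sphere_invK. Qed.

Lemma chart_self z : chart z z = Some (chart_coord z).
Proof. by case: z. Qed.

Lemma continuous_chart z : continuous (chart z).
Proof. by case: z => [w|] x; [exact: cvg_id|exact: continuous_sphere_inv]. Qed.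

Lemma chart_coordK z : chart z (Some (chart_coord z)) = z.
Proof. by rewrite -chart_self chartK. Qed.

Let chart_map (F : S -> S) z (w : C) : S := chart (F z) (F (chart z (Some w))).

Let chart_map_near F z : {for z, continuous F} ->
  chart_map F z @ nbhs (chart_coord z) --> chart (F z) (F z).
Proof.
move=> cF.
apply: (@cvg_comp _ _ _ (fun w => F (chart z (Some w))) (chart (F z)) _ (nbhs (F z))).
  apply: (@cvg_comp _ _ _ (fun w => chart z (Some w)) F _ (nbhs z)); last exact: cF.
  rewrite -[X in _ `=>` nbhs X](chart_coordK z).
  apply: (@cvg_comp _ _ _ (Some : C -> S) (chart z) _ (nbhs (Some (chart_coord z) : S))).
    exact: one_point_compactification_some_continuous.
  exact: continuous_chart.
exact: continuous_chart.
Qed.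

(** By continuity the image stays in the domain of the target chart, so the default value of
    [local_expr] is not reached. *)
Let local_exprE F z : {for z, continuous F} -> \forall w \near chart_coord z,
  chart_map F z w = Some (local_expr F z w).
Proof.
move=> cF; have /(_ (Some @` setT)) := chart_map_near cF.
have : nbhs (chart (F z) (F z)) (Some @` [set: C]).
  by rewrite chart_self; apply/nbhs_finP; apply: nearC => w; exists w.
move=> h /(_ h) h'; apply: filterS (h' : nbhs _ (fun w => _ (chart_map F z w))) => w [v _]; rewrite /local_expr /chart_map.
by case: (chart _ _).
Qed.

(** Charts are involutions, so the two charts at [F2 z] cancel and the local expression of the
    composite is, near the coordinate of z, the composite of the local expressions. *)
Lemma conformal_at_comp F1 F2 z : conformal_at F2 z -> conformal_at F1 (F2 z) ->
  conformal_at (F1 \o F2) z.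
Proof.
move=> /conformal_atP [c2 d2] /conformal_atP [c1 d1]; apply/conformal_atP.
split; first exact: continuous_comp.
have lE := local_exprE c2.
have l0 : local_expr F2 z (chart_coord z) = chart_coord (F2 z).
  by rewrite /local_expr chart_coordK.
have cl : local_expr F2 z @ nbhs (chart_coord z) --> local_expr F2 z (chart_coord z).
  rewrite l0 => A nA; have := chart_map_near c2.
  rewrite chart_self => /(_ (Some @` A)) h.
  have : \forall w \near chart_coord z, (Some @` A) (chart_map F2 z w).
    by apply: h; apply/nbhs_finP; apply: filterS nA => w Aw; exists w.
  move=> h'; apply: (filterS2 _ _ lE h') => w h1 [v Av vE]; have e : v = local_expr F2 z w by move: h1; rewrite -vE => -[].
  by rewrite /= -e.
have := cdiff_at_comp cl d2; rewrite l0 => /(_ _ d1); apply: cdiff_at_near.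
apply: filterS lE => w; rewrite /chart_map => /(congr1 (chart (F2 z))); rewrite chartK => h.
by rewrite /= {1}/local_expr /= -h.
Qed.

Lemma conformal_at_id z : conformal_at id z.
Proof.
apply/conformal_atP; split; first by move=> ?; exact.
exists (fun=> 1); split; [exact: cvg_cst|exact: oner_neq0|].
by apply: nearC => y; rewrite mul1r /local_expr /= !chartK.
Qed.

End Conformal.

Section ConformalJoukowski.
Variable R : realType.
Local Notation C := (R[i]).
Local Notation S := (Cinf R).
Local Notation I := (`[(- 1), 1]%classic : set R).
Variable g : R -> C.
Hypothesis ig : set_inj I g.

Let k0 : (g 1 - g (-1)) / 4 != 0.
Proof. by rewrite mulf_neq0 ?invr_eq0 ?pnatr_eq0// subr_eq0 eq_sym; exact: arc_ends. Qed.

Lemma conformal_at_jouS z : arc_domain g z -> conformal_at (jouS g) z.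
Proof.
move=> Gz; have nz := arc_domain_curve Gz; apply/conformal_atP.
split; first exact: (continuous_jouS ig).
case: z Gz nz => [w|] Gz nz.
  have w0 : w != 0 by apply/eqP => w0; move: Gz => [_]; rewrite w0 /= eqxx.
  (* The difference quotient of [jou] between w and y. At y = w it vanishes only if w is its own
     inverse, and such points lie on the curve. *)
  exists (fun y => (g 1 - g (-1)) / 4 * (1 - w^-1 * y^-1)); split.
  - apply: cvgM; first exact: cvg_cst.
    apply: cvgB; first exact: cvg_cst.
    by apply: cvgM; [exact: cvg_cst|exact: inv_continuous].
  - rewrite mulf_neq0// subr_eq0; apply/eqP => ww; apply: nz.
    apply: (@jouS_fixed R g); rewrite /= (negPf w0); congr Some.
    by apply: (mulfI (invr_neq0 w0)); rewrite -ww mulVf.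
  - have : \forall y \near w, y != 0.
      apply/nbhsCP; exists (cmod w); first by rewrite cmod_gt0.
      by move=> y; apply: contraTneq => ->; rewrite sub0r cmodN ltxx.
    apply: filterS => y y0; rewrite /local_expr /= (negPf y0) (negPf w0) /= /jou /chart_coord /=.
    by field; rewrite y0 w0.
pose k := (g 1 - g (-1)) / 4; have k1 : k != 0 := k0; pose m := (g (-1) + g 1) / 2.
(* In the charts at oo the map is 1 / J(1/y) = y / (k + m y + k y^2). *)
exists (fun y => (k + m * y + k * y * y)^-1).
have n0 : k + m * 0 + k * 0 * 0 != 0 by rewrite !mulr0 !addr0.
rewrite /chart_coord /=; split; [|by rewrite invr_eq0|].
  apply: (@cvgV _ _ _ _ (fun y : C => k + m * y + k * y * y)); first exact: n0.
  have ci : (id : C -> C) @ nbhs (0 : C) --> (0 : C) by exact: cvg_id.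
  have cc (u : C) : (fun=> u) @ nbhs (0 : C) --> u by exact: cvg_cst.
  by apply: cvgD; [apply: cvgD; [|apply: cvgM]|apply: cvgM; [apply: cvgM|]];
    first [exact: cc|exact: ci].
apply: nearC => y; rewrite subr0 /local_expr /= eqxx subr0.
case: (eqVneq y 0) => [->|y0] /=; first by rewrite mulr0.
rewrite invr_eq0 (negPf y0) jouV /=.
have jE : jou g y = (k + m * y + k * y * y) / y.
  by rewrite (_ : jou g _ = m + k * (y + y^-1)) //; clearbody k m; field.
rewrite (_ : _^-1 * y = (jou g y)^-1); last by rewrite jE invf_div mulrC.
by case: eqVneq => [->|//]; rewrite invr0.
Qed.

End ConformalJoukowski.

Section Rational.
Variable R : realType.
Local Notation C := (R[i]).

Lemma rational_id : rational_function (id : Cinf R -> Cinf R).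
Proof.
exists 'X, 1; split; [exact: oner_neq0|by rewrite coprimep1|].
by case=> [w|] /=; rewrite ?hornerE ?oner_eq0 ?divr1// size_polyX size_poly1.
Qed.

(** For F = p / q the composite is (k p^2 + m p q + k q^2) / (p q). The numerator is k q^2 modulo p
    and k p^2 modulo q, whence coprimality; [F None = None] means deg p > deg q, so k p^2 has the
    highest degree. *)
Lemma rational_jouS (g : R -> C) F : set_inj `[(- 1), 1]%classic g ->
  rational_function F -> F None = None -> rational_function (jouS g \o F).
Proof.
move=> ig [p [q [q0 pq FE]]] FN; pose k := (g 1 - g (-1)) / 4; pose m := (g (-1) + g 1) / 2.
have k0 : k != 0 by rewrite mulf_neq0 ?invr_eq0 ?pnatr_eq0// subr_eq0 eq_sym; exact: arc_ends.
have szpq : (size q < size p)%N by move: FN; rewrite FE /=; case: ifP.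
have p0 : p != 0 by apply: contraTneq szpq => ->; rewrite size_poly0.
pose P := k%:P * (p * p) + m%:P * (p * q) + k%:P * (q * q).
exists P, (p * q); split.
- by rewrite mulf_neq0.
- rewrite coprimep_sym coprimepMl; apply/andP; split.
    rewrite (_ : P = (k%:P * p + m%:P * q) * p + k%:P * (q * q)); last by rewrite /P; ring.
    by rewrite coprimep_addl_mul mul_polyC coprimepZr// coprimepMr pq.
  rewrite (_ : P = (m%:P * p + k%:P * q) * q + k%:P * (p * p)); last by rewrite /P; ring.
  by rewrite coprimep_addl_mul mul_polyC coprimepZr// coprimepMr coprimep_sym pq.
- case=> [w|] /=; rewrite FE /=.
    rewrite hornerM; case: (eqVneq q.[w] 0) => [qw|qw] /=; first by rewrite qw mulr0 eqxx.
    rewrite !mulf_eq0 invr_eq0 (negPf qw) !orbF.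
    case: (eqVneq p.[w] 0) => [//|pw]; congr Some.
    rewrite (_ : jou g _ = m + k * (p.[w] / q.[w] + (p.[w] / q.[w])^-1)) //.
    rewrite /P !(hornerD, hornerM, hornerC); clearbody k m; field.
    by rewrite pw qw.
  have q1 : (0 < size q)%N by rewrite size_poly_gt0.
  have s1 : size (k%:P * (p * p)) = (size p + size p).-1.
    by rewrite mul_polyC size_scale// size_mul.
  have s2 : (size (m%:P * (p * q))%R <= (size p + size q).-1)%N.
    by rewrite mul_polyC (leq_trans (size_scale_leq _ _))// size_mul.
  have s3 : (size (k%:P * (q * q))%R <= (size q + size q).-1)%N.
    by rewrite mul_polyC (leq_trans (size_scale_leq _ _))// size_mul.
  have s4 : (size (m%:P * (p * q) + k%:P * (q * q))%R < size (k%:P * (p * p))%R)%N.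
    apply: leq_ltn_trans (size_polyD _ _) _.
    by move: s1 s2 s3 szpq q1; clear; lia.
  rewrite szpq /= ifT// /P -addrA size_polyDl// s1 size_mul//.
  by rewrite ltn_predRL prednK ?ltn_add2l// addn_gt0 q1 orbT.
Qed.

End Rational.

(** * Opening the arcs one after the other *)

Section Opening.
Variable R : realType.
Local Notation C := (R[i]).
Local Notation S := (Cinf R).

(** The invariant of the induction. W inverts F as a map of the plane, which [omap] extends by oo
    |-> oo. It transports the curve of the next arc into the new boundary, so its effect on
    regularity off K belongs to the invariant. *)
Record opening (K : set C) (n : nat) (F : S -> S) (G : set S) (W : C -> C) : Prop :=
  Opening {
  op_rational : rational_function F;
  op_inf : F None = None;
  op_domain : domain G;
  op_domain_inf : G None;
  op_components : (components [set z : C | ~ G (Some z)] #= `I_n)%card;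
  op_range : forall z, G z -> ~ (Some @` K) (F z);
  op_invl : forall z, G z -> omap W (F z) = z;
  op_inv : forall z, ~ (Some @` K) z -> G (omap W z) /\ F (omap W z) = z;
  op_conformal : forall z, G z -> conformal_at F z;
  op_continuous : forall z : S, ~ (Some @` K) z -> {for z, continuous (omap W : S -> S)};
  op_smooth : finite_union_of (@smooth_jordan_curve R) (boundary G);
  op_C1 : preserves_off K W (@C1_regular_on R);
  op_C2 : preserves_off K W (@C2_regular_on R);
  op_analytic : preserves_off K W (@analytic_regular_on R)
}.

Lemma boundary_setT : boundary [set: S] = set0.
Proof. by rewrite boundary_open ?setDT//; exact: openT. Qed.

Lemma within_continuousS (f : S -> S) (B : set S) :
  (forall x, B x -> {for x, continuous f}) -> {within B, continuous f}.
Proof.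
move=> cf; apply/subspace_continuousP => x Bx U nU.
have h : nbhs x (fun y => U (f y)) := cf x Bx U nU.
by apply: (@filterS _ (nbhs x) _ (fun y => U (f y)) (fun y => B y -> U (f y))) h.
Qed.

Lemma closed_imageS (f : S -> S) (B : set S) : closed B ->
  (forall x, B x -> {for x, continuous f}) -> closed (f @` B).
Proof.
move=> cB cf; apply: compact_closed; first exact: hausdorffS.
by apply: continuous_compact; [exact: within_continuousS|exact: closedS_compact].
Qed.

Lemma closed_some (B : set C) : compact B -> closed (Some @` B : set S).
Proof.
move=> cB; apply: compact_closed; first exact: hausdorffS.
apply: continuous_compact cB; apply: continuous_subspaceT.
exact: one_point_compactification_some_continuous.
Qed.

Lemma finite_union_of_set0 (P : set C -> Prop) : finite_union_of P (set0 : set S).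
Proof.
exists 0, (fun=> set0); split; first by case.
by apply/seteqP; split=> [y []|y [x [[]]]].
Qed.

Lemma finite_union_ofU (P : set C -> Prop) (A : set S) (c : set C) :
  finite_union_of P A -> P c -> finite_union_of P (A `|` Some @` c).
Proof.
move=> [n [d [Pd ->]]] Pc; exists n.+1, (fun i => if unlift ord_max i is Some j then d j else c).
split; first by move=> i; case: unliftP.
apply/seteqP; split => [_ [[x [i _ dx] <-]|[x cx <-]]|_ [x [i _] + <-]].
- by exists x => //; exists (lift ord_max i) => //; rewrite liftK.
- by exists x => //; exists ord_max => //; rewrite unlift_none.
- case: unliftP => [j _ dx|_ cx]; first by left; exists x => //; exists j.
  by right; exists x.
Qed.

Lemma opening_set0 : opening set0 0 id setT id.
Proof.
have im0 z : ~ (Some @` (set0 : set C)) z by move=> [? []].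
split; [exact: rational_id|by []| |by []| | | | | | | | | | ].
- by split; [exact: openT|exact: connectedS|exists None].
- rewrite (_ : components _ = set0); first by rewrite II0 card_eq0.
  by rewrite -subset0 => y [z nz]; exfalso; exact: nz.
- by move=> z _; exact: im0.
- by case.
- by case.
- by move=> z _; exact: conformal_at_id.
- move=> z _; rewrite (_ : omap id = id); first by move=> ?; exact.
  by apply/funext; case.
- by rewrite boundary_setT; exact: finite_union_of_set0.
- by move=> D f _ h; exact: h.
- by move=> D f _ h; exact: h.
- by move=> D f _ h; exact: h.
Qed.

Lemma image_smooth_curve (K : set C) (W : C -> C) reg (c : set C) :
  (forall z w, ~ K z -> ~ K w -> W z = W w -> z = w) -> preserves_off K W reg ->
  c `&` K = set0 -> jordan_curve reg c -> jordan_curve reg (W @` c).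
Proof.
move=> injW pW cK [f [injf rf cE]].
have nK z : unit_circle z -> ~ K (f z).
  by move=> uz Kf; rewrite -[False]/(set0 (f z)) -cK; split=> //; rewrite cE; exists z.
exists (W \o f); split.
- move=> z w; rewrite !inE => uz uw h; apply: injf; rewrite ?inE//.
  by apply: injW h; exact: nK.
- apply: (pW setT (fun t => f (cos t +i* sin t))) rf => t _.
  by apply: nK; exact: unit_circle_cos_sin.
- by rewrite cE -image_comp.
Qed.

Lemma op_inj K n F G W : opening K n F G W ->
  forall z w, ~ K z -> ~ K w -> W z = W w -> z = w.
Proof.
move=> op z w nz nw e; have h (u : C) : ~ K u -> F (Some (W u)) = Some u.
  by move=> nu; have [] // := op_inv op (z := Some u) _; move=> [v Kv [vu]]; apply: nu; rewrite -vu.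
by have := h _ nz; rewrite e h// => -[].
Qed.

End Opening.

(** * Adding one arc *)

Section Step.
Variable R : realType.
Local Notation C := (R[i]).
Local Notation S := (Cinf R).
Variables (A K1 : set C) (g : R -> C).
Hypothesis ao : arc_opening A g.
Hypothesis cK1 : compact K1.
Hypothesis AK1 : A `&` K1 = set0.
Local Notation F1 := (jouS g).
Local Notation G1 := (arc_domain g).
Local Notation W1 := (open_up g).
Local Notation K' := (W1 @` K1).
Variables (n : nat) (F' : S -> S) (G' : set S) (W' : C -> C).
Hypothesis op : opening K' n F' G' W'.

Local Notation SA := (Some @` A : set S).
Local Notation SK' := (Some @` K' : set S).
Local Notation W1S := (omap W1 : S -> S).
Local Notation W'S := (omap W' : S -> S).

Let cg := ao_continuous ao.
Let ig := ao_inj ao.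
Let AE := ao_set ao.

Let G1nA z : G1 z -> ~ SA (F1 z). Proof. by rewrite AE => -[]. Qed.
Let W1F1 z : G1 z -> W1S (F1 z) = z. Proof. by move=> -[_]. Qed.
Let W1G1 z : ~ SA z -> G1 (W1S z).
Proof. by rewrite AE; exact: (open_upS_domain cg ig). Qed.
Let F1W1 z : ~ SA z -> F1 (W1S z) = z.
Proof. by rewrite AE; exact: (jouSK cg ig). Qed.
Let cW1 (z : S) : ~ SA z -> {for z, continuous W1S}.
Proof. by rewrite AE; exact: (continuous_open_upS cg ig). Qed.
Let oG1 : open G1 := open_arc_domain cg ig.

Let SK1A z : (Some @` K1 : set S) z -> ~ SA z.
Proof.
move=> [k Kk <-] [x Ax [xk]]; rewrite -[False]/(set0 k) -AK1; split=> //.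
by rewrite -xk.
Qed.

Let K'G1 z : SK' z -> G1 z /\ (Some @` K1 : set S) (F1 z).
Proof.
move=> [_ [k Kk <-] <-]; have nk := SK1A (imageP Some Kk).
have := W1G1 nk; have := F1W1 nk; rewrite /= => -> h; split=> //; exists k => //.
Qed.

Let closed_SK' : closed SK'.
Proof.
rewrite (_ : SK' = W1S @` (Some @` K1)); last by rewrite !image_comp.
apply: closed_imageS; first exact: closed_some.
by move=> x Kx; exact: cW1 (SK1A Kx).
Qed.

Let near_K' z : ~ SK' z -> nbhs z (~` SK').
Proof. by move=> nz; apply: open_nbhs_nbhs; split; [exact: closed_openC|exact: nz]. Qed.

Let G'nK z : G' z -> ~ SK' (F' z) := op_range op (z := z).
Let W'F' z : G' z -> W'S (F' z) = z := op_invl op (z := z).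
Let W'G' z : ~ SK' z -> G' (W'S z). Proof. by move=> /(op_inv op)[]. Qed.
Let F'W' z : ~ SK' z -> F' (W'S z) = z. Proof. by move=> /(op_inv op)[]. Qed.
Let cW' (z : S) : ~ SK' z -> {for z, continuous W'S} := op_continuous op (z := z).
Let cF' (z : S) : G' z -> {for z, continuous F'}.
Proof. by move=> /(op_conformal op)[]. Qed.
Let oG' : open G'. Proof. by case: (op_domain op). Qed.

Let F := F1 \o F'.
Let G : set S := [set z | G' z /\ G1 (F' z)].
Let W := W' \o W1.
Let K := A `|` K1.

Let nK z : ~ (Some @` K : set S) z <-> ~ SA z /\ ~ SK' (W1S z).
Proof.
split=> [nz|[nA nK] [k [Ak|Kk] kz]].
- have nA : ~ SA z by move=> [k Ak kz]; apply: nz; exists k => //; left.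
  split=> // /K'G1 [_]; rewrite F1W1// => -[k Kk kz].
  by apply: nz; exists k => //; right.
- by apply: nA; exists k.
- by apply: nK; rewrite -kz; exists (W1 k) => //; exists k.
Qed.

Let oG : open G.
Proof.
rewrite openE => z [G'z G1z].
have n1 : nbhs z (F' @^-1` G1) by apply: cF' => //; exact: open_nbhs_nbhs.
by apply: filterS2 (open_nbhs_nbhs (conj oG' G'z)) n1 => y; split.
Qed.

Let cW'on (B : set S) : (forall z, B z -> ~ SK' z) -> {within B, continuous W'S}.
Proof. by move=> BK; apply: within_continuousS => x /BK; exact: cW'. Qed.

(* G is the image under the continuous map W' of what remains of G1 after
   removing the other, already transported, arcs. *)
Let GE : G = W'S @` (G1 `\` SK').
Proof.
apply/seteqP; split=> [z [G'z G1z]|_ [z [G1z nz] <-]].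
  by exists (F' z); [split=> //; exact: G'nK|exact: W'F'].
by split; [exact: W'G'|rewrite F'W'].
Qed.

Let G1nK' z : ~ G1 z -> ~ SK' z. Proof. by move=> nG /K'G1[]. Qed.

Let curve_nG1 z : arc_curve g z -> ~ G1 z.
Proof. by move=> cz /arc_domain_curve. Qed.

Let closure_G1 z : closure G1 z -> ~ G1 z -> arc_curve g z.
Proof.
by move=> cz nz; rewrite -(boundary_arc_domain ao) boundary_open.
Qed.

Let curve_closure_G1 z : arc_curve g z -> closure G1 z.
Proof. by rewrite -(boundary_arc_domain ao) boundary_open// => -[]. Qed.

(* G1 minus SK' is one side of the arc curve inside the connected set ~` SK'. *)
Let cG : connected G.
Proof.
rewrite GE; apply: connected_continuous_connected; last first.
  by apply: cW'on => z [].
have [c [cE _ _]] := ao_curve ao.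
apply: (@connected_one_side S (~` SK') (G1 `\` SK') (arc_curve g)).
(* The sphere minus the other arcs is connected because F' maps the domain G' onto it. *)
- rewrite (_ : ~` SK' = F' @` G').
    apply: connected_continuous_connected; first by case: (op_domain op).
    by apply: within_continuousS => x; exact: cF'.
  apply/seteqP; split=> [z nz|_ [z Gz <-]]; last exact: G'nK.
  by exists (W'S z); [exact: W'G'|exact: F'W'].
- exact: closed_openC.
- by apply: openI => //; exact: closed_openC.
- by move=> z [].
- by move=> z /curve_nG1; exact: G1nK'.
- exact: (ao_connected ao).
- exists (Some 1); apply: (@jouS_fixed R g).
  by rewrite /= oner_eq0 invr1.
- by rewrite -subset0 => z [/curve_nG1 nz [/nz]].
- move=> z cz U nU; have nz := G1nK' (curve_nG1 cz).
  have nK'z : nbhs z (~` SK') := near_K' nz.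
  have [y [G1y [Uy ny]]] := curve_closure_G1 cz (filterI nU nK'z).
  by exists y.
- move=> z [cz nz]; have [G1z|nG] := pselect (G1 z); first by left.
  by right; apply: closure_G1 nG; apply: closure_subset cz => ? [].
- move=> z cz U nU; have nz := G1nK' (curve_nG1 cz).
  have nK'z : nbhs z (~` SK') := near_K' nz.
  have [V [B [nV cB BU VB]]] := arc_one_sided ao cz (filterI nU nK'z).
  exists V, B; split=> //; first by move=> y /BU [[Uy ny] Gy].
  by move=> y [Vy [Gy _]]; exact: VB.
Qed.

(** What the current arc adds to the complement of the domain: a copy of the complement of G1, which
    misses SK', so that W' is continuous on it. *)
Let side : set S := W'S @` (~` G1).

Let closed_side : closed side.
Proof.
apply: closed_imageS; first exact: open_closedC.
by move=> x /G1nK'; exact: cW'.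
Qed.

Let sideG' z : side z <-> G' z /\ ~ G1 (F' z).
Proof.
split=> [[y nG <-]|[Gz nG]].
  by rewrite F'W'; [split=> //; exact/W'G'/G1nK'|exact: G1nK'].
by exists (F' z) => //; exact: W'F'.
Qed.

Let nGE z : ~ G z <-> ~ G' z \/ side z.
Proof.
split=> [nz|[nz [/nz]//|/sideG' [_ nz] [_ /nz]//]].
have [Gz|] := pselect (G' z); last by left.
by right; apply/sideG'; split=> // G1z; apply: nz; split.
Qed.

Let G'N : G' None := op_domain_inf op.

Let sideN : ~ side None.
Proof. by move=> /sideG' [_]; rewrite (op_inf op) => nN; exact/nN/arc_domain_inf. Qed.

(** The complement of G is the disjoint union of two closed sets: the complement of G', which has n
    components, and the connected nonempty [side]. *)
Let components_G : (components [set z : C | ~ G (Some z)] #= `I_n.+1)%card.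
Proof.
rewrite (_ : [set z : C | ~ G (Some z)] = [set z | ~ G' (Some z)] `|` [set z | side (Some z)]); last first.
  by apply/seteqP; split=> z /=; rewrite nGE.
apply: card_components_setU; last exact: op_components op.
- apply: compact_closed; first exact: hausdorffC.
  exact: compact_complement.
- have := @closed_comp C S Some side.
  move=> h; apply: h; last exact: closed_side.
  by move=> z _; exact: one_point_compactification_some_continuous.
- by rewrite -subset0 => z /= [nz /sideG' [/nz]].
- apply: connected_finite_part => //; apply: connected_continuous_connected.
    exact: (connected_arc_domainC ao).
  by apply: cW'on => z; exact: G1nK'.
- have c1 : arc_curve g (Some 1).
    by apply: (@jouS_fixed R g); rewrite /= oner_eq0 invr1.
  by exists (W' 1) => /=; exists (Some 1) => //; exact: curve_nG1.
Qed.

(** The two parts do not interfere: [side] is closed and contained in G', so G and G' coincide near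
    each point outside G'. *)
Let boundary_G : boundary G = boundary G' `|` W'S @` arc_curve g.
Proof.
rewrite !boundary_open//; apply/seteqP; split=> z.
- move=> [cz /nGE [nz|/sideG' [Gz nG]]].
    by left; split=> //; apply: closure_subset cz => ? [].
  right; exists (F' z); last exact: W'F'.
  apply: closure_G1 nG => U nU; have := cF' Gz nU => /cz [y [[_ Gy] Uy]].
  by exists (F' y).
- move=> [[cz nz]|[y cy <-]]; last first.
    have nG := curve_nG1 cy; have nk := G1nK' nG; split.
      move=> U nU0; have nU : nbhs y (fun v => U (W'S v)) := cW' nk nU0.
      have nK'y : nbhs y (~` SK') := near_K' nk.
      have [x [Gx [Ux nx]]] := curve_closure_G1 cy (filterI nU nK'y).
      by exists (W'S x); split=> //; rewrite GE; exists x.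
    by move=> [_]; rewrite F'W'.
  split; last by move=> [/nz].
  move=> U nU; have nside : ~ side z by move=> /sideG' [/nz].
  have ns : nbhs z (~` side) by apply: open_nbhs_nbhs; split=> //; exact: closed_openC.
  have [y [Gy [Uy ny]]] := cz _ (filterI nU ns).
  exists y; split=> //; apply: contrapT => /nGE [/(_ Gy)//|/ny//].
Qed.

Let step_curve reg : preserves_off K' W' reg -> forall c, arc_curve g = Some @` c ->
  jordan_curve reg c -> finite_union_of (jordan_curve reg) (boundary G') ->
  finite_union_of (jordan_curve reg) (boundary G).
Proof.
move=> pW c cE jc fu; rewrite boundary_G.
rewrite (_ : W'S @` _ = Some @` (W' @` c)); last by rewrite cE !image_comp.
apply: finite_union_ofU fu _; apply: image_smooth_curve pW _ jc; first exact: op_inj op.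
rewrite -subset0 => z [cz Kz]; apply: (@G1nK' (Some z)); last by exists z.
by apply: curve_nG1; rewrite cE; exists z.
Qed.

Lemma opening_step : opening K n.+1 F G W.
Proof.
have [c [cE smc _]] := ao_curve ao.
have nA z : ~ K z -> ~ A z by move=> nz Az; apply: nz; left.
have nK1 z : ~ K z -> ~ K' (W1 z).
  move=> nz; have [_ h] := (nK (Some z)).1 (ltac:(move=> [k Kk [kz]]; apply: nz; rewrite -kz; exact: Kk)).
  by move=> Kz; apply: h; exists (W1 z).
have WS : omap W = W'S \o W1S by apply/funext; case.
have preserve reg : preserves_off A W1 reg -> preserves_off K' W' reg -> preserves_off K W reg.
  move=> p1 p' D f nf rf; apply: (p' D (W1 \o f)); first by move=> t /nf; exact: nK1.
  by apply: p1 rf => t /nf; exact: nA.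
split.
- exact: rational_jouS ig (op_rational op) (op_inf op).
- by rewrite /F /= (op_inf op).
- split; [exact: oG|exact: cG|exists None].
  by split=> //; rewrite (op_inf op); exact: arc_domain_inf.
- by split=> //; rewrite (op_inf op); exact: arc_domain_inf.
- exact: components_G.
- move=> z [G'z G1z]; apply/nK; rewrite /F /= W1F1//.
  by split; [exact: G1nA|exact: G'nK].
- by move=> z [G'z G1z]; rewrite WS /F /= W1F1// W'F'.
- move=> z /nK [nz nW]; rewrite WS /F /= F'W'// F1W1//; split=> //.
  by split; [exact: W'G'|rewrite F'W'//; exact: W1G1].
- move=> z [G'z G1z]; apply: conformal_at_comp; first exact: (op_conformal op G'z).
  exact: (conformal_at_jouS ig G1z).
- move=> z /nK [nz nW]; rewrite WS; apply: continuous_comp; first exact: cW1.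
  exact: cW'.
- exact: (step_curve (op_C1 op) cE smc (op_smooth op)).
- by apply: preserve; [rewrite AE; exact: (open_up_C1 cg ig)|exact: op_C1 op].
- by apply: preserve; [rewrite AE; exact: (open_up_C2 cg ig)|exact: op_C2 op].
- by apply: preserve; [rewrite AE; exact: (open_up_analytic cg ig)|exact: op_analytic op].
Qed.

Lemma opening_step_analytic : analytic_jordan_arc A ->
  finite_union_of (@analytic_jordan_curve R) (boundary G') ->
  finite_union_of (@analytic_jordan_curve R) (boundary G).
Proof.
move=> aA fu; have [c [cE _ ac]] := ao_curve ao.
exact: (step_curve (op_analytic op) cE (ac aA) fu).
Qed.

End Step.

Section Induction.
Variable R : realType.
Local Notation C := (R[i]).

Lemma preserves_jordan_arc (K : set C) (W : C -> C) reg (c : set C) :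
  (forall z w, ~ K z -> ~ K w -> W z = W w -> z = w) -> preserves_off K W reg ->
  c `&` K = set0 -> jordan_arc reg c -> jordan_arc reg (W @` c).
Proof.
move=> injW pW cK [a [b [f [ab injf rf cE]]]].
have nK t : `[a, b]%classic t -> ~ K (f t).
  by move=> It Kf; rewrite -[False]/(set0 (f t)) -cK; split=> //; rewrite cE; exists t.
exists a, b, (W \o f); split=> //.
- move=> s t; rewrite !inE => Is It h; apply: injf; rewrite ?inE//.
  by apply: injW h; exact: nK.
- by apply: pW rf => t It; exact: nK.
- by rewrite cE image_comp.
Qed.

Lemma bigcup_ord_recl T m (B : 'I_m.+1 -> set T) :
  \bigcup_j B j = B ord0 `|` \bigcup_j B (lift ord0 j).
Proof.
apply/seteqP; split=> [z [j _]|z [gz|[j _ gz]]]; last 2 first.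
- by exists ord0.
- by exists (lift ord0 j).
by case: (unliftP ord0 j) => [i ->|->] gz; [right; exists i|left].
Qed.

Lemma compact_bigcup_ord (T : topologicalType) m (B : 'I_m -> set T) :
  (forall j, compact (B j)) -> compact (\bigcup_j B j).
Proof.
elim: m B => [|m IH] B cB.
  by rewrite (_ : \bigcup_j _ = set0); [exact: compact0|rewrite -subset0 => z [[]]].
by rewrite bigcup_ord_recl; apply: compactU; [|apply: IH].
Qed.

Lemma opening_ex (k0 : nat) (gamma : 'I_k0 -> set C) :
  (forall j, C2_jordan_arc (gamma j)) ->
  (forall j k, j != k -> gamma j `&` gamma k = set0) ->
  exists F G W, opening (\bigcup_j gamma j) k0 F G W /\
   ((forall j, analytic_jordan_arc (gamma j)) ->
     finite_union_of (@analytic_jordan_curve R) (boundary G)).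
Proof.
elim: k0 gamma => [|k0 IH] gamma C2g dis.
  exists id, setT, id; split; last by move=> _; rewrite boundary_setT; exact: finite_union_of_set0.
  rewrite (_ : \bigcup_j _ = set0); first exact: opening_set0.
  by rewrite -subset0 => z [[]].
have [g ao] := arc_opening_ex (C2g ord0).
have cg := ao_continuous ao; have ig := ao_inj ao; have AE := ao_set ao.
have injW z w : ~ gamma ord0 z -> ~ gamma ord0 w -> open_up g z = open_up g w -> z = w.
  rewrite AE => nz nw e; rewrite -(open_upK cg ig nz) -(open_upK cg ig nw).
  by rewrite e.
have dis0 (j : 'I_k0) : gamma (lift ord0 j) `&` gamma ord0 = set0 by apply: dis.
have [||F' [G' [W' [op an]]]] := IH (fun j => open_up g @` gamma (lift ord0 j)).
- move=> j; apply: (preserves_jordan_arc injW _ (dis0 j) (C2g _)).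
  by rewrite AE; exact: (open_up_C2 cg ig).
- move=> j k jk; rewrite -subset0 => _ [[z gz <-] [w gw /esym e]].
  have nz l x : gamma (lift ord0 l) x -> ~ gamma ord0 x.
    by move=> h h'; rewrite -[False]/(set0 x) -(dis0 l).
  have zw := injW _ _ (nz _ _ gz) (nz _ _ gw) e.
  rewrite -[set0 _]/(set0 z) -(dis (lift ord0 j) (lift ord0 k)); last by rewrite (inj_eq lift_inj).
  by split=> //; rewrite zw.
pose K1 := \bigcup_(j : 'I_k0) gamma (lift ord0 j).
have op1 : opening (open_up g @` K1) k0 F' G' W' by rewrite /K1 image_bigcup.
have cK1 : compact K1.
  apply: compact_bigcup_ord => j; have [h aoh] := arc_opening_ex (C2g (lift ord0 j)).
  by rewrite (ao_set aoh); apply: compact_arc; exact: (ao_continuous aoh).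
have AK1 : gamma ord0 `&` K1 = set0.
  rewrite -subset0 => z [gz [j _ gjz]].
  by rewrite -[set0 z]/(set0 z) -(dis0 j).
have st := opening_step ao cK1 AK1 op1.
eexists _, _, _; split; first by rewrite bigcup_ord_recl; exact: st.
move=> aall; apply: (opening_step_analytic ao cK1 AK1 op1 (aall ord0)).
apply: an => j; apply: (preserves_jordan_arc injW _ (dis0 j) (aall _)).
by rewrite AE; exact: (open_up_analytic cg ig).
Qed.

End Induction.

Theorem proposition5 (R : realType) (k0 : nat) (gamma : 'I_k0 -> set R[i])
    (K : set R[i])
    (hgamma : forall j, C2_jordan_arc (gamma j))
    (hdisj : forall j k, j != k -> gamma j `&` gamma k = set0)
    (hK : K = \bigcup_j gamma j) :
  exists (F : Cinf R -> Cinf R) (G : set (Cinf R)),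
    [/\ [/\ rational_function F, domain G & G None],
        compact [set z : R[i] | ~ G (Some z)] /\
          (components [set z : R[i] | ~ G (Some z)] #= `I_k0)%card,
        boundary (~` G) = boundary G /\
          finite_union_of (@smooth_jordan_curve R) (boundary G),
        conformal_bijection F G (~` (Some @` K)) /\ F None = None &
        (forall j, analytic_jordan_arc (gamma j)) ->
          finite_union_of (@analytic_jordan_curve R) (boundary G)].
Proof.
have [F [G [W [op an]]]] := opening_ex hgamma hdisj; rewrite -hK in op.
have [oG _ _] := op_domain op.
exists F, G; split.
- by split; [exact: op_rational op|exact: op_domain op|exact: op_domain_inf op].
- by split; [exact: compact_complement oG (op_domain_inf op)|exact: op_components op].
- by split; [exact: boundary_setC|exact: op_smooth op].
- split; last exact: op_inf op.
  split; last exact: op_conformal op.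
  split.
  + exact: op_range op.
  + by move=> z w; rewrite !inE => Gz Gw e; rewrite -(op_invl op Gz) e (op_invl op Gw).
  + by move=> z /(op_inv op) [Gz zE]; exists (omap W z).
- exact: an.
Qed.
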